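(* Let $n\ge1$ and $k\in\{1,\ldots,n\}$. For every $u\in S(\mathbb{R}^n_{k,+})$, $u\not\equiv0$, with $$\alpha=\left(\frac{\int_{\mathbb{R}^n_{k,+}}|x|^2|u(x)|^2dx}{\int_{\mathbb{R}^n_{k,+}}|\nabla u(x)|^2dx}\right)^{1/4},$$ one has $$\left(\int_{\mathbb{R}^n_{k,+}}|\nabla u(x)|^2dx\right)^{1/2}\left(\int_{\mathbb{R}^n_{k,+}}|u(x)|^2|x|^2dx\right)^{1/2}-\frac{n+2k}{2}\int_{\mathbb{R}^n_{k,+}}|u(x)|^2dx-\inf_{c\in\mathbb{R}}\int_{\mathbb{R}^n_{k,+}}\left|u(x)-c\,e^{-\frac{1}{2\alpha^2}|x|^2}\prod_{i=n-k+1}^{n}x_i\right|^2dx$$ $$\ge\inf_{c\in\mathbb{R},\,\mathbf d\in\mathbb{R}^{n-k}\times\{0\}^k}\int_{\mathbb{R}^n_{k,+}}\left|u(x)-(c+\mathbf d\cdot x)\,e^{-\frac{1}{2\alpha^2}|x|^2}\prod_{i=n-k+1}^{n}x_i\right|^2dx.$$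
   Context: $\mathbb{R}^n_{k,+}:=\mathbb{R}^{n-k}\times(0,\infty)^k$. $S(\mathbb{R}^n_{k,+})$ is the completion of $C_c^\infty(\mathbb{R}^n_{k,+})$ (smooth functions with compact support in the open orthant) under the norm $\left(\int_{\mathbb{R}^n_{k,+}}|\nabla u|^2dx\right)^{1/2}+\left(\int_{\mathbb{R}^n_{k,+}}|x|^2|u|^2dx\right)^{1/2}$. Functions are real-valued. *)

(* Defs.v *)
From HB Require Import structures.
From mathcomp Require Import all_boot all_order all_algebra.
From mathcomp Require Import all_classical all_reals all_analysis.

Set Implicit Arguments.
Unset Strict Implicit.
Unset Printing Implicit Defensive.

Import Order.TTheory GRing.Theory Num.Theory numFieldNormedType.Exports.

Local Open Scope classical_set_scope.
Local Open Scope ring_scope.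

Definition rV_display : measure_display.
Proof. exact: default_measure_display. Qed.

(* The sigma-algebra on 'rV[R]_n generated by the coordinates, i.e. the product
   of the Borel sigma-algebras of R; this is the Borel sigma-algebra of R^n. *)
Section measurable_rV.
Context (R : realType) (n : nat).

Let coord (i : 'I_n) (x : 'rV[R]_n) : measurableTypeR R := x ord0 i.

Let rV_set0 : g_sigma_preimage coord set0.
Proof. exact: sigma_algebra0. Qed.

Let rV_setC A : g_sigma_preimage coord A -> g_sigma_preimage coord (~` A).
Proof. exact: sigma_algebraC. Qed.

Let rV_bigcup (F : _^nat) : (forall i, g_sigma_preimage coord (F i)) ->
  g_sigma_preimage coord (\bigcup_i (F i)).
Proof. exact: sigma_algebra_bigcup. Qed.

HB.instance Definition _ := @isMeasurable.Build rV_display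
  'rV[R]_n (g_sigma_preimage coord) rV_set0 rV_setC rV_bigcup.

End measurable_rV.

Section lebesgue_rV.
Context (R : realType).
Local Open Scope ereal_scope.

Definition row_cons n (p : R * 'rV[R]_n) : 'rV[R]_n.+1 :=
  (\row_i if unlift ord0 i is Some j then p.2 ord0 j else p.1)%R.

Lemma measurable_coord n (i : 'I_n) :
  measurable_fun [set: 'rV[R]_n] (fun x => x ord0 i : measurableTypeR R).
Proof.
move=> _ Y mY; rewrite setTI; apply: sub_sigma_algebra => /=.
rewrite -bigcup_seq/=; exists i => /=; first by rewrite mem_index_enum.
by exists Y => //; rewrite setTI.
Qed.

Lemma measurable_fun_coordP d (T : measurableType d) n (f : T -> 'rV[R]_n) :
  measurable_fun [set: T] f <->
  forall i, measurable_fun [set: T] (fun t => f t ord0 i : measurableTypeR R).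
Proof.
split=> [mf i|mf].
  exact: (measurableT_comp (measurable_coord i) mf).
pose coord i (x : 'rV[R]_n) : measurableTypeR R := x ord0 i.
move=> _ B mB.
have : preimage_set_system [set: T] f (g_sigma_preimage coord)
    ([set: T] `&` f @^-1` B) by exists B.
rewrite -g_sigma_preimage_comp.
apply: smallest_sub; first exact: sigma_algebra_measurable.
move=> A; rewrite -bigcup_seq/= => -[i _ [C mC <-]].
exact: mf.
Qed.

Lemma measurable_row_cons n :
  measurable_fun [set: measurableTypeR R * 'rV[R]_n] (@row_cons n).
Proof.
apply/measurable_fun_coordP => i.
under eq_fun do rewrite mxE.
case: (unliftP ord0 i) => [j _|_]; last exact: measurable_fst.
exact: (measurableT_comp (measurable_coord j) measurable_snd).
Qed.

Section cons_measure.
Context (n : nat) (mu : {sigma_finite_measure set 'rV[R]_n -> \bar R}).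

Let leb : {sigma_finite_measure set (measurableTypeR R) -> \bar R} :=
  lebesgue_measure.

Definition cons_measure : set 'rV[R]_n.+1 -> \bar R :=
  pushforward (leb \x mu) (@row_cons n).

Let cons_measure0 : cons_measure set0 = 0.
Proof. by rewrite /cons_measure /pushforward preimage_set0 measure0. Qed.

Let cons_measure_ge0 A : 0 <= cons_measure A.
Proof. by rewrite /cons_measure /pushforward measure_ge0. Qed.

Let mpre A : measurable A -> measurable (@row_cons n @^-1` A).
Proof. by move=> mA; rewrite -[X in measurable X]setTI; exact: measurable_row_cons. Qed.

Let cons_measure_sigma_additive : semi_sigma_additive cons_measure.
Proof.
move=> F mF tF mUF; rewrite /cons_measure /pushforward preimage_bigcup.
apply: measure_semi_sigma_additive.
- by move=> i; exact: mpre.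
- apply/trivIsetP => /= i j _ _ ij; rewrite -preimage_setI.
  by move/trivIsetP : tF => /(_ _ _ _ _ ij) ->//; rewrite preimage_set0.
- by rewrite -preimage_bigcup; exact: mpre.
Qed.

HB.instance Definition _ := isMeasure.Build _ _ _ cons_measure
  cons_measure0 cons_measure_ge0 cons_measure_sigma_additive.

Let cons_measure_sigma_finite : sigma_finite [set: 'rV[R]_n.+1] cons_measure.
Proof.
have /sigma_finiteP[F [TF ndF Foo]] := sigma_finiteT leb.
have /sigma_finiteP[G [TG ndG Goo]] := sigma_finiteT mu.
pose split (x : 'rV[R]_n.+1) : measurableTypeR R * 'rV[R]_n :=
  (x ord0 ord0, (\row_j x ord0 (lift ord0 j))%R).
have msplit : measurable_fun [set: 'rV[R]_n.+1] split.
  apply/measurable_fun_pairP; split; first exact: measurable_coord.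
  apply/measurable_fun_coordP => j; rewrite /split/=.
  under eq_fun do rewrite mxE.
  exact: measurable_coord.
have consK p : split (row_cons p) = p.
  case: p => a v; rewrite /split /row_cons mxE unlift_none; congr pair.
  by apply/rowP => j; rewrite !mxE liftK.
exists (fun i => split @^-1` (F i `*` G i)).
  apply/seteqP; split=> // x _.
  have [i _ Fi] : (\bigcup_i F i) (split x).1 by rewrite -TF.
  have [j _ Gj] : (\bigcup_i G i) (split x).2 by rewrite -TG.
  exists (maxn i j) => //; split.
    by apply: (subsetPset _ _ (ndF _ _ (leq_maxl i j))).
  by apply: (subsetPset _ _ (ndG _ _ (leq_maxr i j))).
move=> i; have [mFi Fioo] := Foo i; have [mGi Gioo] := Goo i; split.
  by rewrite -[X in measurable X]setTI; apply: msplit => //; exact: measurableX.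
rewrite /cons_measure /pushforward.
rewrite -comp_preimage (_ : split \o _ = id) ?preimage_id; last exact/funext.
by rewrite product_measure1E// lte_mul_pinfty// ge0_fin_numE.
Qed.

HB.instance Definition _ := Measure_isSigmaFinite.Build _ _ _ cons_measure
  cons_measure_sigma_finite.

End cons_measure.

(* Lebesgue measure on R^n, as the n-fold product of Lebesgue measure on R
   transported by R * R^n -> R^(n+1); R^0 has mass 1. *)
Fixpoint lebesgue_rV n : {sigma_finite_measure set 'rV[R]_n -> \bar R} :=
  match n with
  | 0 => \d_ (0%R : 'rV[R]_0)
  | m.+1 => cons_measure (lebesgue_rV m)
  end.

End lebesgue_rV.

Section heisenberg.
Context (R : realType).
Local Open Scope ereal_scope.

Definition rV_dot n (x y : 'rV[R]_n) : R := (\sum_i x ord0 i * y ord0 i)%R.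

(* The squared Euclidean norm; the library's `|x| on 'rV[R]_n is the sup norm. *)
Definition sqnorm n (x : 'rV[R]_n) : R := rV_dot x x.

(* R^(n-k) x (0, +oo)^k: coordinates are numbered from 0, so the last k ones
   are those with n - k <= i. *)
Definition orthant n k : set 'rV[R]_n :=
  [set x | forall i : 'I_n, (n - k <= i)%N -> (0 < x ord0 i)%R].

Definition partial n (i : 'I_n) (f : 'rV[R]_n -> R) : 'rV[R]_n -> R :=
  fun x => 'D_(delta_mx ord0 i) f x.

Definition grad n (f : 'rV[R]_n -> R) : 'rV[R]_n -> 'rV[R]_n :=
  fun x => (\row_i partial i f x)%R.

Definition smooth n (f : 'rV[R]_n -> R) : Prop :=
  forall (s : seq 'I_n) (x : 'rV[R]_n),
    differentiable (foldr (@partial n) f s) x.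

(* C_c^oo(U), each function being extended by 0 to R^n. *)
Definition test_function n (U : set 'rV[R]_n) (f : 'rV[R]_n -> R) : Prop :=
  let supp := closure [set x | f x != 0%R] in
  [/\ smooth f, compact supp & supp `<=` U].

Definition locally_integrable_rV n (U : set 'rV[R]_n) (f : 'rV[R]_n -> R) :=
  [/\ measurable_fun U f, open U &
    forall K, K `<=` U -> compact K ->
      \int[lebesgue_rV R n]_(x in K) `|f x|%:E < +oo].

Definition weak_gradient n (U : set 'rV[R]_n) (u : 'rV[R]_n -> R)
    (g : 'rV[R]_n -> 'rV[R]_n) : Prop :=
  [/\ locally_integrable_rV U u,
      forall i, locally_integrable_rV U (fun x => g x ord0 i) &
      forall f, test_function U f -> forall i,
        \int[lebesgue_rV R n]_(x in U) (u x * partial i f x)%:E =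
        - \int[lebesgue_rV R n]_(x in U) (g x ord0 i * f x)%:E].

Definition dirichlet n k (g : 'rV[R]_n -> 'rV[R]_n) : \bar R :=
  \int[lebesgue_rV R n]_(x in orthant k) (sqnorm (g x))%:E.

Definition moment n k (u : 'rV[R]_n -> R) : \bar R :=
  \int[lebesgue_rV R n]_(x in orthant k) (sqnorm x * u x ^+ 2)%:E.

Definition S_norm n k (u : 'rV[R]_n -> R) (g : 'rV[R]_n -> 'rV[R]_n) : \bar R :=
  dirichlet k g `^ 2^-1 + moment k u `^ 2^-1.

(* [in_S k u g]: u is in S(R^n_{k,+}) and g is its weak gradient.
   The norm controls L^2_loc of the open orthant (0 is not in it when 0 < k), so
   the completion of C_c^oo is its closure among the weakly differentiable
   functions. As usual u and g are representatives modulo null sets. *)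
Definition in_S n k (u : 'rV[R]_n -> R) (g : 'rV[R]_n -> 'rV[R]_n) : Prop :=
  weak_gradient (orthant k) u g /\
  exists f : nat -> 'rV[R]_n -> R,
    (forall j, test_function (orthant k) (f j)) /\
    S_norm k (fun x => u x - f j x)%R (fun x => g x - grad (f j) x)%R
      @[j --> \oo] --> 0.

Definition gauss_monomial n k (alpha : R) (x : 'rV[R]_n) : R :=
  (expR (- (2 * alpha ^+ 2)^-1 * sqnorm x)
   * \prod_(i < n | (n - k <= i)%N) x ord0 i)%R.

End heisenberg.

(* Main.v *)
(* Write [a = alpha ^+ 2]. For a test function, the deficit splits over the
   coordinates as the sum of the squared norms of [annih_i u], where [annih_i]
   is the annihilation operator of the harmonic oscillator on the line, or on
   the half line with Dirichlet condition. In one variable, the oscillator on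
   the line has gaps 1 and 2 above its first two eigenvalues, and on the half
   line its first gap is 2. Tensorising over the coordinates by Fubini bounds
   the sum below by twice the squared norm of [u], minus twice the squared
   component along the ground state and the squared components along the states
   with a single excitation. Since the ground state is a multiple of
   [gauss_monomial], and the other states are multiples of [x_i] times it, these
   are the two distances in the statement. The one-dimensional gaps come from
   Jacobi's factorisation by the eigenfunction whose nodes are the zeros of the
   function to be estimated, without any completeness of Hermite functions.
   Density passes the inequality to [S]: the uncertainty principle itself,
   applied to differences of test functions, gives the convergence in [L2]. *)
From HB Require Import structures.
Require Import Defs.
From mathcomp Require Import all_boot all_order all_algebra.
From mathcomp Require Import all_classical all_reals all_analysis.
From mathcomp Require Import measurable_realfun ring lra zify.

Set Implicit Arguments.
Unset Strict Implicit.
Unset Printing Implicit Defensive.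

Import Order.TTheory GRing.Theory Num.Theory numFieldNormedType.Exports.

Local Open Scope classical_set_scope.
Local Open Scope ring_scope.

(** * Integration and Gaussian weights *)

(** Write [c_0] and [c_i] for the components of [u] along the ground state and along the single
    excitations. The two infima are at most [|u|^2 - c_0^2] and [|u|^2 - c_0^2 - sum c_i^2], so
    their sum is controlled by the quadratic form with eigenvalue [min(|m|, 2)] on the states of
    total excitation [|m|], while the deficit has eigenvalue [|m|]; this explains the weights 2, 2
    and 1. The comparison stays at the level of quadratic forms on compactly supported functions
    that are C^1 along the coordinate lines: Bessel's inequality stands in for Parseval's identity,
    and the induction on the dimension works because the coefficient of such a function, taken in
    all variables but one, is again such a function of the remaining variable. On a half line the
    operator contains [1 / x], harmless because supports stay away from 0. Ground states there are
    extended by 0, so that integrals run over all of R^n. The value of [alpha] comes from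
    [(a D + M / a) / 2], with [D] the Dirichlet integral and [M] the moment: it is minimal at
    [a = sqrt(M / D)], where it equals the product of the two square roots. *)

Section real_integral.
Context d (T : measurableType d) (R : realType) (mu : {measure set T -> \bar R}).
Implicit Types f g : T -> R.

Definition Rintegrable f := mu.-integrable [set: T] (EFin \o f).

Lemma Rintegrable_measurable f : Rintegrable f -> measurable_fun [set: T] f.
Proof. by move=> /integrableP[/measurable_EFinP]. Qed.

Lemma RintegrableD f g : Rintegrable f -> Rintegrable g ->
  Rintegrable (fun x => f x + g x).
Proof.
move=> intf intg; rewrite /Rintegrable /comp; under eq_fun do rewrite EFinD.
exact: integrableD.
Qed.

Lemma RintegrableZ k f : Rintegrable f -> Rintegrable (fun x => k * f x).
Proof.
move=> intf; rewrite /Rintegrable /comp; under eq_fun do rewrite EFinM.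
exact: integrableZl.
Qed.

Lemma RintegrableB f g : Rintegrable f -> Rintegrable g ->
  Rintegrable (fun x => f x - g x).
Proof.
move=> intf intg; rewrite /Rintegrable /comp; under eq_fun do rewrite EFinB.
exact: integrableB.
Qed.

Lemma Rintegrable0 : Rintegrable (fun=> 0).
Proof. exact: integrable0. Qed.

Lemma Rintegrable_sum (I : eqType) (s : seq I) (F : I -> T -> R) :
  (forall i, Rintegrable (F i)) -> Rintegrable (fun x => \sum_(i <- s) F i x).
Proof.
move=> intF; elim: s => [|i s IH].
  by under eq_fun do rewrite big_nil; exact: Rintegrable0.
by under eq_fun do rewrite big_cons; exact: RintegrableD.
Qed.

Lemma RintD f g : Rintegrable f -> Rintegrable g ->
  \int[mu]_x (f x + g x) = \int[mu]_x f x + \int[mu]_x g x.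
Proof. by move=> *; exact: RintegralD. Qed.

Lemma RintB f g : Rintegrable f -> Rintegrable g ->
  \int[mu]_x (f x - g x) = \int[mu]_x f x - \int[mu]_x g x.
Proof. by move=> *; exact: RintegralB. Qed.

Lemma RintZ k f : Rintegrable f ->
  \int[mu]_x (k * f x) = k * \int[mu]_x f x.
Proof. by move=> *; exact: RintegralZl. Qed.

Lemma Rint_zero : \int[mu]_x (0 : R) = 0.
Proof. by rewrite /Rintegral integral0. Qed.

Lemma Rint_sum (I : eqType) (s : seq I) (F : I -> T -> R) :
  (forall i, Rintegrable (F i)) ->
  \int[mu]_x (\sum_(i <- s) F i x) = \sum_(i <- s) \int[mu]_x F i x.
Proof.
move=> intF; elim: s => [|i s IH].
  by rewrite big_nil -[RHS]Rint_zero; apply: eq_Rintegral => x _; rewrite big_nil.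
rewrite big_cons -IH -RintD//; last exact: Rintegrable_sum.
by apply: eq_Rintegral => x _; rewrite big_cons.
Qed.

Lemma le_Rint f g : Rintegrable f -> Rintegrable g -> (forall x, f x <= g x) ->
  \int[mu]_x f x <= \int[mu]_x g x.
Proof. by move=> *; exact: le_Rintegral. Qed.

Lemma Rint_ge0 f : (forall x, 0 <= f x) -> 0 <= \int[mu]_x f x.
Proof. by move=> *; exact: Rintegral_ge0. Qed.

Lemma eq_Rint f g : f =1 g -> Rintegral mu [set: T] f = Rintegral mu [set: T] g.
Proof. by move=> fg; apply: eq_Rintegral => x _. Qed.

Lemma EFin_Rint f : Rintegrable f ->
  ((\int[mu]_x f x)%:E = \int[mu]_x (f x)%:E)%E.
Proof. by move=> intf; rewrite fineK//; exact: integrable_fin_num. Qed.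

Lemma le_Rintegrable f g : measurable_fun [set: T] f -> Rintegrable g ->
  (forall x, `|f x| <= g x) -> Rintegrable f.
Proof.
move=> mf intg fg; apply: le_integrable intg => //; first exact/measurable_EFinP.
by move=> x _ /=; rewrite lee_fin (le_trans (fg x))// ler_norm.
Qed.

End real_integral.

Section gaussian_weight.
Context (R : realType).
Implicit Types f g : R -> R.
Notation lam := (@lebesgue_measure R).

(** The class contains the polynomials and is closed under sums and products, so integrability
    against a Gaussian can be read off the shape of the integrand; [pg_auto] does this. *)
Definition polynomial_growth f :=
  measurable_fun [set: R] f /\
  exists C m, forall x, `|f x| <= C * (1 + x ^+ 2) ^+ m.
Notation pg := polynomial_growth.

Let ge1 (x : R) : 1 <= 1 + x ^+ 2. Proof. by rewrite lerDl sqr_ge0. Qed.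

Lemma pg_ex f : pg f -> exists C m, 0 <= C /\ 
  forall x, `|f x| <= C * (1 + x ^+ 2) ^+ m.
Proof.
move=> [_ [C [m Cm]]]; exists `|C|, m; split => // x.
by rewrite (le_trans (Cm x))// ler_wpM2r ?ler_norm// exprn_ge0// (le_trans _ (ge1 x)).
Qed.

Lemma pgD f g : pg f -> pg g -> pg (fun x => f x + g x).
Proof.
move=> pf pg; split; first exact: measurable_funD pf.1 pg.1.
have [C [m [C0 Cm]]] := pg_ex pf; have [D [k [D0 Dk]]] := pg_ex pg.
exists (C + D), (m + k)%N => x; rewrite (le_trans (ler_normD _ _))// mulrDl lerD//.
  by rewrite (le_trans (Cm x))// ler_wpM2l// ler_weXn2l// leq_addr.
by rewrite (le_trans (Dk x))// ler_wpM2l// ler_weXn2l// leq_addl.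
Qed.

Lemma pgM f g : pg f -> pg g -> pg (fun x => f x * g x).
Proof.
move=> pf pg; split; first exact: measurable_funM pf.1 pg.1.
have [C [m [C0 Cm]]] := pg_ex pf; have [D [k [D0 Dk]]] := pg_ex pg.
by exists (C * D), (m + k)%N => x; rewrite normrM exprD mulrACA ler_pM.
Qed.

Lemma pg_bounded f C : measurable_fun [set: R] f -> (forall x, `|f x| <= C) -> pg f.
Proof. by move=> mf fC; split=> //; exists C, 0%N => x; rewrite expr0 mulr1. Qed.

Lemma pg_cst k : pg (fun=> k).
Proof. by apply: (@pg_bounded _ `|k|). Qed.

Lemma pg_id : pg id.
Proof.
split; first exact: measurable_id.
exists 1, 1%N => x; rewrite expr1 mul1r -real_normK ?num_real//=.
by have := sqr_ge0 (`|x| - 1); have := normr_ge0 x; nra.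
Qed.

Lemma pgX n : pg (fun x => x ^+ n).
Proof.
elim: n => [|n IH]; first exact: pg_cst.
under eq_fun do rewrite exprS; exact: pgM pg_id IH.
Qed.

Lemma pgN f : pg f -> pg (fun x => - f x).
Proof.
move=> pf; rewrite (_ : (fun x => _) = (fun x => (-1) * f x)).
  exact: pgM (pg_cst _) pf.
by apply/funext => x; rewrite mulN1r.
Qed.

Section weight.
Variable a : R.
Hypothesis a0 : 0 < a.

(** The square of the ground state of the line, and a multiple of the normal density of variance
    [a / 2]. *)
Definition gauss_weight (x : R) : R := expR (- (x ^+ 2 / a)).
Notation rho := gauss_weight.

Lemma gauss_weight_gt0 x : 0 < rho x. Proof. exact: expR_gt0. Qed.

Lemma is_derive_gauss_weight (x : R) : is_derive x 1 rho (rho x * (- (2 * x / a))).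
Proof.
apply: is_derive_eq.
by rewrite /gauss_weight /GRing.scale/=; ring.
Qed.

Lemma continuous_derivable f (df : R -> R) :
  (forall x : R, is_derive x 1 f (df x)) -> continuous f.
Proof.
move=> dfE x; apply: differentiable_continuous; apply/derivable1_diffP.
by have [] := dfE x.
Qed.

Lemma continuous_gauss_weight : continuous rho.
Proof. exact: continuous_derivable is_derive_gauss_weight. Qed.

Let normal_funE x : normal_fun 0 (Num.sqrt a) x = expR (- (x ^+ 2 / (2 * a))).
Proof.
rewrite /normal_fun subr0 sqr_sqrtr ?ltW// mulNr; congr (expR (- (_ / _))).
by rewrite mulr2n mulr_natl.
Qed.

(** One factor absorbs the polynomial; the other is a multiple of a normal density and keeps the
    product integrable. *)
Let weight_splitE x : rho x = normal_fun 0 (Num.sqrt a) x * normal_fun 0 (Num.sqrt a) x.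
Proof.
rewrite normal_funE /gauss_weight -exp.expRD; congr expR; field.
by rewrite gt_eqF.
Qed.

Let poly_normal_bound m : exists C, forall x,
  (1 + x ^+ 2) ^+ m * normal_fun 0 (Num.sqrt a) x <= C.
Proof.
(* The witness comes from [t^(m+1) / (m+1)! <= e^t] at [t = (1 + x^2) / (2 a)]; the factor
   [e^(1 / (2 a))] pays for the shift by 1. *)
exists ((2 * a) ^+ m.+1 * (m.+1)`!%:R * expR (1 / (2 * a))) => x.
rewrite normal_funE expRN ler_pdivrMr ?expR_gt0// -[leRHS]mulrA -expRD.
have a2 : 0 < 2 * a by rewrite mulr_gt0.
have t0 : 0 <= 1 / (2 * a) + x ^+ 2 / (2 * a).
  by rewrite addr_ge0// divr_ge0// ?sqr_ge0// ltW.
have := expR_ge1Dxn m t0.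
set t := 1 / (2 * a) + _ => Et.
have tE : 1 + x ^+ 2 = 2 * a * t by rewrite /t; field; rewrite gt_eqF.
rewrite (@le_trans _ _ ((1 + x ^+ 2) ^+ m.+1))//; first by rewrite ler_weXn2l.
rewrite tE exprMn -[leRHS]mulrA; apply: ler_wpM2l; first by rewrite exprn_ge0// ltW.
rewrite -ler_pdivrMl ?ltr0n ?fact_gt0//.
by rewrite mulrC (le_trans _ Et)// lerDr.
Qed.

Lemma gauss_weight_pg_bound f : pg f ->
  exists C, forall x, `|rho x * f x| <= C * (normal_fun 0 (Num.sqrt a) x).
Proof.
move=> pf; have [C [m [C0 Cm]]] := pg_ex pf; have [D Dm] := poly_normal_bound m.
exists (C * D) => x; rewrite normrM gtr0_norm ?gauss_weight_gt0// weight_splitE.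
rewrite mulrAC ler_wpM2r ?normal_fun_ge0// mulrC.
rewrite (le_trans (ler_wpM2r (normal_fun_ge0 _ _ _) (Cm x)))// -mulrA.
by rewrite ler_wpM2l.
Qed.

Lemma Rintegrable_gauss_weight f : pg f -> Rintegrable lam (fun x => rho x * f x).
Proof.
move=> pf; have [C fC] := gauss_weight_pg_bound pf.
have s0 : Num.sqrt a != 0 by rewrite gt_eqF// sqrtr_gt0.
apply: (@le_Rintegrable _ _ _ lam _
  (fun x => (C / normal_peak (Num.sqrt a)) * normal_pdf 0 (Num.sqrt a) x)).
- apply: measurable_funM pf.1; exact: continuous_measurable_fun continuous_gauss_weight.
- by apply: RintegrableZ; exact: integrable_normal_pdf.
- move=> x; rewrite (le_trans (fC x))// /normal_pdf (negbTE s0).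
  by rewrite mulrA divfK// gt_eqF// normal_peak_gt0.
Qed.

(** Boundedness of the weight times [x * f x], with one power of [x] to spare, gives decay of order
    [1 / n]. The sign [s] selects the end of the line. *)
Lemma cvg_gauss_weight f (s : R) : pg f -> `|s| = 1 ->
  (rho (s * n%:R) * f (s * n%:R)) @[n --> \oo] --> (0 : R).
Proof.
move=> pf s1; have [C fC] := gauss_weight_pg_bound (pgM (pgX 1) pf).
have {}fC x : `|rho x * (x * f x)| <= C.
  have C0 : 0 <= C.
    have := le_trans (normr_ge0 _) (fC 0); rewrite pmulr_lge0//.
    by rewrite normal_funE expR_gt0.
  rewrite (le_trans (fC x))// ler_piMr// normal_funE -[leRHS](@expR0 R) ler_expR.
  by rewrite oppr_le0 divr_ge0 ?sqr_ge0// mulr_ge0// ltW.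
apply: norm_cvg0; rewrite -cvg_shiftS.
apply: (@squeeze_cvgr _ _ _ _ (cst 0) (fun n => C * n.+1%:R^-1)).
- apply: nearW => n /=; rewrite normr_ge0/= ler_pdivlMr ?ltr0n//.
  rewrite (le_trans _ (fC (s * n.+1%:R)))// !normrM s1 normr_nat.
  by rewrite mul1r [leRHS]mulrA mulrAC.
- exact: cvg_cst.
- rewrite -(mulr0 C); apply: cvgM; first exact: cvg_cst.
  exact: cvg_harmonic.
Qed.

End weight.

Lemma cvg_Rint_restrict (D : set R) (A : nat -> set R) (g : R -> R) :
  measurable D -> (forall n, measurable (A n)) -> Rintegrable lam g ->
  (forall x, \forall n \near \oo, (x \in A n) = (x \in D)) ->
  (\int[lam]_(x in A n) g x) @[n --> \oo] --> \int[lam]_(x in D) g x.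
Proof.
move=> mD mA ig AD.
have mg := Rintegrable_measurable ig.
have mr (E : set (measurableTypeR R)) : measurable E ->
    measurable_fun [set: measurableTypeR R] (g \_ E).
  by move=> mE; apply/(measurable_restrictT _ _).1 => //; exact: measurable_funTS.
have [|||||_ _ +] := @dominated_convergence _ _ _ lam setT measurableT
  (fun n => EFin \o (g \_ (A n))) (EFin \o (g \_ D)) (EFin \o (Num.norm \o g)).
- by move=> n; apply/measurable_EFinP; exact: (mr _ (mA n)).
- by apply/measurable_EFinP; exact: (mr _ mD).
- apply: aeW => x _; apply: cvg_near_cst.
  by apply: filterS (AD x) => n xA; rewrite /= !patchE xA.
- exact: (integrable_norm ig).
- apply: aeW => x n _ /=; rewrite lee_fin patchE; case: ifP => // _.
  by rewrite normr0.
rewrite /= -EFin_Rint; last first.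
  have ing : Rintegrable lam (Num.norm \o g) by exact: integrable_norm.
  apply: (le_Rintegrable (mr _ mD) ing) => x /=.
  by rewrite patchE; case: ifP => // _; rewrite normr0.
move=> /fine_cvg; rewrite [X in _ -> _ --> X]Rintegral_mkcond.
by under [X in _ -> X @ _ --> _]eq_fun do rewrite Rintegral_mkcond.
Unshelve. all: end_near. Qed.

Let Rintegral_segment (G g : R -> R) (u v : R) : u < v ->
  (forall x : R, is_derive x 1 G (g x)) -> continuous g ->
  \int[lam]_(x in `[u, v]) g x = G v - G u.
Proof.
move=> uv dG cg; rewrite /Rintegral (@continuous_FTC2 _ g G)//.
- exact: continuous_subspaceT.
- split=> [x _||]; first by have [] := dG x.
  + by apply: cvg_at_right_filter; exact: (continuous_derivable dG).
  + by apply: cvg_at_left_filter; exact: (continuous_derivable dG).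
- by move=> x _; rewrite derive1E; have [_ ->] := dG x.
Qed.

Lemma Rint_derive_eq0 (G g : R -> R) :
  (forall x : R, is_derive x 1 G (g x)) -> continuous g -> Rintegrable lam g ->
  G n%:R @[n --> \oo] --> (0 : R) -> G (- n%:R) @[n --> \oo] --> (0 : R) ->
  \int[lam]_x g x = 0.
Proof.
move=> dG cg ig G1 G2.
have h : (\int[lam]_(x in `[- (n.+1%:R) : R, n.+1%:R]) g x) @[n --> \oo] -->
    \int[lam]_x g x.
  apply: (@cvg_Rint_restrict [set: R] (fun n => `[- (n.+1%:R) : R, n.+1%:R]%classic) g) => // x.
  near=> n; rewrite in_setT; apply/mem_set => /=.
  rewrite in_itv/= -ler_norml (le_trans (ltW (truncnS_gt _)))// ler_nat ltnS.
  by near: n; exact: nbhs_infty_ge.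
apply: (cvg_unique _ h) => //.
rewrite (_ : (fun _ => _) = (fun n => G n.+1%:R - G (- n.+1%:R))); last first.
  apply/funext => n; apply: Rintegral_segment => //.
  by rewrite (@lt_trans _ _ 0) ?oppr_lt0 ?ltr0n.
rewrite -(subr0 0); apply: cvgB; first by rewrite -cvg_shiftS in G1.
by rewrite -cvg_shiftS in G2.
Unshelve. all: end_near. Qed.

Lemma Rint_derive_halfline (G g : R -> R) :
  (forall x : R, is_derive x 1 G (g x)) -> continuous g -> Rintegrable lam g ->
  G n%:R @[n --> \oo] --> (0 : R) ->
  \int[lam]_(x in [set x | 0 < x]) g x = - G 0.
Proof.
move=> dG cg ig G1.
have -> : [set x : R | 0 < x] = `]0, +oo[%classic.
  by apply/seteqP; split=> x /=; rewrite in_itv/= andbT.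
rewrite Rintegral_itv_obnd_cbnd; last exact: integrableS ig.
have h : (\int[lam]_(x in `[0 : R, n.+1%:R]) g x) @[n --> \oo] -->
    \int[lam]_(x in `[0, +oo[) g x.
  apply: (@cvg_Rint_restrict _ (fun n => `[0 : R, n.+1%:R]%classic) g) => // x.
  near=> n; apply/idP/idP; rewrite !inE/= !in_itv/= ?andbT; first by case/andP.
  move=> x0; rewrite x0/=.
  rewrite (le_trans (ltW (truncnS_gt _)))// ler_nat ltnS.
  by near: n; exact: nbhs_infty_ge.
apply: (cvg_unique _ h) => //.
have G1' : G n.+1%:R @[n --> \oo] --> (0 : R) by rewrite -cvg_shiftS in G1.
rewrite (_ : (fun _ => _) = (fun n => G n.+1%:R - G 0)); last first.
  by apply/funext => n; apply: Rintegral_segment => //; rewrite ltr0n.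
have := cvgB G1' (cvg_cst (G 0)); rewrite sub0r; exact.
Unshelve. all: end_near. Qed.

End gaussian_weight.

Ltac pg_auto := repeat first [assumption | match goal with
  | |- polynomial_growth (fun _ => ?c) => exact: (pg_cst c)
  | |- polynomial_growth (fun x => x) => exact: pg_id
  | |- polynomial_growth (fun x => x ^+ ?n) => exact: (pgX _ n)
  | |- polynomial_growth (fun x => @?f x + @?g x) => apply: (@pgD _ f g)
  | |- polynomial_growth (fun x => - @?f x) => apply: (@pgN _ f)
  | |- polynomial_growth (fun x => @?f x * @?g x) => apply: (@pgM _ f g)
  | |- polynomial_growth (GRing.mul ?c) => exact: (pgM (pg_cst c) (@pg_id _))
  end | exact: pg_id | exact: pgX | exact: pg_cst].

Section pointwise_calculus.
Context (R : realType).
Implicit Types f g : R -> R.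

Lemma is_derive_mul f g (x df dg : R) : is_derive x 1 f df -> is_derive x 1 g dg ->
  is_derive x 1 (fun y => f y * g y) (df * g x + f x * dg).
Proof. by move=> ? ?; apply: is_derive_eq; rewrite /GRing.scale/=; ring. Qed.

Lemma is_derive_inv f (x df : R) : f x != 0 -> is_derive x 1 f df ->
  is_derive x 1 (fun y => (f y)^-1) (- df / f x ^+ 2).
Proof.
move=> fx dfx; have /is_derive_eq := is_deriveV fx dfx; apply.
by rewrite /GRing.scale/=; ring.
Qed.

Lemma continuous_idfun : continuous (fun x : R => x).
Proof. by move=> x; exact: cvg_id. Qed.

Lemma continuous_add f g : continuous f -> continuous g ->
  continuous (fun x => f x + g x).
Proof. by move=> cf cg x; apply: cvgD; [exact: cf|exact: cg]. Qed.

Lemma continuous_opp f : continuous f -> continuous (fun x => - f x).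
Proof. by move=> cf x; apply: cvgN; exact: cf. Qed.

Lemma continuous_mul f g : continuous f -> continuous g ->
  continuous (fun x => f x * g x).
Proof. by move=> cf cg x; apply: cvgM; [exact: cf|exact: cg]. Qed.

Lemma continuous_mull (c : R) : continuous (fun x : R => c * x).
Proof. by move=> x; apply: cvgM; [exact: cvg_cst|exact: cvg_id]. Qed.

Lemma continuous_pow f n : continuous f -> continuous (fun x => f x ^+ n).
Proof. by move=> cf x; exact: (continuous_comp (cf x) (@exprn_continuous _ n _)). Qed.

Lemma continuous_inv f : continuous f -> (forall x, f x != 0) ->
  continuous (fun x => (f x)^-1).
Proof. by move=> cf f0 x; apply: cvgV; [exact: f0|exact: cf]. Qed.

End pointwise_calculus.

Ltac cont_auto := repeat first [assumption | match goal with
  | |- continuous (fun _ => ?c) => by move=> ?; exact: cvg_cst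
  | |- continuous (GRing.mul ?c) => exact: (continuous_mull c)
  | |- continuous (fun x => x) => exact: continuous_idfun
  | |- continuous (fun x => @?f x + @?g x) => apply: (@continuous_add _ f g)
  | |- continuous (fun x => - @?f x) => apply: (@continuous_opp _ f)
  | |- continuous (fun x => @?f x * @?g x) => apply: (@continuous_mul _ f g)
  | |- continuous (fun x => @?f x ^+ ?n) => apply: (@continuous_pow _ f n)
  end].

(** * Gaussian means and integration by parts *)

Section gauss_mean.
Context (R : realType) (a : R).
Hypothesis a0 : 0 < a.
Implicit Types f g : R -> R.
Notation lam := (@lebesgue_measure R).
Notation pg := polynomial_growth.

Definition gauss_mean f : R := \int[lam]_x (gauss_weight a x * f x).
Notation E := gauss_mean.

Lemma gauss_meanD f g : pg f -> pg g -> E (fun x => f x + g x) = E f + E g.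
Proof.
move=> pf pg; rewrite /E -RintD; try exact: Rintegrable_gauss_weight.
by apply: eq_Rint => x; rewrite mulrDr.
Qed.

Lemma gauss_meanB f g : pg f -> pg g -> E (fun x => f x - g x) = E f - E g.
Proof.
move=> pf pg; rewrite /E -RintB; try exact: Rintegrable_gauss_weight.
by apply: eq_Rint => x; rewrite mulrBr.
Qed.

Lemma gauss_meanZ k f : pg f -> E (fun x => k * f x) = k * E f.
Proof.
move=> pf; rewrite /E -RintZ; try exact: Rintegrable_gauss_weight.
by apply: eq_Rint => x; rewrite mulrCA.
Qed.

Lemma gauss_mean_ge0 f : (forall x, 0 <= f x) -> 0 <= E f.
Proof. by move=> f0; apply: Rint_ge0 => x; rewrite mulr_ge0// ltW// gauss_weight_gt0. Qed.

Lemma eq_gauss_mean f g : f =1 g -> E f = E g.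
Proof. by move=> fg; congr E; apply/funext. Qed.

(** The integrand against the weight is the derivative of weight times [h], whose boundary terms
    vanish: Stein's identity for variance [a / 2]. *)
Lemma gauss_mean_derive (h dh : R -> R) :
  (forall x : R, is_derive x 1 h (dh x)) -> continuous dh -> pg h -> pg dh ->
  E (fun x => dh x - 2 * x / a * h x) = 0.
Proof.
move=> dhE cdh ph pdh; rewrite /E.
have px : pg (fun x => dh x - 2 * x / a * h x).
  by pg_auto.
apply: (@Rint_derive_eq0 _ (fun x => gauss_weight a x * h x)).
- move=> x; have ? := is_derive_gauss_weight a x.
  by apply: is_derive_eq; rewrite /GRing.scale/=; ring.
- have ch := continuous_derivable dhE; have cr := @continuous_gauss_weight _ a.
  move=> x; apply: cvgM; first exact: cr.
  apply: cvgB; first exact: cdh.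
  apply: cvgM; last exact: ch.
  apply: cvgM; last exact: cvg_cst.
  by apply: cvgM; [exact: cvg_cst|exact: cvg_id].
- exact: Rintegrable_gauss_weight.
- have := cvg_gauss_weight a0 ph (normr1 R).
  by under eq_fun do rewrite mul1r.
- have := cvg_gauss_weight (s := -1) a0 ph; rewrite normrN normr1 => /(_ erefl).
  by under eq_fun do rewrite mulN1r.
Qed.

End gauss_mean.

(** * Jacobi's inequality and the one-dimensional gaps *)

(* If [p] solves [(rho p')' = - (2 lambda / a) rho p] and [w] vanishes wherever
   [p] does, Jacobi's identity [rho w'^2 - (rho w^2 p'/p)' - (2 lambda / a) rho w^2
   = rho (w' - w p'/p)^2] gives the bound; [p'/p] is regularised into
   [p p' / (p^2 + e)]. *)
Section nodal.
Context (R : realType) (a l : R) (p p1 p2 w w1 : R -> R) (K : R).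
Notation lam := (@lebesgue_measure R).
Notation pg := polynomial_growth.
Hypothesis a0 : 0 < a.
Hypothesis dp : forall x : R, is_derive x 1 p (p1 x).
Hypothesis dp1 : forall x : R, is_derive x 1 p1 (p2 x).
Hypothesis cp2 : continuous p2.
Hypothesis ode : forall x, a * p2 x - 2 * x * p1 x = - (2 * l * p x).
Hypotheses (pgp : pg p) (pgp1 : pg p1) (pgp2 : pg p2) (pgw : pg w) (pgw1 : pg w1).
(** Only [w^2] is assumed differentiable: on the half line [w] has a corner at 0, which squaring
    removes. *)
Hypothesis dw : forall x : R, is_derive x 1 (fun x => w x ^+ 2) (2 * (w x * w1 x)).
Hypothesis cw : continuous (fun x => w x * w1 x).
Hypothesis K0 : 0 <= K.
Hypothesis wK : forall x, w x ^+ 2 <= K * p x ^+ 2.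
Notation E := (gauss_mean a).

Let cp := continuous_derivable dp.
Let q e x := p x ^+ 2 + e.
(** With [F = p p' / (p^2 + e)], the equation for [p] turns [F^2 + F' - 2 x F / a] into [- 2 l / a]
    plus the bracket below, which is the price of the regularisation. *)
Let rem e x := w x ^+ 2 * (2 * l / a * e / q e x + e * p1 x ^+ 2 / q e x ^+ 2).

Let q_gt0 e x : 0 < e -> 0 < q e x.
Proof. by move=> e0; rewrite /q ltr_wpDl// sqr_ge0. Qed.

Let cq e : continuous (q e).
Proof. by move=> x; apply: cvgD; [apply: cvgM; exact: cp|exact: cvg_cst]. Qed.

Let pgVq e : 0 < e -> pg (fun x => (q e x)^-1).
Proof.
move=> e0; apply: (@pg_bounded _ _ e^-1).
  apply: continuous_measurable_fun => x; apply: cvgV; last exact: cq.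
  by rewrite gt_eqF// q_gt0.
move=> x; rewrite gtr0_norm ?invr_gt0 ?q_gt0//.
by rewrite lef_pV2 ?posrE ?q_gt0// lerDr sqr_ge0.
Qed.

Let pg2 (f : R -> R) : pg f -> pg (fun x => f x ^+ 2).
Proof. by move=> pf; exact: pgM. Qed.

Let pgrem e : 0 < e -> pg (rem e).
Proof.
move=> e0; have pV := pgVq e0; apply: pgM; first exact: pg2.
apply: pgD; first by pg_auto.
rewrite (_ : (fun x => _) = fun x => e * (p1 x * p1 x) * ((q e x)^-1 * (q e x)^-1)).
  by pg_auto.
by apply/funext => x; rewrite -invfM -!expr2.
Qed.

(** For [h = w^2 F], Stein's identity makes [dh - 2 x / a * h] of mean 0. Added to the square
    [(w1 - w F)^2] it gives [w1^2 + rem e - 2 l / a * w^2], whose mean is therefore nonnegative. *)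
Let nodal_rem e : 0 < e ->
  2 * l / a * E (fun x => w x ^+ 2) <= E (fun x => w1 x ^+ 2) + E (rem e).
Proof.
move=> e0; have pV := pgVq e0; have pr := pgrem e0.
pose F x := p x * p1 x / q e x.
pose dF x := (p1 x ^+ 2 + p x * p2 x) / q e x - 2 * (p x * p1 x) ^+ 2 / q e x ^+ 2.
have q0 x : q e x != 0 by rewrite gt_eqF// q_gt0.
have dFE (x : R) : is_derive x 1 F (dF x).
  have dq : is_derive x 1 (q e) (2 * p x * p1 x).
    by apply: is_derive_eq; rewrite /GRing.scale/=; ring.
  have := is_derive_mul (is_derive_mul (dp x) (dp1 x)) (is_derive_inv (q0 x) dq).
  by move/is_derive_eq; apply; rewrite /dF; field; exact: q0.
have pF : pg F by rewrite /F; pg_auto.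
have pdF : pg dF.
  rewrite (_ : dF = fun x => (p1 x * p1 x + p x * p2 x) * (q e x)^-1 -
     2 * ((p x * p1 x) * (p x * p1 x)) * ((q e x)^-1 * (q e x)^-1)).
    by pg_auto.
  by apply/funext => x; rewrite -invfM -!expr2.
have cF : continuous F := continuous_derivable dFE.
have cdF : continuous dF.
  have cVq := continuous_inv (@cq e) q0.
  rewrite (_ : dF = fun x => (p1 x * p1 x + p x * p2 x) * (q e x)^-1 -
     2 * ((p x * p1 x) * (p x * p1 x)) * ((q e x)^-1 * (q e x)^-1)).
    by cont_auto; exact: continuous_derivable.
  by apply/funext => x; rewrite -invfM -!expr2.
pose h x := w x ^+ 2 * F x.
pose dh x := 2 * (w x * w1 x) * F x + w x ^+ 2 * dF x.
have cw2 : continuous (fun x => w x ^+ 2) := continuous_derivable dw.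
have pw2 : pg (fun x => w x ^+ 2) by exact: pg2.
have ph : pg h by rewrite /h; pg_auto.
have pdh : pg dh by rewrite /dh; pg_auto.
have E0 : E (fun x => dh x - 2 * x / a * h x) = 0.
  apply: gauss_mean_derive => //.
    by move=> x; exact: is_derive_mul.
  by rewrite /dh; cont_auto.
have pwF : pg (fun x => (w1 x - w x * F x) ^+ 2) by apply: pg2; pg_auto.
have := gauss_mean_ge0 a (fun x => sqr_ge0 (w1 x - w x * F x)).
have pdh' : pg (fun x => dh x - 2 * x / a * h x) by pg_auto.
have pw12 : pg (fun x => w1 x ^+ 2) by exact: pg2.
have key x : (w1 x - w x * F x) ^+ 2 + (dh x - 2 * x / a * h x) =
    w1 x ^+ 2 + rem e x - 2 * l / a * w x ^+ 2.
  rewrite /dh /h /F /dF /rem.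
  have -> : p2 x = (2 * x * p1 x - 2 * l * p x) / a.
    apply: (mulfI (lt0r_neq0 a0)); rewrite mulrCA divff ?gt_eqF// mulr1.
    by have := ode x; lra.
  have : q e x = p x ^+ 2 + e by [].
  have := q0 x; move: (q e x) => Q Q0 QE.
  have -> : e = Q - p x ^+ 2 by rewrite QE; ring.
  by field; rewrite Q0 gt_eqF.
have -> : E (fun x => (w1 x - w x * F x) ^+ 2) =
    E (fun x => (w1 x - w x * F x) ^+ 2 + (dh x - 2 * x / a * h x)).
  by rewrite gauss_meanD// E0 addr0.
rewrite (eq_gauss_mean a key) gauss_meanB//; last 2 first.
- exact: pgD.
- by pg_auto.
by rewrite gauss_meanD// gauss_meanZ// subr_ge0.
Qed.

Let rem_norm e x : 0 < e -> `|rem e x| <=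
  w x ^+ 2 * (`|2 * l / a| * e / q e x + e * p1 x ^+ 2 / q e x ^+ 2).
Proof.
move=> e0; have q0 := q_gt0 x e0.
rewrite normrM ger0_norm ?sqr_ge0// ler_wpM2l ?sqr_ge0//.
rewrite (le_trans (ler_normD _ _))// lerD//.
  by rewrite -mulrA normrM [`|e / _|]gtr0_norm ?divr_gt0// mulrA.
by rewrite ger0_norm// divr_ge0 ?sqr_ge0//; apply: mulr_ge0; [exact: ltW|exact: sqr_ge0].
Qed.

(** The dominating function for the limit in [e]: by [wK], the quotient [w^2 / q] is at most [K],
    even at the zeros of [p]. *)
Let rem_bound e x : 0 < e -> e <= 1 ->
  `|rem e x| <= K * (`|2 * l / a| + p1 x ^+ 2).
Proof.
move=> e0 e1; have q0 := q_gt0 x e0; rewrite (le_trans (rem_norm x e0))//.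
have pq : p x ^+ 2 <= q e x by rewrite lerDl ltW.
have wq : w x ^+ 2 / q e x <= K.
  by rewrite ler_pdivrMr// (le_trans (wK x))// ler_wpM2l.
have eq : e / q e x <= 1 by rewrite ler_pdivrMr// mul1r lerDr sqr_ge0.
rewrite (_ : w x ^+ 2 * _ = (w x ^+ 2 / q e x) *
    (`|2 * l / a| * e + p1 x ^+ 2 * (e / q e x))); last by field; rewrite gt_eqF.
rewrite ler_pM ?divr_ge0 ?sqr_ge0//; first exact: ltW.
  have eq0 : 0 <= e / q e x by rewrite divr_ge0// ltW.
  by apply: addr_ge0; apply: mulr_ge0 => //; [exact: ltW|exact: sqr_ge0].
by rewrite lerD// -[leRHS]mulr1 ler_wpM2l// sqr_ge0.
Qed.

(** The decay is linear in [e] with a constant depending on [x]. At a zero of [p], where that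
    constant would blow up, [wK] forces [w] and hence the remainder to vanish. *)
Let rem_pointwise x : exists C, forall e, 0 < e -> `|rem e x| <= C * e.
Proof.
have [px0|px0] := eqVneq (p x) 0.
  exists 0 => e e0; rewrite mul0r normr_le0 /rem.
  by have := wK x; rewrite px0 expr0n/= mulr0 => w0; rewrite (@le_anti _ _ (w x ^+ 2) 0) ?mul0r// w0 sqr_ge0.
have p0 : 0 < p x ^+ 2 by rewrite exprn_even_gt0.
exists (w x ^+ 2 * (`|2 * l / a| / p x ^+ 2 + p1 x ^+ 2 / (p x ^+ 2) ^+ 2)) => e e0.
rewrite (le_trans (rem_norm x e0))// -[leRHS]mulrA.
apply: ler_wpM2l; first exact: sqr_ge0.
have pq : (q e x)^-1 <= (p x ^+ 2)^-1.
  by rewrite lef_pV2 ?posrE ?q_gt0// lerDl ltW.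
have q0 : 0 <= (q e x)^-1 by rewrite invr_ge0 ltW// q_gt0.
rewrite [leRHS]mulrDl; apply: lerD.
  by rewrite [leRHS]mulrAC; apply: ler_wpM2l => //; apply: mulr_ge0 => //; exact: ltW.
rewrite [leRHS]mulrC [leRHS]mulrA; apply: ler_wpM2l.
  by apply: mulr_ge0; [exact: ltW|exact: sqr_ge0].
by rewrite -[leLHS]exprVn -[leRHS]exprVn ler_pXn2r ?nnegrE// invr_ge0 sqr_ge0.
Qed.

Let rem_cvg0 : E (rem n.+1%:R^-1) @[n --> \oo] --> (0 : R).
Proof.
have e0 n : 0 < n.+1%:R^-1 :> R by rewrite invr_gt0 ltr0n.
have e1 n : n.+1%:R^-1 <= 1 :> R by rewrite invf_le1 ?ltr0n// ler1n.
have iB : Rintegrable lam (fun x => gauss_weight a x * (K * (`|2 * l / a| + p1 x ^+ 2))).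
  apply: Rintegrable_gauss_weight => //; apply: pgM; first exact: pg_cst.
  by apply: pgD; [exact: pg_cst|exact: pg2].
have ir n : Rintegrable lam (fun x => gauss_weight a x * rem n.+1%:R^-1 x).
  by apply: Rintegrable_gauss_weight => //; exact: pgrem.
have [|||||_ _ +] := @dominated_convergence _ _ _ lam setT measurableT
  (fun n => EFin \o (fun x => gauss_weight a x * rem n.+1%:R^-1 x)) (EFin \o cst 0)
  (EFin \o (fun x => gauss_weight a x * (K * (`|2 * l / a| + p1 x ^+ 2)))).
- by move=> n; have /integrableP[] := ir n.
- exact/measurable_EFinP.
- apply: aeW => x _; apply: cvg_EFin; first exact: nearW.
  rewrite /=; have [C HC] := rem_pointwise x.
  apply: norm_cvg0; apply: (@squeeze_cvgr _ _ _ _ (cst 0)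
    (fun n => gauss_weight a x * C * n.+1%:R^-1)).
  + apply: nearW => n; rewrite normr_ge0/= normrM gtr0_norm ?gauss_weight_gt0//.
    by rewrite -mulrA ler_wpM2l ?HC// ltW// gauss_weight_gt0.
  + exact: cvg_cst.
  + rewrite -(mulr0 (gauss_weight a x * C)); apply: cvgM; first exact: cvg_cst.
    exact: cvg_harmonic.
- exact: iB.
- apply: aeW => x n _ /=; rewrite lee_fin normrM gtr0_norm ?gauss_weight_gt0//.
  by rewrite ler_wpM2l ?rem_bound// ltW// gauss_weight_gt0.
rewrite /= (_ : (\int[_]_x _)%E = 0%:E); last by rewrite integral0.
by move=> /fine_cvg.
Qed.

Lemma nodal_gauss_inequality :
  l * E (fun x => w x ^+ 2) <= a / 2 * E (fun x => w1 x ^+ 2).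
Proof.
suff h : 2 * l / a * E (fun x => w x ^+ 2) <= E (fun x => w1 x ^+ 2).
  have a2 : 0 <= a / 2 by rewrite divr_ge0// ltW.
  have := ler_wpM2l a2 h.
  by rewrite mulrA (_ : a / 2 * (2 * l / a) = l)//; field; rewrite gt_eqF.
rewrite -subr_ge0 -opprB oppr_ge0.
apply: (ler_cvg_to (cvg_cst _) rem_cvg0); apply: nearW => n.
by rewrite lerBlDl; apply: nodal_rem; rewrite invr_gt0 ltr0n.
Qed.

End nodal.

(** * Gaps of the Gaussian Dirichlet form on the line and the half line *)

Section one_dimension.
Context (R : realType).
Implicit Types f g : R -> R.
Notation lam := (@lebesgue_measure R).
Notation pg := polynomial_growth.

(** Multiplying by [e^(x^2)] keeps [f] bounded because of its support, so this is an instance of the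
    Gaussian case with parameter 1. *)
Lemma Rintegrable_bounded_support f C M : measurable_fun [set: R] f ->
  (forall x, `|f x| <= C) -> (forall x, f x != 0 -> `|x| <= M) -> Rintegrable lam f.
Proof.
move=> mf fC fM; have C0 : 0 <= C := le_trans (normr_ge0 _) (fC 0).
have E : f = (fun x => gauss_weight 1 x * (f x * expR (x ^+ 2))).
  apply/funext => x; rewrite mulrCA /gauss_weight -expRD divr1 addrC subrr.
  by rewrite expR0 mulr1.
rewrite E; apply: Rintegrable_gauss_weight => //.
apply: (@pg_bounded _ _ (C * expR (M ^+ 2))).
  apply: measurable_funM => //; apply: continuous_measurable_fun => x.
  by apply: continuous_comp; [exact: exprn_continuous|exact: continuous_expR].
move=> x; have [->|fx0] := eqVneq (f x) 0.
  by rewrite mul0r normr0 mulr_ge0// expR_ge0.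
rewrite normrM ler_pM// gtr0_norm ?expR_gt0// ler_expR.
have := fM x fx0; rewrite -[x ^+ 2]real_normK ?num_real// => xM.
by rewrite ler_pXn2r ?nnegrE// (le_trans (normr_ge0 x)).
Qed.

Lemma continuous_support_bounded f M : continuous f ->
  (forall x, f x != 0 -> `|x| <= M) -> exists2 C, 0 <= C & forall x, `|f x| <= C.
Proof.
move=> cf fM.
have [M0|M0] := ltP M 0.
  exists 0 => // x; rewrite normr_le0; apply: contraT => /fM.
  by move=> /(le_trans (normr_ge0 x)); rewrite leNgt M0.
have cN : {within `[- M, M], continuous (fun x => `|f x|)}.
  apply: continuous_subspaceT => x; apply: (continuous_comp (cf x)).
  exact: norm_continuous.
have MM : - M <= M by rewrite (le_trans _ M0)// oppr_le0.
have [c _ cmax] := EVT_max MM cN.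
exists `|f c| => // x; have [->|fx0] := eqVneq (f x) 0; first by rewrite normr0.
by apply: cmax; rewrite in_itv/= -ler_norml fM.
Qed.

Lemma bounded_derivative_lipschitz f df C : (forall x : R, is_derive x 1 f (df x)) ->
  (forall x, `|df x| <= C) -> forall x y, `|f x - f y| <= C * `|x - y|.
Proof.
move=> dE dC x y; wlog yx : x y / y <= x.
  by move=> H; have [/H//|/ltW/H] := leP y x; rewrite distrC [`|y - x|]distrC.
have [|c _ ->] := MVT_segment yx (fun z _ => dE z).
  exact/continuous_subspaceT/(continuous_derivable dE).
by rewrite normrM ler_wpM2r.
Qed.

Definition pos_part (x : R) := if 0 < x then x else 0.

Lemma continuous_pos_part : continuous pos_part.
Proof.
rewrite (_ : pos_part = fun x => (x + `|x|) / 2).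
  move=> x; apply: cvgM; last exact: cvg_cst.
  by apply: cvgD; [exact: cvg_id|exact: norm_continuous].
apply/funext => x; rewrite /pos_part; case: ltP => x0.
  by rewrite gtr0_norm//; field.
by rewrite ler0_norm// subrr mul0r.
Qed.

(** At the corner the difference quotient of the square is [pos_part] itself, which tends to 0. *)
Lemma is_derive_pos_part_sqr (x : R) :
  is_derive x 1 (fun x => pos_part x ^+ 2) (2 * pos_part x).
Proof.
have [x0|x0|->] := ltgtP x 0.
- apply: (@near_eq_is_derive _ _ _ (fun=> 0)).
    near=> y; rewrite /pos_part ltNge ltW ?expr0n//=.
    by near: y; exact: lt_nbhsl.
  by rewrite /pos_part ltNge ltW//= mulr0; exact: is_derive_cst.
- apply: (@near_eq_is_derive R R R (fun x : R => x ^+ 2)).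
    near=> y; rewrite /pos_part ifT//.
    by near: y; exact: lt_nbhsr.
  rewrite /pos_part x0; apply: is_derive_eq.
  by rewrite /GRing.scale/=; ring.
have h : h^-1 *: (pos_part (h *: 1 + 0) ^+ 2 - pos_part 0 ^+ 2) @[h --> 0^'] --> (0 : R).
  rewrite (_ : (fun _ => _) = pos_part).
    have p0 : pos_part 0 = 0 by rewrite /pos_part ltxx.
    rewrite -[X in _ --> X]p0.
    apply: cvg_trans (@continuous_pos_part 0); apply: cvg_app; exact: cvg_within.
  apply/funext => h; rewrite /pos_part ltxx expr0n subr0 addr0 /GRing.scale/= mulr1.
  case: ltP => h0; last by rewrite expr0n mulr0.
  by rewrite expr2 mulrA mulVf ?mul1r// gt_eqF.
apply: DeriveDef; first by apply/cvg_ex; exists 0.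
by rewrite /pos_part ltxx mulr0; exact: cvg_lim.
Unshelve. all: end_near. Qed.

Lemma pg_pos_part : pg pos_part.
Proof.
split; first by apply: continuous_measurable_fun; exact: continuous_pos_part.
have [C [m [C0 H]]] := pg_ex (@pg_id R); exists C, m => x.
apply: le_trans (H x); rewrite /pos_part; case: ltP => //= _.
by rewrite normr0.
Qed.

(** The derivative of [pos_part] away from 0. The value 0 at 0 makes [pos_part * pos_indic] half the
    derivative of [pos_part ^+ 2] everywhere. *)
Definition pos_indic (x : R) : R := (0 < x)%R%:R.

Lemma pg_pos_indic : pg pos_indic.
Proof.
apply: (@pg_bounded _ _ 1).
  rewrite (_ : pos_indic = \1_`]0 : R, +oo[).
    exact: measurable_indic.
  apply/funext => x; rewrite /pos_indic indicE.
  suff -> : (x \in `]0, +oo[%classic) = (0 < x) by [].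
  by apply/idP/idP; rewrite inE/= in_itv/= andbT.
by move=> x; rewrite /pos_indic; case: ltP => _ /=; rewrite ?normr1 ?normr0.
Qed.

Section gap.
Variables (a : R) (V V1 : R -> R) (M : R).
Hypothesis a0 : 0 < a.
Hypothesis dV : forall x : R, is_derive x 1 V (V1 x).
Hypothesis cV1 : continuous V1.
Hypothesis VM : forall x, V x != 0 -> `|x| <= M.
Hypothesis V1M : forall x, V1 x != 0 -> `|x| <= M.
Notation E := (gauss_mean a).

Let cV : continuous V := continuous_derivable dV.

Let pgV : pg V.
Proof.
have [C _ VC] := continuous_support_bounded cV VM.
exact: pg_bounded (continuous_measurable_fun cV) VC.
Qed.

Let pgV1 : pg V1.
Proof.
have [C _ VC] := continuous_support_bounded cV1 V1M.
exact: pg_bounded (continuous_measurable_fun cV1) VC.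
Qed.

Let mean_V1 : E V1 = 2 / a * E (fun x => x * V x).
Proof.
apply/eqP; rewrite -subr_eq0 -gauss_meanZ//; last by pg_auto.
rewrite -gauss_meanB//; last by pg_auto.
rewrite -[X in _ == X](gauss_mean_derive a0 dV)//; apply/eqP.
by apply: eq_gauss_mean => x; ring.
Qed.

Lemma gauss_mean_id : E (fun x => x) = 0.
Proof.
have d1 (x : R) : is_derive x 1 (fun=> 1 : R) 0 by exact: is_derive_cst.
have c0 : continuous (fun _ : R => 0 : R) by move=> x; exact: cvg_cst.
have := gauss_mean_derive a0 d1 c0 (pg_cst _) (pg_cst _).
rewrite (@eq_gauss_mean R a _ (fun x => (- (2 / a)) * x)); last by move=> x; ring.
rewrite gauss_meanZ//; last exact: pg_id.
have a2 : - (2 / a) != 0 by rewrite oppr_eq0 gt_eqF ?divr_gt0.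
by move/eqP; rewrite mulf_eq0 (negbTE a2) => /eqP.
Qed.

Lemma gauss_mean_sqr : E (fun x => x ^+ 2) = a / 2 * E (fun=> 1).
Proof.
have did (x : R) : is_derive x 1 (fun x : R => x) 1 by exact: is_derive_id.
have c1 : continuous (fun _ : R => 1 : R) by move=> x; exact: cvg_cst.
have := gauss_mean_derive a0 did c1 (@pg_id R) (pg_cst _).
rewrite (@eq_gauss_mean R a _ (fun x => 1 - (2 / a) * x ^+ 2)); last by move=> x; ring.
rewrite gauss_meanB//; try by pg_auto.
rewrite gauss_meanZ//; last exact: pgX.
move/eqP; rewrite subr_eq0 => /eqP ->.
by rewrite mulrA (_ : a / 2 * (2 / a) = 1) ?mul1r//; field; rewrite gt_eqF.
Qed.

(** Jacobi's inequality with [p = x^2 - a / 2], the Hermite polynomial of degree 2, applied to [V]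
    minus an affine function chosen so that the difference vanishes at the two nodes. That function
    interpolates and need not be the projection of [V], but the excess terms form nonnegative
    squares. *)
Lemma gauss_gap (N0 := E (fun=> 1)) (N1 := E (fun x => x ^+ 2)) : 0 < N0 ->
  2 * E (fun x => V x ^+ 2) - 2 * (E V ^+ 2 / N0) - E (fun x => x * V x) ^+ 2 / N1 <=
  a / 2 * E (fun x => V1 x ^+ 2).
Proof.
move=> N00.
have N10 : 0 < N1 by rewrite /N1 gauss_mean_sqr mulr_gt0// divr_gt0.
pose s := Num.sqrt (a / 2).
have s2 : s ^+ 2 = a / 2 by rewrite sqr_sqrtr// divr_ge0// ltW.
have s0 : 0 < s by rewrite sqrtr_gt0 divr_gt0.
(* Affine interpolation of [V] at the nodes [s] and [- s] of [p]. *)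
have [c [d [ws wNs]]] : exists c d,
    V s - (c + d * s) = 0 /\ V (- s) - (c + d * - s) = 0.
  exists ((V s + V (- s)) / 2), ((V s - V (- s)) / (2 * s)).
  by split; field; rewrite gt_eqF.
pose w x := V x - (c + d * x); pose w1 x := V1 x - d.
have dw (x : R) : is_derive x 1 w (w1 x).
  have := dV x => ?; apply: is_derive_eq; rewrite /w1 /GRing.scale/=; ring.
have [B B0 V1B] := continuous_support_bounded cV1 V1M.
have wL := @bounded_derivative_lipschitz w w1 (B + `|d|) dw.
have {wL} wL : forall x y, `|w x - w y| <= (B + `|d|) * `|x - y|.
  by apply: wL => x; rewrite (le_trans (ler_normB _ _))// lerD.
have {}ws : w s = 0 := ws.
have {}wNs : w (- s) = 0 := wNs.
(* For [x >= 0] the Lipschitz bound from the node [s] applies and the other factor [x + s] of [p] is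
   at least [s]; for [x < 0] the nodes exchange roles. Hence the Lipschitz constant over [s]. *)
have wp x : w x ^+ 2 <= ((B + `|d|) / s) ^+ 2 * (x ^+ 2 - a / 2) ^+ 2.
  rewrite -exprMn -[leLHS]real_normK ?num_real// -[leRHS]real_normK ?num_real//.
  have Bs : 0 <= (B + `|d|) / s by rewrite divr_ge0 ?addr_ge0// ltW.
  rewrite ler_pXn2r ?nnegrE// normrM (ger0_norm Bs) -s2 subr_sqr normrM.
  have [x0|x0] := leP 0 x.
    have := wL x s; rewrite ws subr0 => /le_trans; apply.
    rewrite (_ : _ * `|x - s| = (B + `|d|) / s * (`|x - s| * s)); last first.
      by field; rewrite gt_eqF.
    apply: ler_wpM2l => //; apply: ler_wpM2l => //.
    by rewrite ger0_norm ?lerDr// addr_ge0// ltW.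
  have := wL x (- s); rewrite wNs subr0 opprK => /le_trans; apply.
  rewrite (_ : _ * `|x + s| = (B + `|d|) / s * (s * `|x + s|)); last first.
    by field; rewrite gt_eqF.
  apply: ler_wpM2l => //; apply: ler_wpM2r => //.
  have xs : x - s < 0 by rewrite subr_lt0 (lt_trans x0).
  by rewrite ltr0_norm// opprB lerDl oppr_ge0 ltW.
have pV2 : pg (fun x => V x ^+ 2) := pgM pgV pgV.
have pV12 : pg (fun x => V1 x ^+ 2) := pgM pgV1 pgV1.
have pgw : pg w by rewrite /w; pg_auto.
have pgw1 : pg w1 by rewrite /w1; pg_auto.
have cw : continuous w := continuous_derivable dw.
have cw1 : continuous w1 by rewrite /w1; cont_auto.
have H := @nodal_gauss_inequality R a 2 (fun x => x ^+ 2 - a / 2) (fun x => 2 * x)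
  (fun=> 2) w w1 (((B + `|d|) / s) ^+ 2) a0.
have {H} : 2 * E (fun x => w x ^+ 2) <= a / 2 * E (fun x => w1 x ^+ 2).
  apply: H => //.
  - by move=> x; apply: is_derive_eq; rewrite /GRing.scale/=; ring.
  - by move=> x; apply: is_derive_eq; rewrite /GRing.scale/=; ring.
  - by move=> x; exact: cvg_cst.
  - by move=> x; field.
  - by pg_auto.
  - by pg_auto.
  - by pg_auto.
  - by move=> x; have := dw x => ?; apply: is_derive_eq; rewrite /GRing.scale/=; ring.
  - exact: continuous_mul.
  - exact: sqr_ge0.
have -> : E (fun x => w x ^+ 2) = E (fun x => V x ^+ 2) - 2 * c * E V
    - 2 * d * E (fun x => x * V x) + c ^+ 2 * N0 + d ^+ 2 * N1.
  rewrite (@eq_gauss_mean R a _ (fun x => V x ^+ 2 - (2 * c) * V x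
    - (2 * d) * (x * V x) + c ^+ 2 * 1 + d ^+ 2 * x ^+ 2 + (2 * c * d) * x)); last first.
    by move=> x; rewrite /w; ring.
  rewrite !(gauss_meanB, gauss_meanD, gauss_meanZ) //; try by pg_auto.
  by rewrite gauss_mean_id mulr0 addr0.
have -> : E (fun x => w1 x ^+ 2) = E (fun x => V1 x ^+ 2) - 4 * d / a * E (fun x => x * V x) +
    d ^+ 2 * N0.
  rewrite (@eq_gauss_mean R a _ (fun x => V1 x ^+ 2 - (2 * d) * V1 x
     + d ^+ 2 * 1)); last first.
    by move=> x; rewrite /w1; ring.
  rewrite !(gauss_meanB, gauss_meanD, gauss_meanZ) //; try by pg_auto.
  rewrite mean_V1.
  by rewrite -/N0; congr (_ - _ + _); field; rewrite gt_eqF.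
have NN : N1 = a / 2 * N0 := gauss_mean_sqr.
set EV2 := E (fun x => V x ^+ 2); set EV12 := E (fun x => V1 x ^+ 2).
set EV := E V; set EX := E (fun x => x * V x) => H.
(* These squares measure how far [c] and [d] are from the projection coefficients [EV / N0] and
   [EX / N1]; discarding them leaves a bound free of [c] and [d]. *)
have h1 : 0 <= (c * N0 - EV) ^+ 2 / N0 by rewrite divr_ge0 ?sqr_ge0// ltW.
have h2 : 0 <= (d * N1 - EX) ^+ 2 / N1 by rewrite divr_ge0 ?sqr_ge0// ltW.
have e1 : (c * N0 - EV) ^+ 2 / N0 = c ^+ 2 * N0 - 2 * c * EV + EV ^+ 2 / N0.
  by field; rewrite gt_eqF.
have e2 : (d * N1 - EX) ^+ 2 / N1 = d ^+ 2 * N1 - 2 * d * EX + EX ^+ 2 / N1.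
  by field; rewrite gt_eqF.
have e3 : a / 2 * (EV12 - 4 * d / a * EX + d ^+ 2 * N0) =
   a / 2 * EV12 - 2 * d * EX + d ^+ 2 * N1.
  by rewrite NN; field; rewrite gt_eqF.
lra.
Qed.

Hypothesis V0 : forall x, x <= 0 -> V x = 0.
Hypothesis V10 : forall x, x <= 0 -> V1 x = 0.

Lemma gauss_mean_halfline_sqr :
  E (fun x => pos_part x ^+ 2) = a / 2 * E pos_indic.
Proof.
pose g x := gauss_weight a x * (1 - 2 / a * x ^+ 2).
have dG (x : R) : is_derive x 1 (fun x => gauss_weight a x * x) (g x).
  have ? := is_derive_gauss_weight a x.
  by apply: is_derive_eq; rewrite /g /GRing.scale/=; ring.
have cg : continuous g.
  have cr := @continuous_gauss_weight R a.
  by rewrite /g; cont_auto.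
have pgg : pg (fun x => 1 - 2 / a * x ^+ 2) by pg_auto.
have ig : Rintegrable lam g by exact: Rintegrable_gauss_weight.
have G0 : (gauss_weight a n%:R * n%:R) @[n --> \oo] --> (0 : R).
  have := cvg_gauss_weight a0 (@pg_id R) (normr1 R).
  by under eq_fun do rewrite mul1r.
have := Rint_derive_halfline dG cg ig G0; rewrite mulr0 oppr0 Rintegral_mkcond.
have -> : \int[lam]_x (g \_ [set x | 0 < x]) x = E (fun x => pos_indic x - 2 / a * pos_part x ^+ 2).
  apply: eq_Rint => x; rewrite patchE /pos_indic /pos_part /g.
  have -> : (x \in [set x | 0 < x]) = (0 < x) by apply/idP/idP; rewrite inE.
  by case: ifP => //= _; rewrite expr0n mulr0 subr0 mulr0.
have pp := pg_pos_part; have pi := pg_pos_indic.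
have pp2 : pg (fun x => pos_part x ^+ 2) := pgM pp pp.
rewrite gauss_meanB//; last by pg_auto.
rewrite gauss_meanZ// => /eqP; rewrite subr_eq0 => /eqP ->.
by rewrite mulrA (_ : a / 2 * (2 / a) = 1) ?mul1r//; field; rewrite gt_eqF.
Qed.

(** Jacobi's inequality with [p = x^3 - (3 a / 2) x], the Hermite polynomial of degree 3, whose
    nodes in the closed half line are 0 and [s]. Since [V] already vanishes at 0, one multiple of
    [pos_part] suffices to cancel it at [s]. The constant is 3 because energies are still counted
    from the ground state of the line. *)
Lemma gauss_gap_halfline (N1 := E (fun x => pos_part x ^+ 2)) : 0 < N1 ->
  3 * E (fun x => V x ^+ 2) - 2 * (E (fun x => x * V x) ^+ 2 / N1) <=
  a / 2 * E (fun x => V1 x ^+ 2).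
Proof.
move=> N10.
pose s := Num.sqrt (3 * a / 2).
have s2 : s ^+ 2 = 3 * a / 2 by rewrite sqr_sqrtr// divr_ge0// mulr_ge0// ltW.
have s0 : 0 < s by rewrite sqrtr_gt0 divr_gt0// mulr_gt0.
have [d ws] : exists d, V s - d * s = 0.
  by exists (V s / s); field; rewrite gt_eqF.
pose w x := V x - d * pos_part x; pose w1 x := V1 x - d * pos_indic x.
pose u x := V x - d * x.
have du (x : R) : is_derive x 1 u (V1 x - d).
  by have := dV x => ?; apply: is_derive_eq; rewrite /GRing.scale/=; ring.
have [B B0 V1B] := continuous_support_bounded cV1 V1M.
have uL : forall x y, `|u x - u y| <= (B + `|d|) * `|x - y|.
  apply: (bounded_derivative_lipschitz du) => x.
  by rewrite (le_trans (ler_normB _ _))// lerD.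
have us : u s = 0 := ws.
have u0 : u 0 = 0 by rewrite /u V0// mulr0 subr0.
(* The two positive-side estimates are split at [s / 2]: beyond it the Lipschitz bound from the node
   [s] is used and [x (x + s) >= 3 s^2 / 4]; before it the bound from 0, with
   [s^2 - x^2 >= 3 s^2 / 4]. The factor 2 covers both. *)
pose K := 2 * (B + `|d|) / s ^+ 2.
have K0 : 0 <= K.
  by apply: divr_ge0 (sqr_ge0 _); apply: mulr_ge0 => //; exact: addr_ge0.
have wp x : w x ^+ 2 <= K ^+ 2 * (x ^+ 3 - s ^+ 2 * x) ^+ 2.
  rewrite /w /pos_part; have [x0|x0] := ltP 0 x; last first.
    by rewrite V0// mulr0 subr0 expr0n mulr_ge0 ?sqr_ge0.
  rewrite -/(u x) -exprMn -[leLHS]real_normK ?num_real// -[leRHS]real_normK ?num_real//.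
  rewrite ler_pXn2r ?nnegrE// normrM (ger0_norm K0).
  rewrite (_ : x ^+ 3 - s ^+ 2 * x = x * (x - s) * (x + s)); last by ring.
  rewrite 2!normrM (gtr0_norm x0) (gtr0_norm (addr_gt0 x0 s0)).
  have Bd : 0 <= B + `|d| by rewrite addr_ge0.
  have KE : K = (B + `|d|) * (2 / s ^+ 2) by rewrite /K mulrAC mulrC mulrA.
  rewrite KE -[leRHS]mulrA; have [xs|xs] := leP (s / 2) x.
    have := uL x s; rewrite us subr0 => /le_trans; apply.
    apply: ler_wpM2l => //.
    rewrite (_ : _ * _ = `|x - s| * ((2 / s ^+ 2) * (x * (x + s)))); last by ring.
    rewrite -[leLHS]mulr1; apply: ler_wpM2l => //.
    rewrite mulrAC ler_pdivlMr ?exprn_gt0// mul1r.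
    nra.
  have := uL x 0; rewrite u0 !subr0 (gtr0_norm x0) => /le_trans; apply.
  apply: ler_wpM2l => //.
  rewrite (_ : _ * _ = x * ((2 / s ^+ 2) * (`|x - s| * (x + s)))); last by ring.
  rewrite -[leLHS]mulr1; apply: ler_wpM2l; first exact: ltW.
  rewrite mulrAC ler_pdivlMr ?exprn_gt0// mul1r ltr0_norm; last by rewrite subr_lt0; lra.
  nra.
have pp := pg_pos_part; have pi := pg_pos_indic.
have pp2 : pg (fun x => pos_part x ^+ 2) := pgM pp pp.
have pV2 : pg (fun x => V x ^+ 2) := pgM pgV pgV.
have pV12 : pg (fun x => V1 x ^+ 2) := pgM pgV1 pgV1.
have pgw : pg w by rewrite /w; pg_auto.
have pgw1 : pg w1 by rewrite /w1; pg_auto.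
have Vp x : V x * pos_part x = x * V x.
  by rewrite /pos_part; case: ltP => x0; rewrite 1?mulrC// V0// !mulr0.
have V1p x : V1 x * pos_part x = x * V1 x.
  by rewrite /pos_part; case: ltP => x0; rewrite 1?mulrC// V10// !mulr0.
have Vi x : V x * pos_indic x = V x.
  by rewrite /pos_indic; case: ltP => x0; rewrite ?mulr1// V0// mul0r.
have V1i x : V1 x * pos_indic x = V1 x.
  by rewrite /pos_indic; case: ltP => x0; rewrite ?mulr1// V10// mul0r.
have pi2 x : pos_indic x ^+ 2 = pos_indic x.
  by rewrite /pos_indic; case: ltP => x0; rewrite ?expr1n// expr0n.
have ppi x : pos_part x * pos_indic x = pos_part x.
  by rewrite /pos_indic /pos_part; case: ltP => x0; rewrite ?mulr1// mul0r.
have w2E x : w x ^+ 2 = V x ^+ 2 - (2 * d) * (x * V x) + d ^+ 2 * pos_part x ^+ 2.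
  by rewrite /w -Vp; ring.
have ww1E x : w x * w1 x = V x * V1 x - d * V x - d * (x * V1 x) + d ^+ 2 * pos_part x.
  by rewrite -V1p -[in d * V x]Vi -[in _ ^+ 2 * _]ppi /w /w1; ring.
have cpp := continuous_pos_part.
have H := @nodal_gauss_inequality R a 3 (fun x => x ^+ 3 - s ^+ 2 * x)
  (fun x => 3 * x ^+ 2 - s ^+ 2) (fun x => 6 * x) w w1 (K ^+ 2) a0.
have {H} : 3 * E (fun x => w x ^+ 2) <= a / 2 * E (fun x => w1 x ^+ 2).
  apply: H => //.
  - by move=> x; apply: is_derive_eq; rewrite /GRing.scale/=; ring.
  - by move=> x; apply: is_derive_eq; rewrite /GRing.scale/=; ring.
  - by cont_auto.
  - by move=> x; rewrite s2; field.
  - by pg_auto.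
  - by pg_auto.
  - by pg_auto.
  - move=> x; have ? := dV x; have ? := is_derive_pos_part_sqr x.
    under eq_fun do rewrite w2E.
    by apply: is_derive_eq; rewrite ww1E /GRing.scale/=; ring.
  - by rewrite (funext ww1E); cont_auto.
  - exact: sqr_ge0.
rewrite (eq_gauss_mean a w2E) !(gauss_meanB, gauss_meanD, gauss_meanZ)//; try by pg_auto.
have -> : E (fun x => w1 x ^+ 2) = E (fun x => V1 x ^+ 2) - 4 * d / a * E (fun x => x * V x) +
    d ^+ 2 * E pos_indic.
  rewrite (@eq_gauss_mean R a _ (fun x => V1 x ^+ 2 - (2 * d) * V1 x
     + d ^+ 2 * pos_indic x)); last first.
    move=> x; rewrite -[in RHS]pi2 /w1.
    by rewrite -[X in _ = _ - _ * X + _]V1i; ring.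
  rewrite !(gauss_meanB, gauss_meanD, gauss_meanZ)//; try by pg_auto.
  by rewrite mean_V1; congr (_ - _ + _); field; rewrite gt_eqF.
have NN : N1 = a / 2 * E pos_indic := gauss_mean_halfline_sqr.
rewrite -/N1.
set EV2 := E (fun x => V x ^+ 2); set EV12 := E (fun x => V1 x ^+ 2).
set EX := E (fun x => x * V x) => H.
have h2 : 0 <= (d * N1 - EX) ^+ 2 / N1 by rewrite divr_ge0 ?sqr_ge0// ltW.
have e2 : (d * N1 - EX) ^+ 2 / N1 = d ^+ 2 * N1 - 2 * d * EX + EX ^+ 2 / N1.
  by field; rewrite gt_eqF.
have e3 : a / 2 * (EV12 - 4 * d / a * EX + d ^+ 2 * E pos_indic) =
   a / 2 * EV12 - 2 * d * EX + d ^+ 2 * N1.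
  by rewrite NN; field; rewrite gt_eqF.
lra.
Qed.

End gap.

End one_dimension.

Ltac rint_auto := repeat first
  [ assumption | apply: RintegrableB | apply: RintegrableD | apply: RintegrableZ ].

(** * The first two states of a coordinate and Bessel's inequality *)

Section coordinate.
Context (R : realType) (a : R).
Hypothesis a0 : 0 < a.
Implicit Types f df : R -> R.
Notation lam := (@lebesgue_measure R).
Notation pg := polynomial_growth.
Notation E := (gauss_mean a).

Let gauss_mean_pos_indic_gt0 : 0 < E (@pos_indic R).
Proof.
have c0 : 0 < gauss_weight a 1 by exact: gauss_weight_gt0.
apply: (@lt_le_trans _ _ (gauss_weight a 1)) => //.
have ind : Rintegrable lam (\1_(`]0 : R, 1]%classic) : R -> R).
  apply: (@Rintegrable_bounded_support _ _ 1 1).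
  - exact: measurable_indic.
  - by move=> x; rewrite indicE; case: (_ \in _); rewrite ?normr1 ?normr0.
  - move=> x; rewrite indicE; case: (boolP (x \in _)); last by rewrite eqxx.
    by rewrite inE/= in_itv/= => /andP[x0 x1] _; rewrite gtr0_norm.
have -> : gauss_weight a 1 = \int[lam]_x (gauss_weight a 1 * \1_(`]0 : R, 1]%classic) x).
  have m1 : lebesgue_measure (`]0 : R, 1]%classic) = 1%E.
    by rewrite lebesgue_measure_itv/= lte_fin ltr01 oppr0 adde0.
  by rewrite RintZ// /Rintegral integral_indic// setIT [X in fine X]m1 mulr1.
apply: le_Rint; first exact: RintegrableZ.
- exact: Rintegrable_gauss_weight (@pg_pos_indic R).
- move=> x; rewrite indicE; case: (boolP (x \in _)); last first.
    by move=> _; rewrite mulr0 mulr_ge0// ltW// gauss_weight_gt0.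
  rewrite inE/= in_itv/= => /andP[x0 x1]; rewrite /pos_indic x0 !mulr1.
  rewrite ler_expR lerN2 ler_pM2r ?invr_gt0// expr1n.
  by rewrite exprn_ile1// ltW.
Qed.

Definition gauss_root (x : R) := expR (- (x ^+ 2 / (2 * a))).

Definition hermite0_norm (b : bool) : R :=
  Num.sqrt (if b then E (fun x => pos_part x ^+ 2) else E (fun=> 1)).
Definition hermite1_norm : R := Num.sqrt (E (fun x => x ^+ 2)).

(** On the half line this is the odd Hermite function of degree 1, cut off by [pos_part] so that it
    can be integrated over the whole line. *)
Definition hermite0 (b : bool) (x : R) : R :=
  gauss_root x * (if b then pos_part x else 1) / hermite0_norm b.
Definition hermite1 (b : bool) (x : R) : R :=
  if b then 0 else gauss_root x * x / hermite1_norm.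

Let Np_gt0 : 0 < E (fun x => pos_part x ^+ 2).
Proof. by rewrite gauss_mean_halfline_sqr// mulr_gt0// divr_gt0. Qed.

Let N0_gt0 : 0 < E (fun=> 1).
Proof.
apply: lt_le_trans gauss_mean_pos_indic_gt0 _; apply: le_Rint.
- exact: Rintegrable_gauss_weight (@pg_pos_indic R).
- exact: Rintegrable_gauss_weight (pg_cst 1).
- move=> x; rewrite ler_pM2l ?gauss_weight_gt0//.
  by rewrite /pos_indic; case: ltP => //=; rewrite ler01.
Qed.

Let N1_gt0 : 0 < E (fun x => x ^+ 2).
Proof. by rewrite gauss_mean_sqr// mulr_gt0// divr_gt0. Qed.

Lemma hermite0_norm_gt0 b : 0 < hermite0_norm b.
Proof. by rewrite sqrtr_gt0; case: b. Qed.

Lemma hermite1_norm_gt0 : 0 < hermite1_norm.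
Proof. by rewrite sqrtr_gt0. Qed.

Lemma gauss_root_sqr x : gauss_root x * gauss_root x = gauss_weight a x.
Proof.
rewrite /gauss_root -expRD; congr expR; field; exact: lt0r_neq0.
Qed.

Lemma continuous_gauss_root : continuous gauss_root.
Proof.
move=> x; apply: continuous_comp; last exact: continuous_expR.
apply: cvgN; apply: cvgM; last exact: cvg_cst.
exact: exprn_continuous.
Qed.

Lemma continuous_hermite0 b : continuous (hermite0 b).
Proof.
have cr := continuous_gauss_root; have cp := @continuous_pos_part R.
by rewrite /hermite0; case: b; cont_auto.
Qed.

Lemma continuous_hermite1 b : continuous (hermite1 b).
Proof.
have cr := continuous_gauss_root.
by rewrite /hermite1; case: b; cont_auto.
Qed.

Lemma hermite0_sqr b x : hermite0 b x * hermite0 b x = gauss_weight a x *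
  ((if b then pos_part x ^+ 2 else 1) / hermite0_norm b ^+ 2).
Proof.
by rewrite /hermite0 -gauss_root_sqr; case: b; field; exact: lt0r_neq0 (hermite0_norm_gt0 _).
Qed.

Lemma Rint_hermite00 b : \int[lam]_x (hermite0 b x * hermite0 b x) = 1.
Proof.
rewrite (eq_Rint lam (hermite0_sqr b)).
rewrite (_ : (fun x => _) = fun x => (hermite0_norm b ^+ 2)^-1 *
  (gauss_weight a x * (if b then pos_part x ^+ 2 else 1))); last first.
  by apply/funext => x; rewrite [LHS]mulrA mulrC.
have pp := @pg_pos_part R; have pp2 := pgM pp pp.
rewrite RintZ; last first.
  apply: Rintegrable_gauss_weight => //; case: b => //; exact: pg_cst.
rewrite /hermite0_norm sqr_sqrtr; last by case: b; exact: ltW.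
by case: b; rewrite -/(E _) mulVf// gt_eqF.
Qed.

Lemma Rint_hermite11 b : \int[lam]_x (hermite1 b x * hermite1 b x) = (~~ b)%:R.
Proof.
rewrite /hermite1; case: b => /=.
  by rewrite -[RHS](Rint_zero lam); apply: eq_Rint => x; rewrite mulr0.
rewrite (@eq_Rint _ _ _ lam _ (fun x => (hermite1_norm ^+ 2)^-1 * (gauss_weight a x * x ^+ 2))); last first.
  by move=> x; rewrite -gauss_root_sqr; field; exact: lt0r_neq0 hermite1_norm_gt0.
rewrite RintZ; last exact: (Rintegrable_gauss_weight a0 (@pgX R 2)).
by rewrite /hermite1_norm sqr_sqrtr ?ltW// mulVf// gt_eqF.
Qed.

Lemma Rint_hermite01 b : \int[lam]_x (hermite0 b x * hermite1 b x) = 0.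
Proof.
rewrite /hermite1; case: b => /=.
  by rewrite -[RHS](Rint_zero lam); apply: eq_Rint => x; rewrite mulr0.
rewrite (@eq_Rint _ _ _ lam _ (fun x => (hermite0_norm false * hermite1_norm)^-1 * (gauss_weight a x * x))); last first.
  move=> x; rewrite /hermite0 -gauss_root_sqr; field.
  by rewrite !lt0r_neq0 ?hermite1_norm_gt0// hermite0_norm_gt0.
rewrite RintZ; last exact: (Rintegrable_gauss_weight a0 (@pg_id R)).
by rewrite -/(E _) gauss_mean_id// mulr0.
Qed.

Lemma Rintegrable_hermite b (i j : bool) : Rintegrable lam
  (fun x => (if i then hermite1 b x else hermite0 b x) *
            (if j then hermite1 b x else hermite0 b x)).
Proof.
pose p (i : bool) x := if i then if b then 0 else x / hermite1_norm
  else (if b then pos_part x else 1) / hermite0_norm b.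
have pp := @pg_pos_part R.
have pgp l : pg (p l) by rewrite /p; case: l; case: (b); pg_auto.
rewrite (_ : (fun x => _) = fun x => gauss_weight a x * (p i x * p j x)).
  by apply: Rintegrable_gauss_weight => //; exact: pgM.
apply/funext => x; rewrite -gauss_root_sqr /p /hermite0 /hermite1.
by case: i; case: j; case: (b); ring.
Qed.

Lemma bessel_line b f (s := \int[lam]_x (f x * hermite0 b x))
    (t := \int[lam]_x (f x * hermite1 b x)) :
  Rintegrable lam (fun x => f x ^+ 2) ->
  Rintegrable lam (fun x => f x * hermite0 b x) ->
  Rintegrable lam (fun x => f x * hermite1 b x) ->
  s ^+ 2 + t ^+ 2 <= \int[lam]_x (f x ^+ 2).
Proof.
move=> f2 f0 f1.
have i00 := Rintegrable_hermite b false false.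
have i11 := Rintegrable_hermite b true true.
have i01 := Rintegrable_hermite b false true.
have := Rint_ge0 lam (fun x => sqr_ge0 (f x - s * hermite0 b x - t * hermite1 b x)).
rewrite (@eq_Rint _ _ _ lam _ (fun x => f x ^+ 2 - (2 * s) * (f x * hermite0 b x)
   - (2 * t) * (f x * hermite1 b x) + s ^+ 2 * (hermite0 b x * hermite0 b x)
   + t ^+ 2 * (hermite1 b x * hermite1 b x)
   + (2 * s * t) * (hermite0 b x * hermite1 b x))); last by move=> x; ring.
rewrite !(RintB, RintD, RintZ)//; try by rint_auto.
rewrite Rint_hermite00 Rint_hermite11 Rint_hermite01 -/s -/t.
(* On the half line [hermite1] is 0, so its square contributes 0 instead of [t^2]; the expansion
   then yields [s^2 + 2 t^2], which is more than needed. *)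
by case: b @s @t {f0 f1 i00 i11 i01} => s t /=; have := sqr_ge0 t; lra.
Qed.

End coordinate.

(** * The annihilation operator in one variable *)

Section coordinate_gap.
Context (R : realType) (a : R).
Hypothesis a0 : 0 < a.
Implicit Types f df g : R -> R.
Notation lam := (@lebesgue_measure R).
Notation pg := polynomial_growth.
Notation E := (gauss_mean a).

(** A globally continuous function equal to [1 / x] for [x >= 1 / M], hence on the support of the
    functions considered on the half line. *)
Lemma continuous_inv_max (M : R) : 0 < M ->
  continuous (fun x : R => (Num.max x M^-1)^-1).
Proof.
move=> M0; apply: continuous_inv => [|x]; last first.
  by rewrite lt0r_neq0// lt_max invr_gt0 M0 orbT.
rewrite (funext (fun x => maxr_absE x M^-1)).
have cn : continuous (fun x : R => `|x - M^-1|).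
  by move=> x; apply: (@continuous_comp _ _ _ (fun x => x - M^-1) Num.norm);
    [apply: cvgB; [exact: cvg_id|exact: cvg_cst]|exact: norm_continuous].
by cont_auto.
Qed.

(** One [M] bounds the support and, through its inverse, keeps it away from 0 on a half-line
    coordinate; enlarging [M] weakens both conditions. *)
Definition C1_line (b : bool) (M : R) f df := [/\ 0 < M,
  forall x : R, is_derive x 1 f (df x), continuous df &
  forall x, (f x != 0) || (df x != 0) -> `|x| <= M /\ (b -> M^-1 <= x)].

(* The annihilation operator of the ground state [hermite0]; [b] marks a half-line
   coordinate. *)
Definition annih (b : bool) f df (x : R) : R :=
  (a * df x + x * f x - (if b then a * f x / x else 0)) / Num.sqrt (2 * a).

Lemma Rintegrable_continuous_support g M : continuous g ->
  (forall x, g x != 0 -> `|x| <= M) -> Rintegrable lam g.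
Proof.
move=> cg gM; have [C _ gC] := continuous_support_bounded cg gM.
exact: Rintegrable_bounded_support (continuous_measurable_fun cg) gC gM.
Qed.

Section fixed_function.
Context (b : bool) (M : R) (f df : R -> R).
Hypothesis C1f : C1_line b M f df.

Let M0 : 0 < M. Proof. by case: C1f. Qed.
Let dfE (x : R) : is_derive x 1 f (df x). Proof. by case: C1f. Qed.
Let cdf : continuous df. Proof. by case: C1f. Qed.
Let cf : continuous f. Proof. exact: continuous_derivable dfE. Qed.
Let supp x : (f x != 0) || (df x != 0) -> `|x| <= M /\ (b -> M^-1 <= x).
Proof. by case: C1f => _ _ _; apply. Qed.

Let fM x : f x != 0 -> `|x| <= M.
Proof. by move=> fx; case: (supp (x := x)) => //; rewrite fx. Qed.
Let dfM x : df x != 0 -> `|x| <= M.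
Proof. by move=> fx; case: (supp (x := x)) => //; rewrite fx orbT. Qed.

Let r (x : R) := (Num.max x M^-1)^-1.

Let cr : continuous r. Proof. exact: continuous_inv_max. Qed.

Let f_divE x : b -> f x / x = f x * r x.
Proof.
move=> bT; have [->|fx] := eqVneq (f x) 0; first by rewrite !mul0r.
have [|_ /(_ bT) Mx] := @supp x; first by rewrite fx.
by rewrite /r max_l.
Qed.

Let f_nonpos x : b -> x <= 0 -> f x = 0.
Proof.
move=> bT x0; apply/eqP; apply: contraT => fx.
have [|_ /(_ bT) Mx] := @supp x; first by rewrite fx.
by have := le_trans Mx x0; rewrite leNgt invr_gt0 M0.
Qed.

Let annihE x : annih b f df x =
  (a * df x + x * f x - (if b then a * (f x * r x) else 0)) / Num.sqrt (2 * a).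
Proof.
by rewrite /annih; case: ifP => // bT; rewrite -mulrA f_divE.
Qed.

Lemma continuous_annih : continuous (annih b f df).
Proof.
rewrite (funext annihE).
by case: (b); cont_auto.
Qed.

Lemma annih_support x : annih b f df x != 0 -> `|x| <= M.
Proof.
apply: contraNT => xM.
have f0 : f x = 0 by apply/eqP; apply: contraNT xM => /fM.
have df0 : df x = 0 by apply/eqP; apply: contraNT xM => /dfM.
by rewrite annihE f0 df0 !(mulr0, mul0r); case: (b); rewrite ?subr0 !addr0 ?subr0 mul0r.
Qed.

Let intg g h : continuous g -> continuous h -> (forall x, g x != 0 -> `|x| <= M) ->
  Rintegrable lam (fun x => g x * h x).
Proof.
move=> cg ch gM; apply: (@Rintegrable_continuous_support _ M).
  exact: continuous_mul.
by move=> x; rewrite mulf_eq0 negb_or => /andP[/gM].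
Qed.

Lemma Rintegrable_C1 h : continuous h -> Rintegrable lam (fun x => f x * h x).
Proof. by move=> ch; exact: intg. Qed.

Lemma Rintegrable_C1' h : continuous h -> Rintegrable lam (fun x => df x * h x).
Proof. by move=> ch; exact: intg. Qed.

Lemma Rintegrable_annih h : continuous h -> Rintegrable lam (fun x => annih b f df x * h x).
Proof. by move=> ch; apply: intg => //; [exact: continuous_annih|exact: annih_support]. Qed.

Let Rint_derive_C1 (g dg : R -> R) : (forall x : R, is_derive x 1 g (dg x)) ->
  continuous dg -> (forall x, g x != 0 -> `|x| <= M) -> (forall x, dg x != 0 -> `|x| <= M) ->
  \int[lam]_x dg x = 0.
Proof.
move=> gE cdg gM dgM; apply: (Rint_derive_eq0 gE cdg).
- exact: Rintegrable_continuous_support dgM.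
- apply: cvg_near_cst; near=> n; apply/eqP; apply: contraT => /gM.
  rewrite normr_nat leNgt => /negP[].
  by near: n; exact: nbhs_infty_gtr.
- apply: cvg_near_cst; near=> n; apply/eqP; apply: contraT => /gM.
  rewrite normrN normr_nat leNgt => /negP[].
  by near: n; exact: nbhs_infty_gtr.
Unshelve. all: end_near. Qed.

(** The integrand is the derivative of [f^2 / x], with [1 / x] replaced by the continuous [r]; near
    points below [1 / M] everything is 0. *)
Let Rint_half : b -> \int[lam]_x (2 * (f x * df x) * r x - (f x * r x) ^+ 2) = 0.
Proof.
move=> bT.
apply: (@Rint_derive_C1 (fun x => f x ^+ 2 * r x)).
- move=> x; have [xM|xM] := ltP x M^-1.
    have fx : f x = 0.
      apply/eqP; apply: contraT => fx; have [|_ /(_ bT)] := @supp x; first by rewrite fx.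
      by rewrite leNgt xM.
    have -> : 2 * (f x * df x) * r x - (f x * r x) ^+ 2 = 0 by rewrite fx; ring.
    apply: (@near_eq_is_derive R R R (fun=> 0)).
    near=> y; have yM : y < M^-1 by near: y; exact: lt_nbhsl.
    apply/eqP; rewrite eq_sym; apply: contraT; rewrite mulf_eq0 expf_eq0/= negb_or => /andP[fy _].
    have [|_ /(_ bT)] := @supp y; first by rewrite fy.
    by rewrite leNgt yM.
  have x0 : 0 < x by rewrite (lt_le_trans _ xM)// invr_gt0.
  have rx : r x = x^-1 by rewrite /r max_l.
  have -> : (fun x => f x ^+ 2 * r x) = (fun x => f x ^+ 2 * x^-1).
    by apply/funext => y; rewrite expr2 -mulrA -f_divE// mulrA.
  have d2 : is_derive x 1 (fun y => f y ^+ 2) (2 * (f x * df x)).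
    have := dfE x => ?; apply: is_derive_eq; rewrite /GRing.scale/=; ring.
  have dV := is_derive_inv (lt0r_neq0 x0) (is_derive_id x 1).
  have /is_derive_eq := is_derive_mul d2 dV; apply.
  by rewrite rx; field; exact: lt0r_neq0.
- by cont_auto.
- by move=> x; rewrite mulf_eq0 expf_eq0/= negb_or => /andP[/fM].
- move=> x; apply: contraNT => xM.
  have -> : f x = 0 by apply/eqP; apply: contraNT xM => /fM.
  by rewrite (_ : _ - _ = 0)//; ring.
Unshelve. all: end_near. Qed.

Let Rint_xf : \int[lam]_x (f x * f x + 2 * (x * (f x * df x))) = 0.
Proof.
apply: (@Rint_derive_C1 (fun x => x * f x ^+ 2)).
- move=> x; have := dfE x => ?; apply: is_derive_eq; rewrite /GRing.scale/=; ring.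
- by cont_auto.
- by move=> x; rewrite mulf_eq0 expf_eq0/= negb_or => /andP[_ /fM].
- move=> x; apply: contraNT => xM.
  have -> : f x = 0 by apply/eqP; apply: contraNT xM => /fM.
  by rewrite !(mul0r, mulr0) addr0.
Qed.

Let sqrt2a : Num.sqrt (2 * a) ^+ 2 = 2 * a.
Proof. by rewrite sqr_sqrtr// mulr_ge0// ltW. Qed.

(** Expanding the square, the cross terms are the derivatives of [x f^2] and, on the half line, of
    [f^2 / x], up to multiples of [f^2]. Those derivatives integrate to 0, and the multiples add up
    to the ground energy, 1/2 or 3/2. *)
Lemma annih_energy : \int[lam]_x (annih b f df x * annih b f df x) =
  (a * \int[lam]_x (df x * df x) + (\int[lam]_x (f x * (x ^+ 2 * f x))) / a) / 2
  - (1 / 2 + b%:R) * \int[lam]_x (f x * f x).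
Proof.
(* The two exact derivatives are named abstractly so that linearity of the integral does not take
   them apart. *)
have [g4 g4E] : {g : R -> R | forall x, g x = f x * f x + 2 * (x * (f x * df x))} by eexists.
have [g5 g5E] : {g : R -> R |
  forall x, g x = 2 * (f x * df x) * r x - (f x * r x) ^+ 2} by eexists.
have key x : annih b f df x * annih b f df x = a / 2 * (df x * df x) + (2 * a)^-1 * (f x * (x ^+ 2 * f x))
   - (1 / 2 + b%:R) * (f x * f x)
   + 2^-1 * g4 x - b%:R * (a / 2) * g5 x.
  rewrite annihE g4E g5E.
  rewrite (_ : forall z, z / Num.sqrt (2 * a) * (z / Num.sqrt (2 * a)) = z ^+ 2 / (2 * a)); last first.
    by move=> z; rewrite mulf_div -!expr2 sqrt2a.
  case: (boolP b) => bT /=; last by field; exact: lt0r_neq0.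
  have : x * (f x * r x) = f x.
    rewrite -f_divE//; have [x0|x0] := eqVneq x 0; first by rewrite x0 mul0r f_nonpos.
    by rewrite mulrC divfK.
  rewrite (_ : 2 * (f x * df x) * r x = 2 * df x * (f x * r x)); last by ring.
  move: (f x * r x) => k <-.
  by field; exact: lt0r_neq0.
have i1 : Rintegrable lam (fun x => df x * df x) by exact: intg.
have i2 : Rintegrable lam (fun x => f x * (x ^+ 2 * f x)) by apply: intg => //; cont_auto.
have i3 : Rintegrable lam (fun x => f x * f x) by exact: intg.
have i4 : Rintegrable lam g4.
  rewrite (funext g4E); apply: RintegrableD => //; apply: RintegrableZ.
  rewrite (_ : (fun x => _) = fun x => f x * (x * df x)).
    by apply: intg => //; cont_auto.
  by apply/funext => x; ring.
have i5 : Rintegrable lam g5.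
  rewrite (_ : g5 = fun x => f x * (2 * df x * r x - f x * r x ^+ 2)).
    by apply: intg => //; cont_auto.
  by apply/funext => x; rewrite g5E; ring.
rewrite (@eq_Rint _ _ _ lam _ _ key) !(RintB, RintD, RintZ)//; try by rint_auto.
have Z : b%:R * (a / 2) * \int[lam]_x g5 x = 0.
  rewrite (@eq_Rint _ _ _ lam _ _ g5E).
  by case: (boolP b) => [bT|_]; [rewrite Rint_half// mulr0|rewrite !mul0r].
have Y : \int[lam]_x g4 x = 0 by rewrite (@eq_Rint _ _ _ lam _ _ g4E) Rint_xf.
rewrite Z Y subr0 mulr0 addr0; congr (_ - _).
by field; exact: lt0r_neq0.
Qed.

End fixed_function.

Lemma C1_line_weaken b M f df : C1_line b M f df -> C1_line false M f df.
Proof. by move=> [M0 dE cd supp]; split => // x /supp[]. Qed.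

Section gap.
Context (b : bool) (M : R) (f df : R -> R).
Hypothesis C1f : C1_line b M f df.

Let dfE (x : R) : is_derive x 1 f (df x). Proof. by case: C1f. Qed.
Let cdf : continuous df. Proof. by case: C1f. Qed.
Let cf : continuous f. Proof. exact: continuous_derivable dfE. Qed.

Let f_large x : M < `|x| -> f x = 0 /\ df x = 0.
Proof.
case: C1f => _ _ _ supp xM.
have : ~~ ((f x != 0) || (df x != 0)) by apply/negP => /supp[]; rewrite leNgt xM.
by rewrite negb_or !negbK => /andP[/eqP-> /eqP->].
Qed.

Let f_nonpos x : b -> x <= 0 -> f x = 0 /\ df x = 0.
Proof.
case: C1f => M0 _ _ supp bT x0.
have : ~~ ((f x != 0) || (df x != 0)).
  apply/negP => /supp[_ /(_ bT)] /le_trans/(_ x0).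
  by rewrite leNgt invr_gt0 M0.
by rewrite negb_or !negbK => /andP[/eqP-> /eqP->].
Qed.

(* The gap is 2 on the complement of the ground state on the half line, because
   the next odd Hermite function is the third one. *)
Lemma annih_gap (s := \int[lam]_x (f x * hermite0 a b x))
    (t := \int[lam]_x (f x * hermite1 a b x)) :
  2 * \int[lam]_x (f x * f x) - 2 * s ^+ 2 - t ^+ 2 <=
  \int[lam]_x (annih b f df x * annih b f df x).
Proof.
(* Ground-state substitution: [th] is the inverse of [gauss_root], and [V = f * th] turns Lebesgue
   integrals of [f] into Gaussian means. *)
pose th (x : R) := expR (x ^+ 2 / (2 * a)).
have thK x : gauss_root a x * th x = 1 by rewrite -expRD addNr expR0.
have thK2 x : gauss_weight a x * (th x * th x) = 1.
  by rewrite -gauss_root_sqr// mulrACA !thK mulr1.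
have dth (x : R) : is_derive x 1 th (th x * (x / a)).
  rewrite /th; apply: is_derive_eq.
  by rewrite /GRing.scale/=; field; exact: lt0r_neq0.
pose V x := f x * th x; pose V1 x := (df x + x / a * f x) * th x.
have dV (x : R) : is_derive x 1 V (V1 x).
  by have /is_derive_eq := is_derive_mul (dfE x) (dth x); apply; rewrite /V1; ring.
have cth : continuous th := continuous_derivable dth.
have cV1 : continuous V1 by rewrite /V1; cont_auto.
have VM x : V x != 0 -> `|x| <= M.
  by rewrite leNgt; apply: contraNN => /f_large[fx _]; rewrite /V fx mul0r.
have V1M x : V1 x != 0 -> `|x| <= M.
  by rewrite leNgt; apply: contraNN => /f_large[fx dfx]; rewrite /V1 fx dfx mulr0 addr0 mul0r.
have EV2 : E (fun x => V x ^+ 2) = \int[lam]_x (f x * f x).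
  apply: eq_Rint => x; rewrite /V; transitivity (gauss_weight a x * (th x * th x) * (f x * f x)).
    by ring.
  by rewrite thK2 mul1r.
(* [V] is taken relative to the line even when [b] holds, so its energy is that of [annih false].
   The ground energies 3/2 and 1/2 differ by 1, which lowers the half-line constant 3 to 2. *)
have EV12 : a / 2 * E (fun x => V1 x ^+ 2) =
    \int[lam]_x (annih b f df x * annih b f df x) + b%:R * \int[lam]_x (f x * f x).
  transitivity (\int[lam]_x (annih false f df x * annih false f df x)).
    rewrite -gauss_meanZ//; last first.
      have [C _ VC] := continuous_support_bounded cV1 V1M.
      by have pV := pg_bounded (continuous_measurable_fun cV1) VC; exact: pgM.
    apply: eq_Rint => x; rewrite /V1 /annih subr0 mulf_div -!expr2.
    rewrite sqr_sqrtr; last by rewrite mulr_ge0// ltW.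
    transitivity (gauss_weight a x * (th x * th x) * ((a * df x + x * f x) ^+ 2 / (2 * a))).
      by field; exact: lt0r_neq0.
    by rewrite thK2 mul1r.
  by rewrite (annih_energy C1f) (annih_energy (C1_line_weaken C1f))/=; ring.
have EV1 : E V = \int[lam]_x (f x * gauss_root a x).
  apply: eq_Rint => x; rewrite /V -gauss_root_sqr//.
  transitivity (f x * gauss_root a x * (gauss_root a x * th x)); first by ring.
  by rewrite thK mulr1.
have EXV : E (fun x => x * V x) = \int[lam]_x (f x * (gauss_root a x * x)).
  apply: eq_Rint => x; rewrite /V -gauss_root_sqr//.
  transitivity (f x * (gauss_root a x * x) * (gauss_root a x * th x)); first by ring.
  by rewrite thK mulr1.
have ig h : continuous h -> Rintegrable lam (fun x => f x * h x).
  by move=> ch; exact: (Rintegrable_C1 C1f ch).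
have cr : continuous (gauss_root a) by exact: continuous_gauss_root.
have N0 := hermite0_norm_gt0 a0 b; have N1 := hermite1_norm_gt0 a0.
have [bT|bF] := boolP b.
  have V0 x : x <= 0 -> V x = 0.
    by move=> x0; rewrite /V (proj1 (f_nonpos bT x0)) mul0r.
  have V10 x : x <= 0 -> V1 x = 0.
    by move=> x0; have [fx dfx] := f_nonpos bT x0; rewrite /V1 fx dfx mulr0 addr0 mul0r.
  move: N0; rewrite /hermite0_norm bT sqrtr_gt0 => N0.
  have := gauss_gap_halfline a0 dV cV1 VM V1M V0 V10 N0.
  have -> : t = 0.
    rewrite /t /hermite1 bT -[RHS](Rint_zero lam); apply: eq_Rint => x.
    by rewrite mulr0.
  have -> : s ^+ 2 = E (fun x => x * V x) ^+ 2 / E (fun x => pos_part x ^+ 2).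
    rewrite /s /hermite0 /hermite0_norm bT EXV.
    rewrite (@eq_Rint _ _ _ lam _ (fun x => (Num.sqrt (E (fun x => pos_part x ^+ 2)))^-1
       * (f x * (gauss_root a x * x)))); last first.
      move=> x; rewrite /pos_part; case: ltP => x0; first by ring.
      by rewrite (proj1 (f_nonpos bT x0)) !(mul0r, mulr0).
    rewrite RintZ; last by apply: ig; cont_auto.
    by rewrite exprMn exprVn sqr_sqrtr ?ltW// mulrC.
  by rewrite EV2 EV12 bT expr0n/=; lra.
have {}bF : b = false by exact/negbTE.
move: N0; rewrite /hermite0_norm bF sqrtr_gt0 => N0.
have := gauss_gap a0 dV cV1 VM V1M N0.
have -> : s ^+ 2 = E V ^+ 2 / E (fun=> 1).
  rewrite /s /hermite0 /hermite0_norm bF EV1.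
  rewrite (@eq_Rint _ _ _ lam _ (fun x => (Num.sqrt (E (fun=> 1)))^-1
     * (f x * gauss_root a x))); last by move=> x; ring.
  by rewrite RintZ ?exprMn ?exprVn ?sqr_sqrtr ?ltW// 1?mulrC//; exact: ig.
have -> : t ^+ 2 = E (fun x => x * V x) ^+ 2 / E (fun x => x ^+ 2).
  move: N1; rewrite /hermite1_norm sqrtr_gt0 => N1.
  rewrite /t /hermite1 /hermite1_norm bF EXV.
  rewrite (@eq_Rint _ _ _ lam _ (fun x => (Num.sqrt (E (fun x => x ^+ 2)))^-1
     * (f x * (gauss_root a x * x)))); last by move=> x; ring.
  rewrite RintZ; last by apply: ig; cont_auto.
  by rewrite exprMn exprVn sqr_sqrtr ?ltW// mulrC.
by rewrite EV2 EV12 bF /=; lra.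
Qed.

(** The first gap follows from [annih_gap] by absorbing [s^2 + t^2] into one copy of the squared
    norm, by Bessel's inequality. *)
Lemma annih_gap1 (s := \int[lam]_x (f x * hermite0 a b x)) :
  \int[lam]_x (f x * f x) - s ^+ 2 <=
  \int[lam]_x (annih b f df x * annih b f df x).
Proof.
have i0 : Rintegrable lam (fun x => f x * hermite0 a b x).
  by apply: (Rintegrable_C1 C1f); exact: continuous_hermite0.
have i1 : Rintegrable lam (fun x => f x * hermite1 a b x).
  by apply: (Rintegrable_C1 C1f); exact: continuous_hermite1.
have i2 : Rintegrable lam (fun x => f x ^+ 2) := Rintegrable_C1 C1f cf.
have /= := bessel_line a0 i2 i0 i1; have /= := annih_gap; rewrite -/s.
have -> : \int[lam]_x (f x ^+ 2) = \int[lam]_x (f x * f x) by [].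
by lra.
Qed.

End gap.
End coordinate_gap.

(** * Tensorisation *)

Section iterated_integral.
Context (R : realType).
Notation lam := (@lebesgue_measure R).
Notation mu := (lebesgue_rV R).

Definition vcons (n : nat) (x : R) (y : 'rV[R]_n) : 'rV[R]_n.+1 := row_cons (x, y).

Lemma vcons0 n x (y : 'rV[R]_n) : vcons x y ord0 ord0 = x.
Proof. by rewrite /vcons /row_cons mxE unlift_none. Qed.

Lemma vcons_lift n x (y : 'rV[R]_n) j : vcons x y ord0 (lift ord0 j) = y ord0 j.
Proof. by rewrite /vcons /row_cons mxE liftK. Qed.

Lemma measurable_vcons n x : measurable_fun [set: 'rV[R]_n] (vcons x).
Proof.
apply/measurable_fun_coordP => i; case: (unliftP ord0 i) => [j ->|->].
  by under eq_fun do rewrite vcons_lift; exact: measurable_coord.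
by under eq_fun do rewrite vcons0; exact: measurable_cst.
Qed.

Lemma measurable_vcons_l n (y : 'rV[R]_n) :
  measurable_fun [set: measurableTypeR R] (fun x => vcons x y).
Proof.
apply/measurable_fun_coordP => i; case: (unliftP ord0 i) => [j ->|->].
  by under eq_fun do rewrite vcons_lift; exact: measurable_cst.
by under eq_fun do rewrite vcons0; exact: measurable_id.
Qed.

Let leb : {sigma_finite_measure set (measurableTypeR R) -> \bar R} :=
  lebesgue_measure.

Lemma ge0_integral_vcons n (f : 'rV[R]_n.+1 -> \bar R) :
  measurable_fun [set: 'rV[R]_n.+1] f -> (forall x, 0 <= f x)%E ->
  (\int[mu n.+1]_z f z = \int[lam]_x \int[mu n]_y f (vcons x y))%E.
Proof.
move=> mf f0; have mc := @measurable_row_cons R n.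
have := @ge0_integral_pushforward _ _ _ _ R _ mc (leb \x mu n)%E setT f measurableT mf (fun y _ => f0 y).
rewrite preimage_setT => E; apply: etrans E _.
rewrite (@fubini_tonelli1 _ _ _ _ R leb (mu n) (f \o @row_cons R n)) => [//||x].
  exact: (measurableT_comp mf mc).
exact: f0.
Qed.

Lemma integrable_row_cons n (F : 'rV[R]_n.+1 -> R) : Rintegrable (mu n.+1) F ->
  (leb \x mu n)%E.-integrable setT (EFin \o F \o @row_cons R n).
Proof.
move=> iF; have mc := @measurable_row_cons R n.
have /integrableP[mF Foo] := iF; apply/integrableP; split.
  exact: (measurableT_comp mF mc).
have mF' : measurable_fun [set: 'rV[R]_n.+1] (fun x => `|(EFin \o F) x|%E).
  exact: measurableT_comp.
have := @ge0_integral_pushforward _ _ _ _ R _ mc (leb \x mu n)%E setT _ measurableT mF' (fun y _ => abse_ge0 _).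
by rewrite preimage_setT => <-.
Qed.

Lemma integral_vcons n (F : 'rV[R]_n.+1 -> R) : Rintegrable (mu n.+1) F ->
  (\int[mu n.+1]_z (F z)%:E = \int[leb \x mu n]_z (F (row_cons z))%:E)%E.
Proof.
move=> iF; have mc := @measurable_row_cons R n.
have /integrableP[mF _] := iF.
have := @integral_pushforward _ _ _ _ R _ mc (leb \x mu n)%E setT (EFin \o F) mF.
by rewrite preimage_setT => ->//; exact: integrable_row_cons.
Qed.

(** Every slice, not just almost every one, is taken integrable, so that the real-valued inner
    integral agrees everywhere with the extended one of Fubini's theorem. *)
Lemma Rintegrable_vcons n (F : 'rV[R]_n.+1 -> R) : Rintegrable (mu n.+1) F ->
  (forall x, Rintegrable (mu n) (fun y => F (vcons x y))) ->
  Rintegrable lam (fun x => \int[mu n]_y F (vcons x y)).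
Proof.
move=> iF iFx; have iF' := integrable_row_cons iF.
have E : EFin \o (fun x => \int[mu n]_y F (vcons x y)) =
    fubini_F (mu n) (EFin \o F \o @row_cons R n).
  by apply/funext => x; rewrite /= EFin_Rint.
by rewrite /Rintegrable E; exact: (integrable_fubini_F iF').
Qed.

Lemma Rint_vcons n (F : 'rV[R]_n.+1 -> R) : Rintegrable (mu n.+1) F ->
  (forall x, Rintegrable (mu n) (fun y => F (vcons x y))) ->
  \int[mu n.+1]_z F z = \int[lam]_x \int[mu n]_y F (vcons x y).
Proof.
move=> iF iFx; have iF' := integrable_row_cons iF.
rewrite /Rintegral integral_vcons// -(integral12_prod_meas1 iF').
congr fine; apply: eq_integral => x _.
by rewrite /fubini_F -/(Rintegral _ _ _) EFin_Rint.
Qed.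

Lemma Rint_vcons_swap n (F : 'rV[R]_n.+1 -> R) : Rintegrable (mu n.+1) F ->
  (forall y, Rintegrable lam (fun x => F (vcons x y))) ->
  \int[mu n.+1]_z F z = \int[mu n]_y \int[lam]_x F (vcons x y).
Proof.
move=> iF iFx; have iF' := integrable_row_cons iF.
rewrite /Rintegral integral_vcons// -(integral21_prod_meas1 iF').
congr fine; apply: eq_integral => x _.
by rewrite /fubini_G -/(Rintegral _ _ _) EFin_Rint.
Qed.

Definition box n (M : R) : set 'rV[R]_n := [set x | forall i, `|x ord0 i| <= M].

Lemma measurable_box n M : measurable (@box n M).
Proof.
rewrite (_ : box M = \bigcap_(i in [set: 'I_n]) ((fun x : 'rV[R]_n => x ord0 i) @^-1` `[- M, M])).
  apply: fin_bigcap_measurable; first exact: finite_finset.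
  move=> i _; rewrite -[X in measurable X]setTI; apply: measurable_coord => //.
apply/seteqP; split=> x h i /=.
  by move=> _; rewrite in_itv/= -ler_norml; exact: h.
by have := h i Logic.I; rewrite /= in_itv/= -ler_norml.
Qed.

Lemma box_lty n M : (mu n (@box n M) < +oo)%E.
Proof.
elim: n => [|n IH].
  rewrite /= diracE; exact: ltry.
pose J : set (measurableTypeR R) := `[- M, M]%classic.
have -> : mu n.+1 (@box n.+1 M) = ((leb \x mu n) (J `*` @box n M))%E.
  rewrite /= /cons_measure /pushforward; congr (_ _).
  apply/seteqP; split=> -[x y] /=.
    move=> h; split; last by move=> j; have := h (lift ord0 j); rewrite -/(vcons x y) vcons_lift.
    by rewrite /J/= in_itv/= -ler_norml; have := h ord0; rewrite -/(vcons x y) vcons0.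
  rewrite /J/= in_itv/= -ler_norml => -[hx hy] i; rewrite -/(vcons x y).
  by case: (unliftP ord0 i) => [j ->|->]; rewrite ?vcons_lift ?vcons0.
rewrite product_measure1E//; last exact: measurable_box.
apply: lte_mul_pinfty => //.
by rewrite ge0_fin_numE// /leb/= lebesgue_measure_itv/=; case: ifP => _; rewrite ?ltry.
exact: measurable_itv.
Qed.

(** A single [M] bounds the values and the support, which gives integrability on the whole space and
    on all slices. *)
Definition bounded_box n (M : R) (F : 'rV[R]_n -> R) :=
  [/\ measurable_fun [set: 'rV[R]_n] F, forall x, `|F x| <= M &
      forall x, F x != 0 -> forall i, `|x ord0 i| <= M].

Lemma Rintegrable_bounded_box n M (F : 'rV[R]_n -> R) : bounded_box M F ->
  Rintegrable (mu n) F.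
Proof.
move=> [mF FM Fsupp]; have mB := @measurable_box n M.
have -> : F = F \_ (box M).
  apply/funext => x; rewrite patchE; case: ifPn => // /negP xB.
  apply/eqP; apply: contraT => /Fsupp xM; exfalso; apply: xB.
  by rewrite inE.
rewrite /Rintegrable -restrict_EFin; apply/(integrable_mkcond _ mB).
apply: measurable_bounded_integrable => //; first exact: box_lty.
  exact: measurable_funTS.
by exists M; split; [exact: num_real|move=> C MC x _; exact: le_trans (FM x) (ltW MC)].
Qed.

Lemma bounded_box_vcons n M (F : 'rV[R]_n.+1 -> R) x : bounded_box M F ->
  bounded_box M (fun y => F (vcons x y)).
Proof.
move=> [mF FM Fsupp]; split => //.
  exact: (measurableT_comp mF (@measurable_vcons n x)).
by move=> y /Fsupp h i; have := h (lift ord0 i); rewrite vcons_lift.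
Qed.

Lemma Rint_rV0 (F : 'rV[R]_0 -> R) : \int[mu 0]_z F z = F 0.
Proof.
have -> : F = fun=> F 0 by apply/funext => x; rewrite (thinmx0 x).
by rewrite /Rintegral /= integral_dirac// diracT mul1e.
Qed.

End iterated_integral.

(** * Bounded functions of bounded support, slices and averages *)

Section box_functions.
Context (R : realType).
Notation lam := (@lebesgue_measure R).
Notation mu := (lebesgue_rV R).

Definition bbox n (F : 'rV[R]_n -> R) := exists M, bounded_box M F.

Lemma bbox_int n (F : 'rV[R]_n -> R) : bbox F -> Rintegrable (mu n) F.
Proof. by move=> [M /Rintegrable_bounded_box]. Qed.

Let bounded_box_ge0 n M (F : 'rV[R]_n -> R) : bounded_box M F -> 0 <= M.
Proof. by move=> [_ FM _]; rewrite (le_trans _ (FM 0)). Qed.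

Lemma bbox_mul n (F e : 'rV[R]_n -> R) C : bbox F ->
  measurable_fun [set: 'rV[R]_n] e -> (forall x, `|e x| <= C) ->
  bbox (fun x => F x * e x).
Proof.
move=> [M BF] me eC; have M0 := bounded_box_ge0 BF; case: BF => mF FM Fs.
have C0 : 0 <= C by rewrite (le_trans _ (eC 0)).
exists (M * (1 + C)); split; first exact: measurable_funM.
  move=> x; rewrite normrM ler_pM// (le_trans (eC x))// lerDr//.
move=> x; rewrite mulf_eq0 negb_or => /andP[/Fs h _] i.
by rewrite (le_trans (h i))// ler_peMr// lerDl.
Qed.

Lemma bbox_bound n (F : 'rV[R]_n -> R) : bbox F ->
  measurable_fun [set: 'rV[R]_n] F /\ exists C, forall x, `|F x| <= C.
Proof. by move=> [M [mF FM _]]; split => //; exists M. Qed.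

Lemma bboxM n (F G : 'rV[R]_n -> R) : bbox F -> bbox G -> bbox (fun x => F x * G x).
Proof. by move=> BF /bbox_bound[mG [C GC]]; exact: bbox_mul BF mG GC. Qed.

Lemma bboxD n (F G : 'rV[R]_n -> R) : bbox F -> bbox G -> bbox (fun x => F x + G x).
Proof.
move=> [M BF] [N BG]; have M0 := bounded_box_ge0 BF; have N0 := bounded_box_ge0 BG.
case: BF BG => mF FM Fs [mG GN Gs]; exists (M + N); split.
- exact: measurable_funD.
- by move=> x; rewrite (le_trans (ler_normD _ _))// lerD.
- move=> x FG i; have [Fx|/Fs/(_ i) Fx] := eqVneq (F x) 0; last first.
    by rewrite (le_trans Fx)// lerDl.
  by move: FG; rewrite Fx add0r => /Gs/(_ i) Gx; rewrite (le_trans Gx)// lerDr.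
Qed.

Lemma bboxZ n k (F : 'rV[R]_n -> R) : bbox F -> bbox (fun x => k * F x).
Proof.
move=> BF; rewrite (_ : (fun x => _) = fun x => F x * k); last first.
  by apply/funext => x; rewrite mulrC.
by apply: (bbox_mul (C := `|k|)) => //; exact: measurable_cst.
Qed.

Lemma bboxB n (F G : 'rV[R]_n -> R) : bbox F -> bbox G -> bbox (fun x => F x - G x).
Proof.
move=> BF BG; rewrite (_ : (fun x => _) = fun x => F x + (-1) * G x).
  by apply: bboxD => //; exact: bboxZ.
by apply/funext => x; rewrite mulN1r.
Qed.

(** The factor [h] may be unbounded: the support of [F] confines the coordinate to a compact
    interval. *)
Lemma bbox_coord n (i : 'I_n) (h : R -> R) (F : 'rV[R]_n -> R) :
  continuous h -> bbox F -> bbox (fun x => h (x ord0 i) * F x).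
Proof.
move=> ch [M BF]; have M0 := bounded_box_ge0 BF; case: BF => mF FM Fs.
have cN : {within `[- M, M], continuous (fun x => `|h x|)}.
  apply: continuous_subspaceT => x; apply: (continuous_comp (ch x)).
  exact: norm_continuous.
have MM : - M <= M by rewrite (le_trans _ M0)// oppr_le0.
have [c _ cmax] := EVT_max MM cN.
exists (M * (1 + `|h c|)); split.
- apply: measurable_funM => //.
  exact: (measurableT_comp (continuous_measurable_fun ch) (measurable_coord i)).
- move=> x; have [->|Fx] := eqVneq (F x) 0.
    by rewrite mulr0 normr0 mulr_ge0// addr_ge0.
  rewrite normrM mulrC ler_pM// (@le_trans _ _ `|h c|)// ?lerDr//.
  by apply: cmax; rewrite in_itv/= -ler_norml Fs.
- move=> x; rewrite mulf_eq0 negb_or => /andP[_ /Fs h'] j.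
  by rewrite (le_trans (h' j))// ler_peMr// lerDl.
Qed.

Lemma bbox_vcons n (F : 'rV[R]_n.+1 -> R) x : bbox F -> bbox (fun y => F (vcons x y)).
Proof. by move=> [M BF]; exists M; exact: bounded_box_vcons. Qed.

Lemma bbox_Rint n (F : 'rV[R]_n.+1 -> R) : bbox F ->
  Rintegrable lam (fun x => \int[mu n]_y F (vcons x y)).
Proof.
move=> BF; apply: Rintegrable_vcons; first exact: bbox_int.
by move=> x; exact/bbox_int/bbox_vcons.
Qed.

Lemma bbox_Rint_vcons n (F : 'rV[R]_n.+1 -> R) : bbox F ->
  \int[mu n.+1]_z F z = \int[lam]_x \int[mu n]_y F (vcons x y).
Proof.
move=> BF; apply: Rint_vcons; first exact: bbox_int.
by move=> x; exact/bbox_int/bbox_vcons.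
Qed.

Lemma bbox_Rint_vcons_swap n (F : 'rV[R]_n.+1 -> R) : bbox F ->
  \int[mu n.+1]_z F z = \int[mu n]_y \int[lam]_x F (vcons x y).
Proof.
move=> BF; apply: Rint_vcons_swap; first exact: bbox_int.
case: BF => M [mF FM Fs] y.
apply: (@Rintegrable_bounded_support _ _ M M) => //.
  exact: (measurableT_comp mF (@measurable_vcons_l _ n y)).
by move=> x /Fs/(_ ord0); rewrite vcons0.
Qed.

Definition upd n (x : 'rV[R]_n) (i : 'I_n) (t : R) : 'rV[R]_n :=
  \row_j if j == i then t else x ord0 j.

Lemma upd_vcons0 n x (y : 'rV[R]_n) t : upd (vcons x y) ord0 t = vcons t y.
Proof.
apply/rowP => i; rewrite [LHS]mxE; case: (unliftP ord0 i) => [j ->|->].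
  by rewrite !vcons_lift eq_sym (negbTE (neq_lift _ _)).
by rewrite eqxx vcons0.
Qed.

Lemma upd_vcons_lift n x (y : 'rV[R]_n) j t :
  upd (vcons x y) (lift ord0 j) t = vcons x (upd y j t).
Proof.
apply/rowP => i; rewrite [LHS]mxE; case: (unliftP ord0 i) => [l ->|->].
  by rewrite !vcons_lift mxE (inj_eq lift_inj).
by rewrite !vcons0 (negbTE (neq_lift _ _)).
Qed.

Lemma upd_id n (x : 'rV[R]_n) i : upd x i (x ord0 i) = x.
Proof. by apply/rowP => j; rewrite mxE; case: eqP => // ->. Qed.

(** Regularity is asked only along coordinate lines. This passes to slices, is all that
    one-dimensional integration by parts uses, and spares joint continuity of the partial
    derivatives. *)
Record C1_box n (b : 'I_n -> bool) (M : R) (f : 'rV[R]_n -> R)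
    (p : 'I_n -> 'rV[R]_n -> R) : Prop := C1Box {
  C1_box_gt0 : 0 < M ;
  C1_box_fun : bounded_box M f ;
  C1_box_partial : forall i, bounded_box M (p i) ;
  C1_box_support : forall (x : 'rV[R]_n) i, b i -> x ord0 i < M^-1 ->
    f x = 0 /\ forall j, p j x = 0 ;
  C1_box_derive : forall (x : 'rV[R]_n) i (t : R),
    is_derive t 1 (fun s => f (upd x i s)) (p i (upd x i t)) ;
  C1_box_continuous : forall (x : 'rV[R]_n) i, continuous (fun t => p i (upd x i t)) }.

Section C1.
Context n (b : 'I_n.+1 -> bool) (M : R) (f : 'rV[R]_n.+1 -> R)
  (p : 'I_n.+1 -> 'rV[R]_n.+1 -> R).
Hypothesis C1f : C1_box b M f p.

Lemma C1_box_slice x : C1_box (fun j => b (lift ord0 j)) M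
  (fun y => f (vcons x y)) (fun j y => p (lift ord0 j) (vcons x y)).
Proof.
case: C1f => M0 Bf Bp supp df cp; split => //.
- exact: bounded_box_vcons Bf.
- by move=> j; exact: bounded_box_vcons (Bp _).
- move=> y j bj yj; have := supp (vcons x y) _ bj; rewrite vcons_lift => /(_ yj)[-> h].
  by split.
- by move=> y j t; have := df (vcons x y) (lift ord0 j) t;
    under eq_fun do rewrite upd_vcons_lift; rewrite upd_vcons_lift.
- by move=> y j; have := cp (vcons x y) (lift ord0 j);
    under eq_fun do rewrite upd_vcons_lift.
Qed.

Lemma C1_box_line y : C1_line (b ord0) M (fun x => f (vcons x y))
  (fun x => p ord0 (vcons x y)).
Proof.
case: C1f => M0 [mf fM fs] Bp supp df cp; split => //.
- by move=> x; have := df (vcons 0 y) ord0 x;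
    under eq_fun do rewrite upd_vcons0; rewrite upd_vcons0.
- by have := cp (vcons 0 y) ord0; under eq_fun do rewrite upd_vcons0.
- move=> x fp; split.
    case/orP: fp => [/fs/(_ ord0)|]; first by rewrite vcons0.
    by case: (Bp ord0) => _ _ ps /ps/(_ ord0); rewrite vcons0.
  move=> b0; rewrite leNgt; apply/negP => xM.
  have [|fx px] := supp (vcons x y) ord0 b0; first by rewrite vcons0.
  by move: fp; rewrite fx px eqxx.
Qed.

Context (e : 'rV[R]_n -> R) (C : R).
Hypothesis me : measurable_fun [set: 'rV[R]_n] e.
Hypothesis eC : forall y, `|e y| <= C.

Let C0 : 0 <= C. Proof. by rewrite (le_trans _ (eC 0)). Qed.

Let G (y : 'rV[R]_n) : R := M * C * \1_(box M) y.

Let G_ge0 y : 0 <= G y.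
Proof. by rewrite /G !mulr_ge0// ltW//; case: C1f. Qed.

Let intG : (mu n).-integrable [set: 'rV[R]_n] (EFin \o G).
Proof.
apply: (@bbox_int n G); apply: bboxZ; have M0 := C1_box_gt0 C1f.
exists (1 + M); split.
- by apply: measurable_indic; exact: measurable_box.
- move=> y; rewrite indicE; case: (_ \in _) => /=; rewrite ?normr1 ?normr0.
    by rewrite lerDl ltW.
  by rewrite addr_ge0// ltW.
- move=> y; rewrite indicE; case: (boolP (y \in _)) => [|_ /=]; last by rewrite eqxx.
  by rewrite inE => yM _ i; rewrite (le_trans (yM i))// lerDr.
Qed.

Let dominated (q : 'rV[R]_n.+1 -> R) x y : bounded_box M q ->
  `|q (vcons x y) * e y| <= G y.
Proof.
move=> [_ qM qs]; have [->|qx] := eqVneq (q (vcons x y)) 0.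
  by rewrite mul0r normr0.
rewrite normrM /G indicE mem_set ?mulr1 ?ler_pM//.
by move=> i; have := qs _ qx (lift ord0 i); rewrite vcons_lift.
Qed.

Let intq (q : 'rV[R]_n.+1 -> R) x : bounded_box M q ->
  Rintegrable (mu n) (fun y => q (vcons x y) * e y).
Proof.
move=> Bq; apply: bbox_int; apply: (bbox_mul _ me eC).
by exists M; exact: bounded_box_vcons.
Qed.

(** Differentiation under the integral sign, with [G] dominating for all values of the first
    variable at once. It makes the coefficients of [f] in the remaining variables eligible for the
    one-dimensional gaps. *)
Lemma C1_box_average : C1_line (b ord0) M (fun x => \int[mu n]_y (f (vcons x y) * e y))
  (fun x => \int[mu n]_y (p ord0 (vcons x y) * e y)).
Proof.
have M0 := C1_box_gt0 C1f; have Bf := C1_box_fun C1f; have Bp := C1_box_partial C1f.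
have L := C1_box_line.
have d1 (x : R) y : is_derive x 1 (fun x => f (vcons x y) * e y) (p ord0 (vcons x y) * e y).
  have [_ dL _ _] := L y; have /is_derive_eq := is_derive_mul (dL x) (is_derive_cst (e y) x 1).
  by apply; rewrite mulr0 addr0.
split => //.
- move=> a.
  have Ia : `]a - 1, a + 1[%classic a by rewrite /= in_itv/=; apply/andP; split; lra.
  have d1E (x : R) y : derive1 (fun x => f (vcons x y) * e y) x = p ord0 (vcons x y) * e y.
    by rewrite derive1E; have [_ ->] := d1 x y.
  have H1 := @derivable_under_integral R _ _ (mu n) (fun x y => f (vcons x y) * e y)
    setT measurableT a (a - 1) (a + 1) Ia (fun x _ => intq x Bf)
    (fun x y _ _ => @ex_derive _ _ _ _ _ _ _ (d1 x y)) G G_ge0 intG.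
  have H2 := @differentiation_under_integral R _ _ (mu n) (fun x y => f (vcons x y) * e y)
    setT measurableT a (a - 1) (a + 1) Ia (fun x _ => intq x Bf)
    (fun x y _ _ => @ex_derive _ _ _ _ _ _ _ (d1 x y)) G G_ge0 intG.
  have dom x y : `]a - 1, a + 1[%classic x -> [set: 'rV[R]_n] y ->
      `|partial1of2 (fun x y => f (vcons x y) * e y) x y| <= G y.
    by move=> _ _; rewrite /partial1of2 d1E; exact: dominated.
  apply: DeriveDef; first exact: H1.
  rewrite -derive1E H2//; apply: eq_Rintegral => y _; exact: d1E.
- move=> a.
  have := @continuity_under_integral R _ _ (mu n) (fun x y => p ord0 (vcons x y) * e y)
    setT measurableT (a - 1) (a + 1) (fun x _ => intq x (Bp ord0)) _ G intG _ a.
  apply.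
  + apply: aeW => y _ x _; apply: cvgM; last exact: cvg_cst.
    by have [_ _ cL _] := L y; exact: cL.
  + by move=> x _; apply: aeW => y _; exact: dominated.
  + by apply/mem_set; rewrite /= in_itv/=; apply/andP; split; lra.
- move=> x; have z0 (q : 'rV[R]_n.+1 -> R) : (forall y, q (vcons x y) = 0) ->
      \int[mu n]_y (q (vcons x y) * e y) = 0.
    by move=> q0; rewrite -[RHS](Rint_zero (mu n)); apply: eq_Rint => y; rewrite q0 mul0r.
  have nz : (forall y, f (vcons x y) = 0 /\ p ord0 (vcons x y) = 0) ->
    ~~ ((\int[mu n]_y (f (vcons x y) * e y) != 0) || (\int[mu n]_y (p ord0 (vcons x y) * e y) != 0)).
    by move=> H; rewrite negb_or !negbK; apply/andP; split; apply/eqP; apply: z0 => y; case: (H y).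
  move=> H; split.
    rewrite leNgt; apply/negP => xM; move: H; apply/negP/nz => y.
    have [_ _ _ /(_ x) s] := L y; split; apply/eqP; apply: contraTT xM => ne;
      by rewrite -leNgt; case: s => //; rewrite ne ?orbT.
  move=> b0; rewrite leNgt; apply/negP => xM; move: H; apply/negP/nz => y.
  have [_ _ _ /(_ x) s] := L y; split; apply/eqP; apply: contraTT xM => ne;
      by rewrite -leNgt; case: s => [|_ /(_ b0)//]; rewrite ne ?orbT.
Qed.

End C1.

End box_functions.

(** * Product states and Bessel's inequality in several variables *)

Section tensor.
Context (R : realType) (a : R).
Hypothesis a0 : 0 < a.
Notation lam := (@lebesgue_measure R).
Notation mu := (lebesgue_rV R).

(* [tens b None] is the ground state; [tens b (Some i)] has its first excitation
   in the direction [i], and vanishes when [b i], as the half line has no state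
   of excitation 1. *)
Definition tens n (b : 'I_n -> bool) (o : option 'I_n) (x : 'rV[R]_n) : R :=
  \prod_i (if o == Some i then hermite1 a (b i) (x ord0 i)
           else hermite0 a (b i) (x ord0 i)).

Lemma tens_None n (b : 'I_n.+1 -> bool) x (y : 'rV[R]_n) :
  tens b None (vcons x y) =
  hermite0 a (b ord0) x * tens (fun j => b (lift ord0 j)) None y.
Proof.
rewrite /tens big_ord_recl vcons0; congr (_ * _).
by apply: eq_bigr => j _; rewrite vcons_lift.
Qed.

Lemma tens_ord0 n (b : 'I_n.+1 -> bool) x (y : 'rV[R]_n) :
  tens b (Some ord0) (vcons x y) =
  hermite1 a (b ord0) x * tens (fun j => b (lift ord0 j)) None y.
Proof.
rewrite /tens big_ord_recl vcons0 eqxx; congr (_ * _).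
by apply: eq_bigr => j _; rewrite vcons_lift.
Qed.

Lemma tens_lift n (b : 'I_n.+1 -> bool) i x (y : 'rV[R]_n) :
  tens b (Some (lift ord0 i)) (vcons x y) =
  hermite0 a (b ord0) x * tens (fun j => b (lift ord0 j)) (Some i) y.
Proof.
rewrite /tens big_ord_recl vcons0; congr (_ * _); apply: eq_bigr => j _.
have E : (Some (lift ord0 i) == Some (lift ord0 j)) = (Some i == Some j).
  exact: (inj_eq lift_inj).
by rewrite vcons_lift E.
Qed.

Lemma hermite_bounded b : exists C, forall x,
  `|hermite0 a b x| <= C /\ `|hermite1 a b x| <= C.
Proof.
have a2 : 0 < 2 * a by rewrite mulr_gt0.
(* The ground state with parameter [a] is the weight with parameter [2 a], so bounds on weights
   apply to it. *)
have rE x : gauss_root a x = gauss_weight (2 * a) x by [].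
have bd (g : R -> R) : polynomial_growth g -> exists C, forall x, `|gauss_root a x * g x| <= C.
  move=> pg; have [C gC] := gauss_weight_pg_bound a2 pg.
  exists `|C| => x; rewrite rE (le_trans (gC x))// (le_trans (ler_norm _))//.
  rewrite normrM -[leRHS]mulr1 ler_wpM2l// ger0_norm ?normal_fun_ge0//.
  rewrite /normal_fun -[leRHS](@expR0 R) ler_expR mulNr oppr_le0.
  by rewrite divr_ge0 ?sqr_ge0// mulrn_wge0// sqr_ge0.
have pp := @pg_pos_part R.
have [C HC] : exists C, forall x, `|hermite0 a b x| <= C.
  have [|C HC] := bd (fun x => (if b then pos_part x else 1) / hermite0_norm a b).
    by case: (b); pg_auto.
  by exists C => x; rewrite /hermite0 -mulrA.
have [D HD] : exists C, forall x, `|hermite1 a b x| <= C.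
  rewrite /hermite1; case: b => [|] in HC *; first by exists 0 => x; rewrite normr0.
  have [|D HD] := bd (fun x => x / hermite1_norm a); first by pg_auto.
  by exists D => x; rewrite -mulrA.
exists (Num.max C D) => x.
split; first by rewrite (le_trans (HC x))// le_max lexx.
by rewrite (le_trans (HD x))// le_max lexx orbT.
Qed.

Lemma measurable_tens n (b : 'I_n -> bool) o : measurable_fun [set: 'rV[R]_n] (tens b o).
Proof.
rewrite /tens; apply: measurable_prod => i _.
have mc : measurable_fun [set: 'rV[R]_n] (fun x => x ord0 i : measurableTypeR R) := measurable_coord i.
case: (o == Some i).
  by apply: (measurableT_comp _ mc); apply: continuous_measurable_fun; exact: continuous_hermite1.
by apply: (measurableT_comp _ mc); apply: continuous_measurable_fun; exact: continuous_hermite0.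
Qed.

Lemma tens_bounded n (b : 'I_n -> bool) o : exists C, forall x, `|tens b o x| <= C.
Proof.
have /choice[C HC] : forall i, exists C, forall x, `|hermite0 a (b i) x| <= C /\ `|hermite1 a (b i) x| <= C.
  by move=> i; exact: hermite_bounded.
exists (\prod_i C i) => x; rewrite /tens normr_prod; apply: ler_prod => i _.
by rewrite normr_ge0/=; case: ifP => _; have [] := HC i (x ord0 i).
Qed.

Lemma bbox_tens n (b : 'I_n -> bool) o (F : 'rV[R]_n -> R) : bbox F ->
  bbox (fun x => F x * tens b o x).
Proof.
move=> BF; have [C HC] := tens_bounded b o.
exact: bbox_mul BF (measurable_tens b o) HC.
Qed.

Definition coef n (b : 'I_n -> bool) (F : 'rV[R]_n -> R) o : R :=
  \int[mu n]_x (F x * tens b o x).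

(** A single excitation lies either in the first coordinate, with the others in their ground state,
    or in the others, with the first in its ground state. Both cases are one-dimensional
    coefficients of a coefficient. *)
Lemma coef_vcons n (b : 'I_n.+1 -> bool) (F : 'rV[R]_n.+1 -> R) (b' := fun j => b (lift ord0 j)) :
  bbox F ->
  [/\ coef b F None = \int[lam]_x (coef b' (fun y => F (vcons x y)) None * hermite0 a (b ord0) x),
     coef b F (Some ord0) = \int[lam]_x (coef b' (fun y => F (vcons x y)) None * hermite1 a (b ord0) x) &
     forall j, coef b F (Some (lift ord0 j)) =
       \int[lam]_x (coef b' (fun y => F (vcons x y)) (Some j) * hermite0 a (b ord0) x)].
Proof.
move=> BF.
have key o o' (h : R -> R) : (forall x y, tens b o (vcons x y) = h x * tens b' o' y) ->
    coef b F o = \int[lam]_x (coef b' (fun y => F (vcons x y)) o' * h x).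
  move=> E; rewrite /coef bbox_Rint_vcons; last exact: bbox_tens.
  apply: eq_Rint => x; rewrite mulrC -RintZ; last exact/bbox_int/bbox_tens/bbox_vcons.
  by apply: eq_Rint => y; rewrite E; ring.
split; first by apply: key => x y; exact: tens_None.
  by apply: key => x y; exact: tens_ord0.
by move=> j; apply: key => x y; exact: tens_lift.
Qed.

Let tail n (z : 'rV[R]_n.+1) : 'rV[R]_n := \row_j z ord0 (lift ord0 j).

Let tail_vcons n x (y : 'rV[R]_n) : tail (vcons x y) = y.
Proof. by apply/rowP => j; rewrite mxE vcons_lift. Qed.

Let measurable_tail n : measurable_fun [set: 'rV[R]_n.+1] (@tail n).
Proof.
apply/measurable_fun_coordP => i.
by under eq_fun do rewrite mxE; exact: measurable_coord.
Qed.

Lemma Rintegrable_coef_vcons n (b : 'I_n -> bool) (F : 'rV[R]_n.+1 -> R) o (h : R -> R) D :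
  bbox F -> measurable_fun [set: measurableTypeR R] h -> (forall x, `|h x| <= D) ->
  Rintegrable lam (fun x => coef b (fun y => F (vcons x y)) o * h x).
Proof.
move=> BF mh hD; have [C HC] := tens_bounded b o.
have BG : bbox (fun z => F z * (tens b o (tail z) * h (z ord0 ord0))).
  apply: (bbox_mul (C := C * D)) => //.
    apply: measurable_funM; first exact: (measurableT_comp (measurable_tens b o) (@measurable_tail n)).
    exact: (measurableT_comp mh (measurable_coord ord0)).
  by move=> z; rewrite normrM ler_pM.
have := bbox_Rint BG; congr Rintegrable; apply/funext => x.
rewrite /coef mulrC -RintZ; last exact/bbox_int/bbox_tens/bbox_vcons.
by apply: eq_Rint => y; rewrite tail_vcons vcons0; ring.
Qed.

Lemma coef_vcons_bounded n (b : 'I_n -> bool) (F : 'rV[R]_n.+1 -> R) o :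
  bbox F -> exists C, forall x, `|coef b (fun y => F (vcons x y)) o| <= C.
Proof.
move=> BF; have [C HC] := tens_bounded b o; have [M [mF FM Fs]] := BF.
have C0 : 0 <= C by rewrite (le_trans _ (HC 0)).
have M0 : 0 <= M by rewrite (le_trans _ (FM 0)).
have BI : bbox (\1_(@box R n M) : 'rV[R]_n -> R).
  exists (1 + M); split.
  - by apply: measurable_indic; exact: measurable_box.
  - move=> y; rewrite indicE; case: (_ \in _) => /=; rewrite ?normr1 ?normr0.
      by rewrite lerDl.
    by rewrite addr_ge0.
  - move=> y; rewrite indicE; case: (boolP (y \in _)) => [|_ /=]; last by rewrite eqxx.
    by rewrite inE => yM _ i; rewrite (le_trans (yM i))// lerDr.
have iI := bbox_int (bboxZ (M * C) BI).
exists (\int[mu n]_y (M * C * \1_(@box R n M) y)) => x.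
have BT : bbox (fun y => F (vcons x y) * tens b o y) by exact/bbox_tens/bbox_vcons.
rewrite (le_trans (le_normr_Rintegral _ (bbox_int BT)))//.
apply: le_Rint => //; first exact: (integrable_norm (bbox_int BT)).
move=> y; have [->|Fx] := eqVneq (F (vcons x y)) 0.
  by rewrite mul0r normr0 !mulr_ge0.
rewrite normrM indicE mem_set ?mulr1 ?ler_pM//.
by move=> i; have := Fs _ Fx (lift ord0 i); rewrite vcons_lift.
Qed.

Let measurable_coef_vcons n (b : 'I_n -> bool) (F : 'rV[R]_n.+1 -> R) o : bbox F ->
  measurable_fun [set: measurableTypeR R] (fun x => coef b (fun y => F (vcons x y)) o).
Proof.
move=> BF; have m1 : measurable_fun [set: measurableTypeR R] (fun=> 1 : R).
  exact: measurable_cst.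
have := Rintegrable_measurable (Rintegrable_coef_vcons b o (D := 1) BF m1 (fun=> _)).
rewrite normr1 => /(_ (fun=> lexx _)); congr measurable_fun.
by apply/funext => x; rewrite mulr1.
Qed.

(** Bessel's inequality is applied on each slice in the remaining variables, then to each resulting
    coefficient in the first one. Both one-dimensional components are kept for the ground
    coefficient, only the ground component for the excited ones. *)
Lemma bessel_box n (b : 'I_n -> bool) (F : 'rV[R]_n -> R) : bbox F ->
  coef b F None ^+ 2 + \sum_j coef b F (Some j) ^+ 2 <= \int[mu n]_x (F x * F x).
Proof.
elim: n => [|n IH] in b F *.
  by move=> _; rewrite big_ord0 addr0 /coef !Rint_rV0 /tens big_ord0 mulr1.
move=> BF; have BFx x : bbox (fun y => F (vcons x y)) by exact: bbox_vcons.
pose b' := fun j => b (lift ord0 j).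
pose A o x := coef b' (fun y => F (vcons x y)) o.
have [CN C0 CS] := coef_vcons b BF; rewrite CN big_ord_recl C0.
under eq_bigr do rewrite CS.
rewrite bbox_Rint_vcons; last exact: bboxM.
have iA0 o : Rintegrable lam (fun x => A o x * hermite0 a (b ord0) x).
  have [D HD] := hermite_bounded (b ord0).
  apply: (@Rintegrable_coef_vcons n b' F o _ D) => // [|x]; last by have [] := HD x.
  by apply: continuous_measurable_fun; exact: continuous_hermite0.
have iA1 o : Rintegrable lam (fun x => A o x * hermite1 a (b ord0) x).
  have [D HD] := hermite_bounded (b ord0).
  apply: (@Rintegrable_coef_vcons n b' F o _ D) => // [|x]; last by have [] := HD x.
  by apply: continuous_measurable_fun; exact: continuous_hermite1.
have iA2 o : Rintegrable lam (fun x => A o x ^+ 2).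
  have [D HD] := coef_vcons_bounded b' o BF.
  apply: (@Rintegrable_coef_vcons n b' F o _ D) => //.
  exact: measurable_coef_vcons.
have B1 o : (\int[lam]_x (A o x * hermite0 a (b ord0) x)) ^+ 2 +
    (\int[lam]_x (A o x * hermite1 a (b ord0) x)) ^+ 2 <= \int[lam]_x (A o x ^+ 2).
  exact: bessel_line.
apply: (@le_trans _ _ (\int[lam]_x (A None x ^+ 2 + \sum_j A (Some j) x ^+ 2))); last first.
  apply: le_Rint => [||x].
  - by apply: RintegrableD => //; exact: Rintegrable_sum.
  - by apply: (bbox_Rint (F := fun z => F z * F z)); exact: bboxM.
  - exact: IH.
rewrite RintD//; last exact: Rintegrable_sum.
rewrite Rint_sum// addrA; apply: lerD; first exact: B1.
by apply: ler_sum => j _; rewrite (le_trans _ (B1 _))// lerDl sqr_ge0.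
Qed.

End tensor.

(** * The gap in several variables *)

Section box_gap.
Context (R : realType) (a : R).
Hypothesis a0 : 0 < a.
Notation lam := (@lebesgue_measure R).
Notation mu := (lebesgue_rV R).

Definition annih_at n (b : 'I_n -> bool) (f : 'rV[R]_n -> R)
    (p : 'I_n -> 'rV[R]_n -> R) (i : 'I_n) (x : 'rV[R]_n) : R :=
  annih a (b i) (fun t => f (upd x i t)) (fun t => p i (upd x i t)) (x ord0 i).

Lemma annih_at_lift n (b : 'I_n.+1 -> bool) f p j x (y : 'rV[R]_n) :
  annih_at b f p (lift ord0 j) (vcons x y) =
  annih_at (fun j => b (lift ord0 j)) (fun y => f (vcons x y))
    (fun j y => p (lift ord0 j) (vcons x y)) j y.
Proof. by rewrite /annih_at /annih !upd_vcons_lift vcons_lift. Qed.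

Lemma annih_at0 n (b : 'I_n.+1 -> bool) f p x (y : 'rV[R]_n) :
  annih_at b f p ord0 (vcons x y) =
  annih a (b ord0) (fun t => f (vcons t y)) (fun t => p ord0 (vcons t y)) x.
Proof. by rewrite /annih_at /annih !upd_vcons0 vcons0. Qed.

Section C1.
Context n (b : 'I_n -> bool) (M : R) (f : 'rV[R]_n -> R) (p : 'I_n -> 'rV[R]_n -> R).
Hypothesis C1f : C1_box b M f p.

Lemma C1_box_bbox : bbox f /\ forall i, bbox (p i).
Proof.
by split=> [|i]; exists M; [exact: C1_box_fun C1f|exact: C1_box_partial C1f _].
Qed.

Lemma bbox_annih_at i : bbox (annih_at b f p i).
Proof.
have [Bf Bp] := C1_box_bbox; have M0 := C1_box_gt0 C1f.
have E : annih_at b f p i = fun x => (Num.sqrt (2 * a))^-1 * (a * p i x + x ord0 i * f x -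
    (if b i then a * ((Num.max (x ord0 i) M^-1)^-1 * f x) else 0 * f x)).
  apply/funext => x; rewrite /annih_at /annih upd_id mulrC; congr (_ * (_ - _)).
  case: ifP => [bi|_]; last by rewrite mul0r.
  rewrite -mulrA; congr (_ * _).
  have [xM|xM] := ltP (x ord0 i) M^-1; last by rewrite mulrC.
  by have [-> _] := C1_box_support C1f bi xM; rewrite mulr0 mul0r.
rewrite E; apply: bboxZ; apply: bboxB.
  apply: bboxD; first exact: bboxZ.
  by apply: (@bbox_coord R n i (fun t => t) f _ Bf) => x; exact: cvg_id.
case: (b i); last exact: bboxZ.
apply: bboxZ; apply: (@bbox_coord R n i (fun t => (Num.max t M^-1)^-1) f _ Bf).
exact: continuous_inv_max.
Qed.

End C1.

(** The induction hypothesis on slices ([S1]) treats the operators of the remaining coordinates and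
    leaves the norms of the coefficients [A o]. Bessel's inequality ([S2]) bounds the operator of
    the first coordinate below by its action on these coefficients. The ground one receives the full
    gap ([S3]); an excited one has already used one excitation and only needs the gap 1 ([S4]). The
    norms of the [A o] cancel in the sum. *)
Lemma box_gap n (b : 'I_n -> bool) (M : R) (f : 'rV[R]_n -> R) p : C1_box b M f p ->
  2 * \int[mu n]_x (f x * f x) - 2 * coef a b f None ^+ 2 -
    \sum_j coef a b f (Some j) ^+ 2 <=
  \sum_i \int[mu n]_x (annih_at b f p i x * annih_at b f p i x).
Proof.
elim: n => [|n IH] in b f p *.
  move=> _; rewrite !big_ord0 subr0 /coef !Rint_rV0 /tens big_ord0 mulr1.
  by rewrite expr2 subrr.
move=> C1f; have [Bf Bp] := C1_box_bbox C1f.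
pose b' := fun j : 'I_n => b (lift ord0 j).
have Cx x := C1_box_slice C1f x.
pose A o x := coef a b' (fun y => f (vcons x y)) o.
pose A1 o x := coef a b' (fun y => p ord0 (vcons x y)) o.
have CA o : C1_line (b ord0) M (A o) (A1 o).
  have [C HC] := tens_bounded a0 b' o.
  exact: (C1_box_average C1f (measurable_tens a b' o) HC).
have cA o : continuous (A o).
  by have [_ dA _ _] := CA o; exact: continuous_derivable dA.
have [CN C0 CS] := coef_vcons a0 b Bf.
have iA o (h : R -> R) : continuous h -> Rintegrable lam (fun x => A o x * h x).
  by move=> ch; exact: (Rintegrable_C1 (CA o) ch).
have iA2 o : Rintegrable lam (fun x => A o x ^+ 2) by exact: (iA o _ (cA o)).
have Bat i : bbox (fun x => annih_at b f p i x * annih_at b f p i x).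
  by apply: bboxM; exact: (bbox_annih_at C1f).
have Bff : bbox (fun x => f x * f x) by exact: bboxM.
have S1 : 2 * \int[mu n.+1]_x (f x * f x) - 2 * \int[lam]_x (A None x ^+ 2) -
    \sum_j \int[lam]_x (A (Some j) x ^+ 2) <=
    \sum_i \int[mu n.+1]_x (annih_at b f p (lift ord0 i) x * annih_at b f p (lift ord0 i) x).
  rewrite bbox_Rint_vcons// -Rint_sum//.
  under [leRHS]eq_bigr do rewrite bbox_Rint_vcons//.
  rewrite -Rint_sum; last by move=> i; exact: (bbox_Rint (Bat (lift ord0 i))).
  have i1 := bbox_Rint Bff.
  have i2 : Rintegrable lam (fun x => \sum_j A (Some j) x ^+ 2) by exact: Rintegrable_sum.
  rewrite -RintZ// -RintZ// -RintB; try by rint_auto.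
  rewrite -RintB; try by rint_auto.
  apply: le_Rint; try by rint_auto.
    by apply: Rintegrable_sum => i; exact: (bbox_Rint (Bat (lift ord0 i))).
  move=> x; rewrite (le_trans (IH _ _ _ (Cx x)))//.
  apply: ler_sum => i _; apply: le_Rint.
  - by apply: bbox_int; apply: bboxM; exact: (bbox_annih_at (Cx x) _).
  - by apply: bbox_int; exact: (bbox_vcons x (Bat (lift ord0 i))).
  - by move=> y; rewrite !annih_at_lift.
have iB o : Rintegrable lam (fun x => annih a (b ord0) (A o) (A1 o) x * annih a (b ord0) (A o) (A1 o) x).
  exact: (Rintegrable_annih a (CA o) (@continuous_annih R a _ _ _ _ (CA o))).
have S2 : \int[lam]_x (annih a (b ord0) (A None) (A1 None) x * annih a (b ord0) (A None) (A1 None) x) +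
    \sum_j \int[lam]_x (annih a (b ord0) (A (Some j)) (A1 (Some j)) x * annih a (b ord0) (A (Some j)) (A1 (Some j)) x) <=
    \int[mu n.+1]_x (annih_at b f p ord0 x * annih_at b f p ord0 x).
  rewrite bbox_Rint_vcons// -Rint_sum// -RintD//; last exact: Rintegrable_sum.
  apply: le_Rint.
  - by apply: RintegrableD => //; exact: Rintegrable_sum.
  - exact: (bbox_Rint (Bat ord0)).
  - move=> x; have BB : bbox (fun y => annih_at b f p ord0 (vcons x y)).
      by apply: bbox_vcons; exact: (bbox_annih_at C1f).
    apply: le_trans (bessel_box a0 b' BB).
    (* The operator acts on the first variable alone, so it commutes with taking coefficients in the
       others. *)
    have E o : coef a b' (fun y => annih_at b f p ord0 (vcons x y)) o =
        annih a (b ord0) (A o) (A1 o) x.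
      rewrite /coef /annih.
      pose c := (x - (if b ord0 then a / x else 0)) / Num.sqrt (2 * a).
      rewrite (@eq_Rint _ _ _ (mu n) _ (fun y =>
          a / Num.sqrt (2 * a) * (p ord0 (vcons x y) * tens a b' o y)
          + c * (f (vcons x y) * tens a b' o y))); last first.
        by move=> y; rewrite annih_at0 /annih /c; case: ifP => _; ring.
      have i1 : Rintegrable (mu n) (fun y => p ord0 (vcons x y) * tens a b' o y).
        exact/bbox_int/bbox_tens/bbox_vcons.
      have i2 : Rintegrable (mu n) (fun y => f (vcons x y) * tens a b' o y).
        exact/bbox_int/bbox_tens/bbox_vcons.
      rewrite RintD; try exact: RintegrableZ.
      have EA1 : \int[mu n]_y (p ord0 (vcons x y) * tens a b' o y) = A1 o x by [].
      have EA : \int[mu n]_y (f (vcons x y) * tens a b' o y) = A o x by [].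
      rewrite !RintZ// EA1 EA /c.
      by case: ifP => _; ring.
    rewrite E; apply: lerD; first by rewrite expr2.
    by apply: ler_sum => j _; rewrite E expr2.
have S3 : 2 * \int[lam]_x (A None x ^+ 2) - 2 * coef a b f None ^+ 2 -
    coef a b f (Some ord0) ^+ 2 <=
    \int[lam]_x (annih a (b ord0) (A None) (A1 None) x * annih a (b ord0) (A None) (A1 None) x).
  by rewrite CN C0; exact: (annih_gap a0 (CA None)).
have S4 : \sum_j \int[lam]_x (A (Some j) x ^+ 2) - \sum_j coef a b f (Some (lift ord0 j)) ^+ 2 <=
    \sum_j \int[lam]_x (annih a (b ord0) (A (Some j)) (A1 (Some j)) x * annih a (b ord0) (A (Some j)) (A1 (Some j)) x).
  rewrite -sumrB; apply: ler_sum => j _; rewrite CS.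
  exact: (annih_gap1 a0 (CA (Some j))).
rewrite !big_ord_recl; lra.
Qed.

(** Fubini's theorem reduces to one variable: a coordinate other than the first is reached through
    slices and induction, the first by integrating it innermost. *)
Lemma box_energy n (b : 'I_n -> bool) (M : R) (f : 'rV[R]_n -> R) p i : C1_box b M f p ->
  \int[mu n]_x (annih_at b f p i x * annih_at b f p i x) =
  (a * \int[mu n]_x (p i x * p i x) + (\int[mu n]_x (f x * (x ord0 i ^+ 2 * f x))) / a) / 2
  - (1 / 2 + (b i)%:R) * \int[mu n]_x (f x * f x).
Proof.
elim: n => [|n IH] in b f p i *; first by case: i.
move=> C1f; have [Bf Bp] := C1_box_bbox C1f.
have Bat := bbox_annih_at C1f i.
have Bx : bbox (fun x => x ord0 i ^+ 2 * f x).
  by apply: (@bbox_coord R n.+1 i (fun t => t ^+ 2) f _ Bf); exact: exprn_continuous.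
have B1 := bboxM Bat Bat; have B2 := bboxM (Bp i) (Bp i); have B3 := bboxM Bf Bx.
have B4 := bboxM Bf Bf.
pose c := 1 / 2 + (b i)%:R : R.
have BG : bbox (fun x => annih_at b f p i x * annih_at b f p i x -
    (a / 2) * (p i x * p i x) - (2 * a)^-1 * (f x * (x ord0 i ^+ 2 * f x)) + c * (f x * f x)).
  by apply: bboxD; [apply: bboxB; [apply: bboxB => //; exact: bboxZ|exact: bboxZ]|exact: bboxZ].
have i1 := bbox_int B1; have i2 := bbox_int B2; have i3 := bbox_int B3; have i4 := bbox_int B4.
(* All terms are gathered into one integrand of integral 0, so that Fubini's theorem is used once
   and the inner integral is 0 pointwise. *)
suff : \int[mu n.+1]_x (annih_at b f p i x * annih_at b f p i x -
    (a / 2) * (p i x * p i x) - (2 * a)^-1 * (f x * (x ord0 i ^+ 2 * f x)) + c * (f x * f x)) = 0.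
  rewrite !(RintB, RintD, RintZ)//; try by rint_auto.
  move=> H; apply/eqP; rewrite -subr_eq0; apply/eqP; rewrite -[RHS]H /c.
  by field; exact: lt0r_neq0.
case: (unliftP ord0 i) => [j ij|i0].
  rewrite bbox_Rint_vcons// -[RHS](Rint_zero lam); apply: eq_Rint => x.
  have Cx := C1_box_slice C1f x.
  have E := IH _ _ _ j Cx.
  have [Bfx Bpx] := C1_box_bbox Cx.
  have Batx := bbox_annih_at Cx j.
  have Bxx : bbox (fun y => y ord0 j ^+ 2 * f (vcons x y)).
    by apply: (@bbox_coord R n j (fun t => t ^+ 2) _ _ Bfx); exact: exprn_continuous.
  have j1 := bbox_int (bboxM Batx Batx); have j2 := bbox_int (bboxM (Bpx j) (Bpx j)).
  have j3 := bbox_int (bboxM Bfx Bxx); have j4 := bbox_int (bboxM Bfx Bfx).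
  rewrite (@eq_Rint _ _ _ (mu n) _ (fun y =>
    annih_at (fun j => b (lift ord0 j)) (fun y => f (vcons x y))
      (fun j y => p (lift ord0 j) (vcons x y)) j y *
    annih_at (fun j => b (lift ord0 j)) (fun y => f (vcons x y))
      (fun j y => p (lift ord0 j) (vcons x y)) j y -
    (a / 2) * (p (lift ord0 j) (vcons x y) * p (lift ord0 j) (vcons x y)) -
    (2 * a)^-1 * (f (vcons x y) * (y ord0 j ^+ 2 * f (vcons x y)))
    + c * (f (vcons x y) * f (vcons x y)))); last first.
    by move=> y; rewrite ij vcons_lift annih_at_lift.
  rewrite !(RintB, RintD, RintZ)//; try by rint_auto.
  rewrite E /c ij; field; exact: lt0r_neq0.
rewrite bbox_Rint_vcons_swap// -[RHS](Rint_zero (mu n)); apply: eq_Rint => y.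
have L := C1_box_line C1f y; have [M0 dL cL sL] := L.
have cf := continuous_derivable dL.
have E := annih_energy a0 L.
have j1 := Rintegrable_annih a L (@continuous_annih R a _ _ _ _ L).
have j2 := Rintegrable_C1' L cL.
have j4 := Rintegrable_C1 L cf.
have j3 : Rintegrable lam (fun x => f (vcons x y) * (x ^+ 2 * f (vcons x y))).
  apply: (Rintegrable_C1 L (h := fun x => x ^+ 2 * f (vcons x y))).
  by cont_auto.
rewrite (@eq_Rint _ _ _ lam _ (fun x =>
    annih a (b ord0) (fun t => f (vcons t y)) (fun t => p ord0 (vcons t y)) x *
    annih a (b ord0) (fun t => f (vcons t y)) (fun t => p ord0 (vcons t y)) x -
    (a / 2) * (p ord0 (vcons x y) * p ord0 (vcons x y)) -
    (2 * a)^-1 * (f (vcons x y) * (x ^+ 2 * f (vcons x y)))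
    + c * (f (vcons x y) * f (vcons x y)))); last first.
  by move=> x; rewrite i0 vcons0 annih_at0.
rewrite !(RintB, RintD, RintZ)//; try by rint_auto.
rewrite E /c i0; field; exact: lt0r_neq0.
Qed.

End box_gap.

(** * Test functions *)

Section test_functions.
Context (R : realType).
Notation mu := (lebesgue_rV R).

(** The topology comes from the sup norm and the sigma-algebra from the coordinates; countably many
    cubes with rational centres link the two. *)
Lemma open_measurable_rV n (A : set 'rV[R]_n) : open A -> measurable A.
Proof.
move=> oA.
pose B (p : 'rV[rat]_n * nat) : set 'rV[R]_n :=
  [set x | forall i, `|x ord0 i - ratr (p.1 ord0 i)| < p.2.+1%:R^-1].
have mB p : measurable (B p).
  rewrite (_ : B p = \bigcap_(i in [set: 'I_n]) ((fun x : 'rV[R]_n => x ord0 i) @^-1`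
      [set t | `|t - ratr (p.1 ord0 i)| < p.2.+1%:R^-1])).
    apply: fin_bigcap_measurable; first exact: finite_finset.
    move=> i _; rewrite -[X in measurable X]setTI; apply: measurable_coord => //.
    apply: open_measurable.
    rewrite (_ : mkset _ = ball (ratr (p.1 ord0 i) : R) p.2.+1%:R^-1).
      exact: ball_open.
    by apply/seteqP; split=> t; rewrite /ball/= distrC.
  by apply/seteqP; split=> x h i; [move=> _; exact: h|exact: h i Logic.I].
have -> : A = \bigcup_p (if `[< B p `<=` A >] then B p else set0).
  apply/seteqP; split=> [x Ax|x [p _]]; last by case: asboolP => // BA /BA.
  have /nbhs_ballP[e /= e0 eA] : nbhs x A by exact: open_nbhs_nbhs.
  pose m := Num.truncn (2 / e); have me : m.+1%:R^-1 < e / 2.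
    rewrite -[e / 2]invrK ltf_pV2 ?posrE ?invr_gt0 ?divr_gt0//.
    by rewrite invf_div truncnS_gt.
  have /choice[q Hq] : forall i, exists q : rat, `|x ord0 i - ratr q| < m.+1%:R^-1.
    move=> i; have [|q] := @rat_in_itvoo R (x ord0 i - m.+1%:R^-1) (x ord0 i + m.+1%:R^-1).
      by rewrite ltrD2l gtrN// invr_gt0.
    by rewrite in_itv/= => h; exists q; rewrite distrC ltr_distl.
  exists (\row_i q i, m) => //; rewrite ifT; first by move=> i /=; rewrite mxE.
  apply/asboolP => y By; apply: eA; split=> // i j; rewrite ord1.
  have := By j; rewrite /= mxE => yq; have := Hq j => xq.
  rewrite /ball/= (_ : x ord0 j - y ord0 j = (x ord0 j - ratr (q j)) - (y ord0 j - ratr (q j))); last by ring.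
  rewrite (le_lt_trans (ler_normB _ _))// [ltRHS]splitr.
  by apply: ltrD; [exact: lt_trans xq me|exact: lt_trans yq me].
apply: countable_bigcupT_measurable => // p.
by case: asboolP.
Qed.

Lemma continuous_measurable_rV n (f : 'rV[R]_n -> R) : continuous f ->
  measurable_fun [set: 'rV[R]_n] f.
Proof.
move=> cf; apply: (measurability _ (RGenOpens.measurableE R)).
move=> _ [_ [a [b ->] <-]]; rewrite setTI; apply: open_measurable_rV.
by move/continuousP : cf; apply; exact: interval_open.
Qed.

Let updE n (y : 'rV[R]_n) i t : upd y i t = y + (t - y ord0 i) *: delta_mx ord0 i.
Proof.
apply/rowP => j; rewrite !mxE eqxx/=; have [->|_] := eqVneq j i.
  by rewrite mulr1 addrCA subrr addr0.
by rewrite mulr0 addr0.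
Qed.

Let updD n (y : 'rV[R]_n) i t h : upd y i (h + t) = h *: delta_mx ord0 i + upd y i t.
Proof.
by rewrite !updE [RHS]addrCA -scalerDl addrA.
Qed.

Lemma continuous_upd n (y : 'rV[R]_n) i : continuous (upd y i).
Proof.
rewrite (_ : upd y i = fun t => y + (t - y ord0 i) *: delta_mx ord0 i); last first.
  by apply/funext => t; exact: updE.
move=> t; apply: cvgD; first exact: cvg_cst.
by apply: cvgZ (cvg_cst _); apply: cvgB; [exact: cvg_id|exact: cvg_cst].
Qed.

Lemma is_derive_upd n (f : 'rV[R]_n -> R) y i (t : R) :
  differentiable f (upd y i t) ->
  is_derive t 1 (fun s => f (upd y i s)) (partial i f (upd y i t)).
Proof.
move=> df.
have E : (fun h : R => h^-1 *: (((fun s => f (upd y i s)) \o shift t) (h *: 1) - f (upd y i t))) =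
   (fun h : R => h^-1 *: ((f \o shift (upd y i t)) (h *: delta_mx ord0 i) - f (upd y i t))).
  by apply/funext => h /=; rewrite /GRing.scale/= mulr1 updD.
apply: DeriveDef.
  by rewrite /derivable E; exact: diff_derivable.
by rewrite /derive E.
Qed.

Lemma compact_norm_bound n (S : set 'rV[R]_n) (g : 'rV[R]_n -> R) :
  compact S -> {in S, continuous g} -> exists2 C, 0 <= C & forall x, S x -> `|g x| <= C.
Proof.
move=> cS cg; have cgS : compact (g @` S).
  by apply: continuous_compact => //; exact: continuous_in_subspaceT.
have [C [_ HC]] := compact_bounded cgS.
exists (`|C| + 1) => [|x Sx]; first by rewrite addr_ge0.
by apply: (HC (`|C| + 1)); [rewrite ltr_pwDr// ler_norm|exists x].
Qed.

(** Compactness of the support inside the open orthant gives all the bounds at once; [M] is a sum of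
    them, so it exceeds each. *)
Lemma test_function_C1 n k (f : 'rV[R]_n -> R) : test_function (orthant k) f ->
  exists M, C1_box (fun i : 'I_n => (n - k <= i)%N) M f (fun i => partial i f).
Proof.
move=> [sf]; set S := closure _ => cS suppO.
have df x : differentiable f x by exact: (sf [::]).
have dpf i x : differentiable (partial i f) x by exact: (sf [:: i]).
have cf : continuous f by move=> x; exact: differentiable_continuous.
have cpf i : continuous (partial i f) by move=> x; exact: differentiable_continuous.
have fS x : ~ S x -> f x = 0.
  by move=> Sx; apply/eqP; apply: contra_notT Sx => fx; exact: subset_closure.
have pS i x : ~ S x -> partial i f x = 0.
  move=> Sx; have oS : open (~` S) by apply: closed_openC; exact: closed_closure.
  have nS : \forall y \near x, ~ S y by exact: open_nbhs_nbhs.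
  rewrite /partial (@near_eq_derive _ _ _ f (fun=> 0)); first exact: derive_cst.
  by apply: filterS nS => y /fS.
have [Cf Cf0 HCf] := compact_norm_bound cS (fun x _ => cf x).
have /choice[Cp HCp] : forall i, exists C, 0 <= C /\ forall x, S x -> `|partial i f x| <= C.
  by move=> i; have [C C0 HC] := compact_norm_bound cS (fun x _ => cpf i x); exists C.
have /choice[Cx HCx] : forall i : 'I_n, exists C, 0 <= C /\ forall x, S x -> `|x ord0 i| <= C.
  move=> i; have [|C C0 HC] := @compact_norm_bound _ S (fun x => x ord0 i) cS.
    by move=> x _; exact: coord_continuous.
  by exists C.
(* The distance to the faces: [1 / x_i] is continuous on the support, hence bounded there. *)
have /choice[Ci HCi] : forall i : 'I_n, exists C, 0 <= C /\
    forall x, S x -> (n - k <= i)%N -> (x ord0 i)^-1 <= C.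
  move=> i; have [ki|ki] := boolP (n - k <= i)%N; last by exists 0.
  have [|C C0 HC] := @compact_norm_bound _ S (fun x => (x ord0 i)^-1) cS.
    move=> x /set_mem/suppO/(_ i ki) x0.
    have /= := @continuousV _ _ (fun x : 'rV[R]_n => x ord0 i) x (lt0r_neq0 x0).
    by apply; exact: coord_continuous.
  by exists C; split => // x Sx _; rewrite (le_trans (ler_norm _))// HC.
pose D i := Cp i + Cx i + Ci i.
have D0 i : 0 <= D i.
  by rewrite !addr_ge0//; [case: (HCp i)|case: (HCx i)|case: (HCi i)].
pose M := 1 + Cf + \sum_i D i.
have sumD0 : 0 <= \sum_i D i by apply: sumr_ge0 => i _.
have M1 : 1 <= M by rewrite /M -addrA lerDl addr_ge0.
have M0 : 0 < M by rewrite (lt_le_trans _ M1).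
have DM i : D i <= M.
  rewrite /M (bigD1 i)//= addrCA lerDl !addr_ge0//.
  by apply: sumr_ge0 => j _.
have fM : Cf <= M by rewrite /M addrAC lerDr addr_ge0.
have pM i : Cp i <= M.
  by rewrite (le_trans _ (DM i))// /D -addrA lerDl addr_ge0//; [case: (HCx i)|case: (HCi i)].
have xM i : Cx i <= M.
  by rewrite (le_trans _ (DM i))// /D addrAC lerDr addr_ge0//; [case: (HCp i)|case: (HCi i)].
have iM i : Ci i <= M.
  by rewrite (le_trans _ (DM i))// /D lerDr addr_ge0//; [case: (HCp i)|case: (HCx i)].
have box_of (g : 'rV[R]_n -> R) C : continuous g -> (forall x, ~ S x -> g x = 0) ->
    (forall x, S x -> `|g x| <= C) -> C <= M -> bounded_box M g.
  move=> cg g0 gC CM; split; first exact: continuous_measurable_rV.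
    move=> x; have [Sx|Sx] := pselect (S x); first by rewrite (le_trans (gC x Sx)).
    by rewrite g0// normr0 ltW.
  move=> x gx i; have [Sx|/g0] := pselect (S x); last by move=> g0x; rewrite g0x eqxx in gx.
  by rewrite (le_trans _ (xM i))//; case: (HCx i) => _; apply.
exists M; split => //.
- exact: (box_of f Cf).
- by move=> i; apply: (box_of _ (Cp i)) => //; [exact: pS|case: (HCp i)].
- move=> x i ki xi.
  suff Sx : ~ S x by split; [exact: fS|move=> j; exact: pS].
  move=> Sx; have x0 : 0 < x ord0 i by exact: suppO.
  have [_ /(_ x Sx ki) h] := HCi i.
  have : M^-1 <= x ord0 i by rewrite -[x ord0 i]invrK lef_pV2 ?posrE ?invr_gt0// (le_trans h).
  by rewrite leNgt xi.
- by move=> x i t; exact: is_derive_upd.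
- move=> x i t; apply: (@continuous_comp _ _ _ (upd x i) (partial i f)).
    exact: continuous_upd.
  exact: cpf.
Qed.

End test_functions.

(** * Square-integrable functions and passage to the limit *)

Section square_integrable.
Context d (T : measurableType d) (R : realType) (mu : {measure set T -> \bar R}).
Implicit Types f g h : T -> R.

Definition L2 f := measurable_fun [set: T] f /\ Rintegrable mu (fun x => f x * f x).

Definition ip f g : R := \int[mu]_x (f x * g x).

Lemma L2_int f g : L2 f -> L2 g -> Rintegrable mu (fun x => f x * g x).
Proof.
move=> [mf f2] [mg g2].
apply: (@le_Rintegrable _ _ _ mu _ (fun x => f x * f x + g x * g x)).
- exact: measurable_funM.
- exact: RintegrableD.
- move=> x; rewrite ler_norml; apply/andP.
  by have := sqr_ge0 (f x + g x); have := sqr_ge0 (f x - g x); split; nra.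
Qed.

Lemma L2D f g : L2 f -> L2 g -> L2 (fun x => f x + g x).
Proof.
move=> Lf Lg; split; first exact: measurable_funD Lf.1 Lg.1.
rewrite (_ : (fun x => _) = fun x => f x * f x + 2 * (f x * g x) + g x * g x).
  apply: RintegrableD Lg.2; apply: RintegrableD Lf.2 _.
  by apply: RintegrableZ; exact: L2_int.
by apply/funext => x; ring.
Qed.

Lemma L2Z k f : L2 f -> L2 (fun x => k * f x).
Proof.
move=> Lf; split; first exact: measurable_funM (measurable_cst _) Lf.1.
rewrite (_ : (fun x => _) = fun x => k ^+ 2 * (f x * f x)).
  exact: RintegrableZ Lf.2.
by apply/funext => x; ring.
Qed.

Lemma L2B f g : L2 f -> L2 g -> L2 (fun x => f x - g x).
Proof.
move=> Lf Lg; rewrite (_ : (fun x => _) = fun x => f x + (-1) * g x).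
  by apply: L2D => //; exact: L2Z.
by apply/funext => x; rewrite mulN1r.
Qed.

Lemma ipC f g : ip f g = ip g f.
Proof. by apply: eq_Rint => x; rewrite mulrC. Qed.

Lemma ip_ge0 f : 0 <= ip f f.
Proof. by apply: Rint_ge0 => x; rewrite -expr2 sqr_ge0. Qed.

Lemma L2_le (h : T -> R) r : measurable_fun [set: T] h ->
  (\int[mu]_x (h x * h x)%:E <= r%:E)%E -> L2 h /\ ip h h <= r.
Proof.
move=> mh hr; have L : L2 h.
  split=> //; apply/integrableP; split.
    by apply/measurable_EFinP; exact: measurable_funM.
  rewrite (eq_integral (fun x => (h x * h x)%:E)) ?(le_lt_trans hr) ?ltry//.
  by move=> x _ /=; rewrite ger0_norm// -expr2 sqr_ge0.
by split=> //; rewrite -lee_fin (EFin_Rint L.2).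
Qed.

Lemma ipDl f g h : L2 f -> L2 g -> L2 h -> ip (fun x => f x + g x) h = ip f h + ip g h.
Proof.
move=> Lf Lg Lh; rewrite /ip -RintD; try exact: L2_int.
by apply: eq_Rint => x; rewrite mulrDl.
Qed.

Lemma ipBl f g h : L2 f -> L2 g -> L2 h -> ip (fun x => f x - g x) h = ip f h - ip g h.
Proof.
move=> Lf Lg Lh; rewrite /ip -RintB; try exact: L2_int.
by apply: eq_Rint => x; rewrite mulrBl.
Qed.

Lemma ipZl k f h : L2 f -> L2 h -> ip (fun x => k * f x) h = k * ip f h.
Proof.
move=> Lf Lh; rewrite /ip -RintZ; last exact: L2_int.
by apply: eq_Rint => x; rewrite mulrA.
Qed.

Lemma ip_sqrD f g : L2 f -> L2 g ->
  ip (fun x => f x + g x) (fun x => f x + g x) = ip f f + 2 * ip f g + ip g g.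
Proof.
move=> Lf Lg; have Lfg := L2D Lf Lg.
rewrite ipDl// ipC ipDl// [X in _ + X]ipC ipDl// (ipC g f); ring.
Qed.

Lemma cauchy_schwarz f g : L2 f -> L2 g -> ip f g ^+ 2 <= ip f f * ip g g.
Proof.
move=> Lf Lg; have f0 := ip_ge0 f; have g0 := ip_ge0 g.
have key t : 0 <= ip f f - 2 * t * ip f g + t ^+ 2 * ip g g.
  have := ip_ge0 (fun x => f x + (- t) * g x).
  have LZ := L2Z (- t) Lg.
  rewrite ip_sqrD// (ipC f (fun x => - t * g x)) !ipZl// (ipC g (fun x => - t * g x)).
  rewrite ipZl// (ipC g f).
  by move=> H; apply: le_trans H _; rewrite le_eqVlt; apply/orP; left; apply/eqP; ring.
have [g00|gn0] := eqVneq (ip g g) 0.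
  rewrite g00 mulr0; have [->|C0] := eqVneq (ip f g) 0; first by rewrite expr0n.
  (* With [ip g g = 0] the quadratic in [t] is affine, and at this [t] it would take the value
     -1. *)
  have := key ((ip f f + 1) / (2 * ip f g)); rewrite g00 mulr0 addr0.
  rewrite (_ : 2 * _ * _ = ip f f + 1); last by field.
  by rewrite opprD addrA subrr add0r oppr_ge0 ler10.
have gp : 0 < ip g g by rewrite lt_neqAle eq_sym gn0.
have := key (ip f g / ip g g).
rewrite (_ : _ + _ = ip f f - ip f g ^+ 2 / ip g g); last by field.
by rewrite subr_ge0 ler_pdivrMr.
Qed.

Section convergence.
Variables (h : T -> R) (h_ : nat -> T -> R).
Hypotheses (Lh : L2 h) (Lh_ : forall j, L2 (h_ j)).
Hypothesis hh : ip (fun x => h x - h_ j x) (fun x => h x - h_ j x) @[j --> \oo] --> (0 : R).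

Lemma ip_cvg e : L2 e -> ip (h_ j) e @[j --> \oo] --> ip h e.
Proof.
move=> Le.
have E j : ip (h_ j) e = ip h e - ip (fun x => h x - h_ j x) e by rewrite ipBl//; ring.
rewrite (funext E) -[X in _ --> X]subr0; apply: cvgB; first exact: cvg_cst.
apply: norm_cvg0.
apply: (@squeeze_cvgr _ _ _ _ (cst 0) (fun j =>
   Num.sqrt (ip (fun x => h x - h_ j x) (fun x => h x - h_ j x) * ip e e))).
- apply: nearW => j; rewrite normr_ge0/= -sqrtr_sqr ler_wsqrtr//.
  by apply: cauchy_schwarz => //; exact: L2B.
- exact: cvg_cst.
- rewrite -[X in _ --> X](@sqrtr0 R) -(mul0r (ip e e)).
  apply: continuous_cvg; first exact: sqrt_continuous.
  by apply: cvgM => //; exact: cvg_cst.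
Qed.

Lemma ip_sqr_cvg : ip (h_ j) (h_ j) @[j --> \oo] --> ip h h.
Proof.
have E j : ip (h_ j) (h_ j) = 2 * ip (h_ j) h - ip h h + ip (fun x => h x - h_ j x) (fun x => h x - h_ j x).
  have LB := L2B Lh (Lh_ j).
  have := ip_sqrD (Lh_ j) LB; rewrite (ipC (h_ j) (fun x => h x - h_ j x)) ipBl// (ipC h (h_ j)).
  by rewrite (_ : (fun x => h_ j x + (h x - h_ j x)) = h); [lra|apply/funext => x; ring].
have H : 2 * ip (h_ j) h @[j --> \oo] --> 2 * ip h h.
  by apply: cvgM; [exact: cvg_cst|exact: ip_cvg].
rewrite (funext E) [X in _ --> X](_ : _ = 2 * ip h h - ip h h + 0); last by ring.
exact: (cvgD (cvgB H (cvg_cst _)) hh).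
Qed.

End convergence.

End square_integrable.

(** * Orthogonality of the product states *)

Section product_integral.
Context (R : realType) (a : R).
Hypothesis a0 : 0 < a.
Notation lam := (@lebesgue_measure R).
Notation mu := (lebesgue_rV R).

(** The states do not have bounded support, so integrability of the product comes from Tonelli's
    theorem on absolute values, along the induction. *)
Lemma Rint_prod n (h : 'I_n -> R -> R) : (forall i, Rintegrable lam (h i)) ->
  Rintegrable (mu n) (fun x => \prod_i h i (x ord0 i)) /\
  \int[mu n]_x (\prod_i h i (x ord0 i)) = \prod_i \int[lam]_t h i t.
Proof.
elim: n => [|n IH] in h *.
  move=> _; have E : (fun x : 'rV[R]_0 => \prod_i h i (x ord0 i)) = fun=> 1.
    by apply/funext => x; rewrite big_ord0.
  rewrite E big_ord0 Rint_rV0; split => //.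
  rewrite /Rintegrable; apply/integrableP; split; first exact: measurable_cst.
  by rewrite /= integral_dirac//= diracT mul1e normr1 ltry.
move=> ih; have [iH EH] := IH (fun j => h (lift ord0 j)) (fun j => ih _).
pose P (y : 'rV[R]_n) := \prod_(i < n) h (lift ord0 i) (y ord0 i).
have E x y : \prod_i h i (vcons x y ord0 i) = h ord0 x * P y.
  rewrite big_ord_recl vcons0; congr (_ * _).
  by apply: eq_bigr => j _; rewrite vcons_lift.
have mh i : measurable_fun [set: measurableTypeR R] (h i) := Rintegrable_measurable (ih i).
have mF : measurable_fun [set: 'rV[R]_n.+1] (fun x => \prod_i h i (x ord0 i)).
  apply: measurable_prod => i _; exact: (measurableT_comp (mh i) (measurable_coord i)).
have iF : Rintegrable (mu n.+1) (fun x => \prod_i h i (x ord0 i)).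
  apply/integrableP; split; first exact/measurable_EFinP.
  rewrite ge0_integral_vcons//; last by apply: measurableT_comp => //; exact/measurable_EFinP.
  have iP : Rintegrable (mu n) (fun y => `|P y|) := integrable_norm iH.
  have ih0 : Rintegrable lam (fun x => `|h ord0 x|) := integrable_norm (ih ord0).
  have iG := RintegrableZ (\int[mu n]_y `|P y|) ih0.
  rewrite [ltLHS](@eq_integral _ _ _ lam _ (fun x => (\int[mu n]_y `|P y| * `|h ord0 x|)%:E)).
    by rewrite -(EFin_Rint iG) ltry.
  move=> x _; rewrite mulrC -RintZ// EFin_Rint; last exact: RintegrableZ.
  by apply: eq_integral => y _; rewrite /= E normrM.
have iFx x : Rintegrable (mu n) (fun y => \prod_i h i (vcons x y ord0 i)).
  by rewrite (funext (E x)); exact: RintegrableZ.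
split => //; rewrite Rint_vcons// big_ord_recl -EH mulrC -RintZ; last exact: ih.
by apply: eq_Rint => x; rewrite (eq_Rint (mu n) (E x)) RintZ// mulrC.
Qed.

Let tensM n (b : 'I_n -> bool) o o' x : tens a b o x * tens a b o' x =
  \prod_i ((if o == Some i then hermite1 a (b i) (x ord0 i) else hermite0 a (b i) (x ord0 i)) *
           (if o' == Some i then hermite1 a (b i) (x ord0 i) else hermite0 a (b i) (x ord0 i))).
Proof. by rewrite big_split. Qed.

Let tens_prod n (b : 'I_n -> bool) o o' :=
  Rint_prod (h := fun i t =>
    (if o == Some i then hermite1 a (b i) t else hermite0 a (b i) t) *
    (if o' == Some i then hermite1 a (b i) t else hermite0 a (b i) t))
  (fun i => Rintegrable_hermite a0 (b i) (o == Some i) (o' == Some i)).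

Lemma L2_tens n (b : 'I_n -> bool) o : L2 (mu n) (tens a b o).
Proof.
split; first exact: measurable_tens.
by rewrite (funext (tensM b o o)); exact: (tens_prod b o o).1.
Qed.

Lemma ip_tens n (b : 'I_n -> bool) o o' : o != o' -> ip (mu n) (tens a b o) (tens a b o') = 0.
Proof.
move=> oo'; rewrite /ip (eq_Rint (mu n) (tensM b o o')) (tens_prod b o o').2.
have [i Hi] : exists i, (o == Some i) != (o' == Some i).
  case: o o' oo' => [i|] [j|] // ij.
  - by exists i; rewrite eqxx (eq_sym (Some j)) (negbTE ij).
  - by exists i; rewrite eqxx.
  - by exists j; rewrite eqxx.
rewrite (bigD1 i)//=; apply/eqP; rewrite mulf_eq0; apply/orP; left; apply/eqP.
case: (o == _) (o' == _) Hi => [] [] // _; last exact: Rint_hermite01.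
by rewrite -[RHS](Rint_hermite01 a0 (b i)); apply: eq_Rint => x; rewrite mulrC.
Qed.

(** Not an equality: the state excited in a half-line coordinate is 0. The bound is all that
    projection requires and treats every coordinate alike. *)
Lemma ip_tens_le1 n (b : 'I_n -> bool) o : ip (mu n) (tens a b o) (tens a b o) <= 1.
Proof.
rewrite /ip (eq_Rint (mu n) (tensM b o o)) (tens_prod b o o).2.
rewrite -[leRHS](@big1_eq _ 1 *%R 'I_n (index_enum _) xpredT).
apply: ler_prod => i _; case: (o == _).
  by rewrite Rint_hermite11//; case: (b i) => /=; rewrite ?lexx ?ler01.
by rewrite Rint_hermite00// lexx ler01.
Qed.

End product_integral.

(** * Limits of test functions in the norm of the completion *)

Section L2_limit.
Context (R : realType) (n : nat) (b : 'I_n -> bool).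
Notation mu := (lebesgue_rV R n).
Notation ip := (ip mu).
Notation L2 := (L2 mu).
Notation norm2 h := (ip h h).

Lemma C1_boxB M N f g p q : C1_box b M f p -> C1_box b N g q ->
  C1_box b (M + N) (fun x : 'rV[R]_n => f x - g x) (fun i x => p i x - q i x).
Proof.
have BB F G : bounded_box M F -> bounded_box N G -> 0 < M -> 0 < N ->
    bounded_box (M + N) (fun x : 'rV[R]_n => F x - G x).
  move=> [mF FM Fs] [mG GN Gs] M0 N0; split.
  - exact: measurable_funB.
  - by move=> x; rewrite (le_trans (ler_normB _ _))// lerD.
  - move=> x FG i; have [F0|F0] := eqVneq (F x) 0.
      by rewrite (le_trans (Gs x _ i)) ?lerDr ?ltW//; apply: contra_neq FG; rewrite F0 => ->; rewrite subr0.
    by rewrite (le_trans (Fs x F0 i))// lerDl ltW.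
move=> [M0 Bf Bp fs df cp] [N0 Bg Bq gs dg cq]; split.
- exact: addr_gt0.
- exact: BB.
- by move=> i; exact: BB.
- move=> x i bi xi.
  have [|-> p0] := fs x i bi; first by rewrite (lt_le_trans xi)// lef_pV2 ?posrE ?addr_gt0// lerDl ltW.
  have [|-> q0] := gs x i bi; first by rewrite (lt_le_trans xi)// lef_pV2 ?posrE ?addr_gt0// lerDr ltW.
  by split=> [|j]; rewrite ?p0 ?q0 subrr.
- by move=> x i t; exact: is_deriveB.
- by move=> x i t; apply: continuousB; [exact: cp|exact: cq].
Qed.

Lemma L2_bbox F : bbox F -> L2 F.
Proof. by move=> BF; split; [exact: (bbox_bound BF).1|apply: bbox_int; exact: bboxM]. Qed.

Lemma norm2_coord i f : ip (fun x : 'rV[R]_n => x ord0 i * f x) (fun x => x ord0 i * f x) =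
  \int[mu]_x (f x * (x ord0 i ^+ 2 * f x)).
Proof. by apply: eq_Rint => x; ring. Qed.

(** The uncertainty principle in one coordinate is the nonnegativity of the squared norm of
    [annih_at], rewritten by [box_energy]. *)
Lemma box_heisenberg a M f p i : 0 < a -> C1_box b M f p ->
  (2^-1 + (b i)%:R) * norm2 f <=
  (a * norm2 (p i) + norm2 (fun x => x ord0 i * f x) / a) / 2.
Proof.
move=> a0 C1f; rewrite -subr_ge0 norm2_coord.
have := box_energy a0 i C1f; rewrite div1r => <-.
by apply: Rint_ge0 => x; rewrite -expr2 sqr_ge0.
Qed.

Lemma norm2_triangle h f g : L2 (fun x => h x - f x) -> L2 (fun x => h x - g x) ->
  norm2 (fun x => f x - g x) <=
  2 * (norm2 (fun x => h x - f x) + norm2 (fun x => h x - g x)).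
Proof.
move=> Lf Lg; rewrite -RintD; [|exact: Lf.2|exact: Lg.2].
have L : L2 (fun x => f x - g x).
  rewrite (_ : (fun x => _) = fun x => (h x - g x) - (h x - f x)); first exact: L2B.
  by apply/funext => x; ring.
rewrite -RintZ; last by apply: RintegrableD; [exact: Lf.2|exact: Lg.2].
apply: le_Rint; first exact: L.2.
  by apply: RintegrableZ; apply: RintegrableD; [exact: Lf.2|exact: Lg.2].
by move=> x; have := sqr_ge0 ((h x - f x) + (h x - g x)); nra.
Qed.

Section approximation.
Variables (U : 'rV[R]_n -> R) (G : 'I_n -> 'rV[R]_n -> R) (M : nat -> R)
  (f : nat -> 'rV[R]_n -> R) (p : nat -> 'I_n -> 'rV[R]_n -> R) (i0 : 'I_n).
Hypotheses (bi0 : b i0) (mU : measurable_fun [set: 'rV[R]_n] U)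
  (U_supp : forall x : 'rV[R]_n, U x != 0 -> 0 < x ord0 i0)
  (C1f : forall j, C1_box b (M j) (f j) (p j)).
Hypotheses (LG : forall i j, L2 (fun x => G i x - p j i x))
  (nG : forall i j, norm2 (fun x => G i x - p j i x) <= harmonic j)
  (LX : forall i j, L2 (fun x => x ord0 i * U x - x ord0 i * f j x))
  (nX : forall i j, norm2 (fun x => x ord0 i * U x - x ord0 i * f j x) <= harmonic j).

Let Lf j : L2 (f j). Proof. by apply: L2_bbox; exact: (C1_box_bbox (C1f j)).1. Qed.

Let Lp j i : L2 (p j i). Proof. by apply: L2_bbox; exact: (C1_box_bbox (C1f j)).2. Qed.

Let Lxf j i : L2 (fun x => x ord0 i * f j x).
Proof.
apply: L2_bbox; apply: (@bbox_coord R n i (fun t => t) (f j)); last exact: (C1_box_bbox (C1f j)).1.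
by move=> x; exact: cvg_id.
Qed.

(** The norm of the completion contains no plain L2 term; the uncertainty principle at [a = 1]
    recovers one for differences. It does not yet identify the limit with [U]. *)
Let f_cauchy j l : norm2 (fun x => f j x - f l x) <= 4 * (harmonic j + harmonic l).
Proof.
have := box_heisenberg i0 ltr01 (C1_boxB (C1f j) (C1f l)).
have := norm2_triangle (LG i0 j) (LG i0 l); have := norm2_triangle (LX i0 j) (LX i0 l).
rewrite (_ : (fun x : 'rV[R]_n => x ord0 i0 * (f j x - f l x)) =
             (fun x : 'rV[R]_n => x ord0 i0 * f j x - x ord0 i0 * f l x)); last first.
  by apply/funext => x; rewrite mulrBr.
have := nG i0 j; have := nG i0 l; have := nX i0 j; have := nX i0 l; rewrite bi0.
have := ip_ge0 mu (fun x => f j x - f l x); rewrite mul1r divr1.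
move: (harmonic j) (harmonic l) => hj hl /=.
by do 6![move: (ip _ _) => ?]; lra.
Qed.

Let A m := [set x : 'rV[R]_n | harmonic m <= x ord0 i0].

Let mA m : measurable (A m).
Proof.
rewrite (_ : A m = (fun x : 'rV[R]_n => x ord0 i0 : measurableTypeR R) @^-1` `[harmonic m, +oo[).
  by rewrite -[X in measurable X]setTI; exact: measurable_coord.
by apply/seteqP; split => x /=; rewrite in_itv/= andbT.
Qed.

Let mUf j : measurable_fun [set: 'rV[R]_n] (fun x => (U x - f j x) * (U x - f j x)).
Proof. by apply: measurable_funM; apply: measurable_funB => //; exact: (Lf j).1. Qed.

(** Where [x_(i0) >= 1 / (m + 1)] the moment controls [U - f_l] up to the factor [(m + 1)^2].
    Passing through [f_l] and letting [l] tend to infinity with [m] fixed removes that factor, so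
    the bound does not depend on [m]. *)
Let UfA j m : (\int[mu]_(x in A m) ((U x - f j x) * (U x - f j x))%:E <=
  (8 * harmonic j)%:E)%E.
Proof.
have bound l : (\int[mu]_(x in A m) ((U x - f j x) * (U x - f j x))%:E <=
    (8 * harmonic j + (8 + 2 * m.+1%:R ^+ 2) * harmonic l)%:E)%E.
  pose H (x : 'rV[R]_n) := 2 * m.+1%:R ^+ 2 * ((x ord0 i0 * U x - x ord0 i0 * f l x) *
    (x ord0 i0 * U x - x ord0 i0 * f l x)) + 2 * ((f j x - f l x) * (f j x - f l x)).
  have Lfjl := L2B (Lf j) (Lf l).
  have iH1 := RintegrableZ (2 * m.+1%:R ^+ 2) (LX i0 l).2.
  have iH2 := RintegrableZ 2 Lfjl.2.
  have iH : Rintegrable mu H := RintegrableD iH1 iH2.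
  have H0 x : 0 <= H x.
    by rewrite addr_ge0// mulr_ge0// -?expr2 ?sqr_ge0// mulr_ge0// sqr_ge0.
  apply: (@le_trans _ _ (\int[mu]_(x in A m) (H x)%:E)%E).
    apply: ge0_le_integral => //.
    - by move=> x _; rewrite lee_fin -expr2 sqr_ge0.
    - by apply/measurable_EFinP; exact: measurable_funTS.
    - by apply/measurable_EFinP; apply: measurable_funTS; exact: Rintegrable_measurable iH.
    move=> x /= Ax; rewrite lee_fin /H.
    have : 1 <= m.+1%:R * x ord0 i0 by rewrite mulrC -ler_pdivrMr// div1r.
    move: (x ord0 i0) (m.+1%:R : R) => t N Nt.
    have : 1 <= (N * t) ^+ 2 by rewrite exprn_ege1.
    have := sqr_ge0 ((U x - f l x) + (f j x - f l x)).
    have := sqr_ge0 (U x - f l x).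
    rewrite (_ : 2 * N ^+ 2 * _ = 2 * ((N * t) ^+ 2 * (U x - f l x) ^+ 2)); last by ring.
    by move: ((N * t) ^+ 2) => q; nra.
  apply: (@le_trans _ _ (\int[mu]_x (H x)%:E)%E).
    apply: ge0_subset_integral => //.
      by apply/measurable_EFinP; exact: Rintegrable_measurable iH.
    by move=> x _; rewrite lee_fin.
  rewrite -(EFin_Rint iH) lee_fin /H RintD// !RintZ//; last 2 first.
  - exact: Lfjl.2.
  - exact: (LX i0 l).2.
  have := nX i0 l; have := f_cauchy j l; rewrite -/(ip _ _) -/(ip _ _).
  have : 0 <= m.+1%:R ^+ 2 :> R by rewrite sqr_ge0.
  move: (m.+1%:R ^+ 2 : R) => q; nra.
have C : (8 * harmonic j + (8 + 2 * m.+1%:R ^+ 2) * (harmonic l : R))%:E @[l --> \oo] --> (8 * (harmonic j : R))%:E.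
  apply/fine_cvgP; split; first exact: nearW.
  rewrite -[X in _ --> X]addr0 -[X in _ --> _ + X](mulr0 (8 + 2 * m.+1%:R ^+ 2)).
  by apply: cvgD; [exact: cvg_cst|apply: cvgM; [exact: cvg_cst|exact: cvg_harmonic]].
by apply: (cvge_to_ge C); exact: nearW.
Qed.

(** Monotone convergence in [m]. Outside the union of the [A m] the coordinate [i0] is nonpositive,
    and both [U] and [f j] vanish. *)
Let Uf j : L2 (fun x => U x - f j x) /\
  norm2 (fun x => U x - f j x) <= 8 * harmonic j.
Proof.
have E : (\int[mu]_x ((U x - f j x) * (U x - f j x))%:E <= (8 * harmonic j)%:E)%E.
  rewrite (_ : (\int[mu]_x _)%E = (\int[mu]_(x in \bigcup_m A m) ((U x - f j x) * (U x - f j x))%:E)%E).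
    have C : (\int[mu]_(x in A m) ((U x - f j x) * (U x - f j x))%:E)%E @[m --> \oo] -->
        (\int[mu]_(x in \bigcup_m A m) ((U x - f j x) * (U x - f j x))%:E)%E.
      apply: ge0_nondecreasing_set_cvg_integral => //.
      - move=> m l ml; apply/subsetPset => x; apply: le_trans.
        by rewrite /harmonic lef_pV2 ?posrE// ler_nat.
      - by move=> m; apply/measurable_EFinP; exact: measurable_funTS.
      - by move=> m x _; rewrite lee_fin -expr2 sqr_ge0.
    by apply: (cvge_to_le C); apply: nearW => m; exact: UfA.
  rewrite [RHS]integral_mkcond; apply: eq_integral => x _.
  rewrite patchE; case: ifPn => // /negP xA.
  have x0 : x ord0 i0 <= 0.
    rewrite leNgt; apply/negP => x0; apply: xA; rewrite inE.
    have [m _ /(_ m (leqnn m)) Hm] := near_infty_natSinv_lt (PosNum x0).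
    by exists m => //=; exact: ltW.
  have -> : U x = 0 by apply/eqP/negPn/negP => /U_supp; rewrite ltNge x0.
  have -> : f j x = 0.
    case: (C1f j) => M0 _ _ /(_ x i0 bi0) fs _ _.
    by apply: (fs _).1; rewrite (le_lt_trans x0)// invr_gt0.
  by rewrite subrr mul0r.
by apply: L2_le E; apply: measurable_funB => //; exact: (Lf j).1.
Qed.

Lemma L2_limit : L2 U.
Proof.
rewrite (_ : U = fun x => (U x - f 0%N x) + f 0%N x); first by apply: L2D => //; exact: (Uf 0).1.
by apply/funext => x; ring.
Qed.

Lemma L2_partial_limit i : L2 (G i).
Proof.
rewrite (_ : G i = fun x => (G i x - p 0%N i x) + p 0%N i x); first exact: L2D.
by apply/funext => x; ring.
Qed.

Lemma L2_coord_limit i : L2 (fun x => x ord0 i * U x).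
Proof.
rewrite (_ : (fun x => _) = fun x : 'rV[R]_n =>
    (x ord0 i * U x - x ord0 i * f 0%N x) + x ord0 i * f 0%N x).
  exact: L2D.
by apply/funext => x; ring.
Qed.

Let cvg0 (F : nat -> R) C : (forall j, 0 <= F j) -> (forall j, F j <= C * harmonic j) ->
  F @ \oo --> (0 : R).
Proof.
move=> F0 FC; apply: (@squeeze_cvgr _ _ _ _ (cst 0) (fun j => C * harmonic j)).
- by apply: nearW => j; rewrite F0 FC.
- exact: cvg_cst.
- rewrite -[X in _ --> X](mulr0 C).
  by apply: cvgM; [exact: cvg_cst|exact: cvg_harmonic].
Qed.

Let cvgU : norm2 (fun x => U x - f j x) @[j --> \oo] --> (0 : R).
Proof. by apply: (@cvg0 _ 8) => j; [exact: ip_ge0|exact: (Uf j).2]. Qed.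

Let cvg_norm : norm2 (f j) @[j --> \oo] --> norm2 U.
Proof. exact: ip_sqr_cvg L2_limit Lf cvgU. Qed.

Let cvg_coef (a : R) o : 0 < a -> coef a b (f j) o @[j --> \oo] --> ip U (tens a b o).
Proof. by move=> a0; apply: (ip_cvg L2_limit Lf cvgU); exact: L2_tens. Qed.

Let cvg_partial i : norm2 (p j i) @[j --> \oo] --> norm2 (G i).
Proof.
apply: (ip_sqr_cvg (L2_partial_limit i) (fun j => Lp j i)).
by apply: (@cvg0 _ 1) => j; [exact: ip_ge0|rewrite mul1r; exact: nG].
Qed.

Let cvg_coord i : norm2 (fun x => x ord0 i * f j x) @[j --> \oo] -->
  norm2 (fun x => x ord0 i * U x).
Proof.
apply: (ip_sqr_cvg (L2_coord_limit i) (fun j => Lxf j i)).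
by apply: (@cvg0 _ 1) => j; [exact: ip_ge0|rewrite mul1r; exact: nX].
Qed.

Let cvg_energy (a : R) i : (a * norm2 (p j i) + norm2 (fun x => x ord0 i * f j x) / a) / 2
  @[j --> \oo] --> (a * norm2 (G i) + norm2 (fun x => x ord0 i * U x) / a) / 2.
Proof.
apply: cvgM; last exact: cvg_cst.
by apply: cvgD; apply: cvgM; [exact: cvg_cst|exact: cvg_partial|exact: cvg_coord|exact: cvg_cst].
Qed.

Lemma limit_heisenberg (a : R) i : 0 < a ->
  (2^-1 + (b i)%:R) * norm2 U <=
  (a * norm2 (G i) + norm2 (fun x => x ord0 i * U x) / a) / 2.
Proof.
move=> a0.
have cL : (2^-1 + (b i)%:R) * norm2 (f j) @[j --> \oo] --> (2^-1 + (b i)%:R) * norm2 U.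
  by apply: cvgM; [exact: cvg_cst|exact: cvg_norm].
apply: (ler_cvg_to cL (@cvg_energy a i)).
by apply: nearW => j; apply: box_heisenberg.
Qed.

Lemma limit_gap (a : R) : 0 < a ->
  2 * norm2 U - 2 * ip U (tens a b None) ^+ 2 - \sum_j ip U (tens a b (Some j)) ^+ 2 <=
  \sum_i ((a * norm2 (G i) + norm2 (fun x => x ord0 i * U x) / a) / 2 -
          (2^-1 + (b i)%:R) * norm2 U).
Proof.
move=> a0; have cC o : coef a b (f j) o ^+ 2 @[j --> \oo] --> ip U (tens a b o) ^+ 2.
  by rewrite !expr2; apply: cvgM; exact: cvg_coef.
have cL : 2 * norm2 (f j) - 2 * coef a b (f j) None ^+ 2 - \sum_i coef a b (f j) (Some i) ^+ 2
    @[j --> \oo] -->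
    2 * norm2 U - 2 * ip U (tens a b None) ^+ 2 - \sum_j ip U (tens a b (Some j)) ^+ 2.
  apply: cvgB; last by apply: cvg_big => [|i _]; [exact: add_continuous|exact: cC].
  by apply: cvgB; apply: cvgM; try exact: cvg_cst; [exact: cvg_norm|exact: cC].
have cR : \sum_i ((a * norm2 (p j i) + norm2 (fun x => x ord0 i * f j x) / a) / 2 -
          (2^-1 + (b i)%:R) * norm2 (f j)) @[j --> \oo] -->
    \sum_i ((a * norm2 (G i) + norm2 (fun x => x ord0 i * U x) / a) / 2 -
          (2^-1 + (b i)%:R) * norm2 U).
  apply: cvg_big => [|i _]; first exact: add_continuous.
  apply: cvgB; first exact: cvg_energy.
  by apply: cvgM; [exact: cvg_cst|exact: cvg_norm].
apply: (ler_cvg_to cL cR); apply: nearW => j.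
apply: le_trans (box_gap a0 (C1f j)) _; apply: ler_sum => i _.
by rewrite (box_energy a0 i (C1f j)) norm2_coord div1r.
Qed.

End approximation.

End L2_limit.

(** * The deficit *)

Section orthogonal_projection.
Context d (T : measurableType d) (R : realType) (mu : {measure set T -> \bar R}).
Notation ip := (ip mu).
Notation L2 := (L2 mu).

(* The c_i e_i are subtracted one at a time, since orthogonality keeps the
   remaining coefficients unchanged. *)
Lemma ip_projection (I : eqType) (s : seq I) (e : I -> T -> R) f : uniq s ->
  L2 f -> (forall i, L2 (e i)) -> (forall i, ip (e i) (e i) <= 1) ->
  (forall i j, i != j -> ip (e i) (e j) = 0) ->
  let g x := f x - \sum_(i <- s) ip f (e i) * e i x in
  [/\ L2 g, forall j, j \notin s -> ip g (e j) = ip f (e j) &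
      ip g g <= ip f f - \sum_(i <- s) ip f (e i) ^+ 2].
Proof.
move=> + Lf Le e1 eo; elim: s => [_|i s IH /= /andP[si us]].
  rewrite (_ : (fun x => _) = f); last by apply/funext => x; rewrite big_nil subr0.
  by split => //; rewrite big_nil subr0.
have [Lg gj gg] := IH us; move: Lg gj gg; set g := (fun x => _) => Lg gj gg.
rewrite (_ : (fun x => _) = fun x => g x + (- ip f (e i)) * e i x); last first.
  by apply/funext => x; rewrite big_cons /g; ring.
have LZ := L2Z (- ip f (e i)) (Le i).
split.
- exact: L2D.
- move=> j; rewrite inE negb_or => /andP[ji js].
  by rewrite ipDl// ipZl// eo 1?eq_sym// mulr0 addr0 gj.
- rewrite big_cons ip_sqrD// (ipC mu g (fun x => _ * _)) !ipZl// (ipC mu (e i) g) gj//.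
  rewrite (ipC mu (e i) (fun x => _ * _)) ipZl//.
  (* Subtracting [c e_i] changes the squared norm by [- 2 c^2 + c^2 |e_i|^2], at most [- c^2] even
     when [e_i] is shorter than a unit vector. *)
  have := e1 i; have := sqr_ge0 (ip f (e i)).
  by move: (ip f (e i)) (ip (e i) (e i)) gg => c q; nra.
Qed.

End orthogonal_projection.

(** * The product states on the orthant *)

Definition half_coord n k (i : 'I_n) : bool := (n - k <= i)%N.

Section gauss_monomial_tens.
Context (R : realType) (n k : nat) (alpha : R).
Hypothesis alpha0 : 0 < alpha.
Notation a := (alpha ^+ 2).
Notation b := (@half_coord n k).

Let a0 : 0 < a. Proof. exact: exprn_gt0. Qed.

Let kappa := \prod_i (hermite0_norm a (b i))^-1.

Let tens_None_orthant (x : 'rV[R]_n) : orthant k x ->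
  tens a b None x = kappa * gauss_monomial k alpha x.
Proof.
move=> Ox; rewrite /tens /gauss_monomial.
have -> : expR (- (2 * alpha ^+ 2)^-1 * sqnorm x) = \prod_i gauss_root a (x ord0 i).
  rewrite -expR_sum; congr expR; rewrite /sqnorm /rV_dot mulr_sumr.
  by apply: eq_bigr => i _; rewrite -expr2 mulNr mulrC.
rewrite [X in _ * (_ * X)]big_mkcond /= -!big_split/=.
apply: eq_bigr => i _; rewrite /hermite0.
have -> : (if b i then pos_part (x ord0 i) else 1) = if (n - k <= i)%N then x ord0 i else 1.
  by rewrite /half_coord; case: ifP => // /Ox xi; rewrite /pos_part xi.
by rewrite mulrC.
Qed.

Let tens_Some_orthant (x : 'rV[R]_n) j : orthant k x ->
  tens a b (Some j) x =
  (if b j then 0 else kappa * hermite0_norm a false / hermite1_norm a) *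
  (x ord0 j * gauss_monomial k alpha x).
Proof.
move=> Ox; case: ifPn => bj.
  by rewrite mul0r /tens (bigD1 j)//= eqxx /hermite1 bj mul0r.
have := tens_None_orthant Ox; rewrite /tens (bigD1 j)//= => E.
rewrite (bigD1 j)//= eqxx (eq_bigr (fun i => hermite0 a (b i) (x ord0 i))); last first.
  by move=> i ij; case: eqP => // -[ji]; rewrite ji eqxx in ij.
have n0 := lt0r_neq0 (hermite0_norm_gt0 a0 false).
have n1 := lt0r_neq0 (hermite1_norm_gt0 a0).
(* On the line the first excitation is the ground state times a multiple of the coordinate, so only
   one factor of the product changes. *)
rewrite (_ : hermite1 _ _ _ = hermite0 a (b j) (x ord0 j) *
   (hermite0_norm a false / hermite1_norm a * x ord0 j)); last first.
  by rewrite /hermite1 /hermite0 (negbTE bj); field; rewrite n0 n1.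
by rewrite mulrAC E; ring.
Qed.

Lemma tens_off_orthant (x : 'rV[R]_n) o : ~ orthant k x -> tens a b o x = 0.
Proof.
move=> /existsNP[i /not_implyP[bi /negP]]; rewrite -leNgt => xi.
rewrite /tens (bigD1 i)//=; case: ifP => _.
  by rewrite /hermite1 /half_coord bi mul0r.
by rewrite /hermite0 /half_coord bi /pos_part ltNge xi /= mulr0 !mul0r.
Qed.

(** The vanishing of [kappa (Some i)] on half-line coordinates is what places the optimal vector in
    [R^(n-k) x {0}^k]. *)
Lemma tens_orthant : exists kappa : option 'I_n -> R,
  [/\ forall i, b i -> kappa (Some i) = 0,
      forall x : 'rV[R]_n, orthant k x -> tens a b None x = kappa None * gauss_monomial k alpha x &
      forall (x : 'rV[R]_n) i, orthant k x ->
        tens a b (Some i) x = kappa (Some i) * (x ord0 i * gauss_monomial k alpha x)].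
Proof.
exists (fun o => if o is Some j then
  if b j then 0 else kappa * hermite0_norm a false / hermite1_norm a else kappa).
by split => // i ->.
Qed.

End gauss_monomial_tens.

(** * Elements of the completion *)

Section completion.
Context (R : realType) (n k : nat) (u : 'rV[R]_n -> R) (gradu : 'rV[R]_n -> 'rV[R]_n).
Notation mu := (lebesgue_rV R n).
Notation ip := (ip mu).
Notation L2 := (L2 mu).
Notation norm2 h := (ip h h).
Notation O := (orthant k : set 'rV[R]_n).
Notation b := (@half_coord n k).
Notation U := (u \_ O).
Notation G i := ((fun x => gradu x ord0 i) \_ O).

Lemma integral_restrict (F : 'rV[R]_n -> R) :
  (\int[mu]_(x in O) (F x)%:E = \int[mu]_x ((F \_ O) x)%:E)%E.
Proof.
by rewrite integral_mkcond; apply: eq_integral => x _; rewrite !patchE; case: ifP.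
Qed.

Lemma integral_sum_sqr (h : 'I_n -> 'rV[R]_n -> R) :
  (forall i, measurable_fun [set: 'rV[R]_n] (h i)) ->
  (\int[mu]_x (\sum_i h i x * h i x)%:E = \sum_i \int[mu]_x (h i x * h i x)%:E)%E.
Proof.
move=> mh; under eq_integral do rewrite -sumEFin.
rewrite ge0_integral_sum//.
- by move=> i; apply/measurable_EFinP; exact: measurable_funM.
- by move=> i x _; rewrite lee_fin -expr2 sqr_ge0.
Qed.

Lemma moment_sum v : measurable_fun [set: 'rV[R]_n] (v \_ O) ->
  (moment k v = \sum_i \int[mu]_x ((x ord0 i * (v \_ O) x) * (x ord0 i * (v \_ O) x))%:E)%E.
Proof.
move=> mv; rewrite -integral_sum_sqr => [|i]; last first.
  by apply: measurable_funM => //; exact: measurable_coord.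
rewrite /moment integral_restrict; apply: eq_integral => x _.
rewrite !patchE; case: ifP => _; last by rewrite big1// => i _; rewrite !mulr0.
by rewrite /sqnorm /rV_dot mulr_suml; congr EFin; apply: eq_bigr => i _; ring.
Qed.

Lemma dirichlet_sum (g : 'rV[R]_n -> 'rV[R]_n) : (forall i, measurable_fun [set: 'rV[R]_n] ((fun x => g x ord0 i) \_ O)) ->
  (dirichlet k g = \sum_i \int[mu]_x
    (((fun x => g x ord0 i) \_ O) x * ((fun x => g x ord0 i) \_ O) x)%:E)%E.
Proof.
move=> mg; rewrite -integral_sum_sqr// /dirichlet integral_restrict; apply: eq_integral => x _.
rewrite !patchE; case: ifP => xO; first by congr EFin; apply: eq_bigr => i _; rewrite patchE xO.
by rewrite big1// => i _; rewrite patchE xO mulr0.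
Qed.

Hypothesis hu : in_S k u gradu.

Let mO : measurable O.
Proof. by case: hu => -[[_ oO _] _ _] _; exact: open_measurable_rV. Qed.

Lemma measurable_in_S : measurable_fun [set: 'rV[R]_n] (u \_ O) /\
  forall i, measurable_fun [set: 'rV[R]_n] ((fun x => gradu x ord0 i) \_ O).
Proof.
case: hu => -[[mu_ _ _] mg _] _; split => [|i]; first exact: (measurable_restrictT u mO).1 mu_.
by apply: (measurable_restrictT _ mO).1; case: (mg i).
Qed.

Lemma poweR_half_le (x : \bar R) e : (0 <= x)%E -> 0 <= e ->
  (x `^ 2^-1 <= e%:E)%E -> (x <= (e ^+ 2)%:E)%E.
Proof.
case: x => [r| |] //=; last by rewrite invr_eq0 pnatr_eq0/= leye_eq.
rewrite !lee_fin => r0 e0; rewrite powR12_sqrt// => re.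
by rewrite -(sqr_sqrtr r0) lerXn2r// nnegrE sqrtr_ge0.
Qed.

(** Approximants are selected with norm at most [harmonic j], which gives an explicit rate. Only
    differences are shown square integrable here, as nothing is known yet about [u] itself. *)
Lemma in_S_approx : exists M f, forall j,
  [/\ C1_box b (M j) (f j) (fun i => partial i (f j)),
      forall i, (fun h => L2 h /\ norm2 h <= harmonic j)
        (fun x => ((fun x => gradu x ord0 i) \_ O) x - partial i (f j) x) &
      forall i, (fun h => L2 h /\ norm2 h <= harmonic j)
        (fun x => x ord0 i * (u \_ O) x - x ord0 i * f j x)].
Proof.
have [mU mG] := measurable_in_S.
case: hu => _ [f [tf cf]].
suff H j : exists Mf, [/\ C1_box b Mf.1 Mf.2 (fun i => partial i Mf.2),
      forall i, (fun h => L2 h /\ norm2 h <= harmonic j)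
        (fun x => ((fun x => gradu x ord0 i) \_ O) x - partial i Mf.2 x) &
      forall i, (fun h => L2 h /\ norm2 h <= harmonic j)
        (fun x => x ord0 i * (u \_ O) x - x ord0 i * Mf.2 x)].
  have [Mf HMf] := choice H.
  by exists (fun j => (Mf j).1), (fun j => (Mf j).2).
have h0 : 0 < harmonic j :> R by rewrite invr_gt0.
have [l Hl] : exists l, (S_norm k (fun x => u x - f l x)%R (fun x => gradu x - grad (f l) x)%R
    <= (harmonic j)%:E)%E.
  move: cf => /fine_cvgP[fin] /cvgr0_norm_le /(_ _ h0) nle.
  have [l _ /(_ l (leqnn l))[Fl Nl]] := filterI fin nle.
  by exists l; rewrite -(fineK Fl) lee_fin (le_trans (ler_norm _)).
have [M C1f] := test_function_C1 (tf l).
exists (M, f l) => /=.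
have off x : (x \in O) = false -> f l x = 0 /\ forall i, partial i (f l) x = 0.
  move=> /negbT/negP xO; have /existsNP[i /not_implyP[bi /negP]] : ~ O x.
    by move=> Ox; apply: xO; rewrite inE.
  rewrite -leNgt => xi; case: C1f => M0 _ _ supp _ _.
  by apply: (supp x i bi); rewrite (le_lt_trans xi)// invr_gt0.
have Eu : (fun x => u x - f l x) \_ O = fun x => (u \_ O) x - f l x.
  apply/funext => x; rewrite !patchE; case: ifPn => // /negbTE xO.
  by rewrite (off x xO).1 subr0.
have Eg i : (fun x => (gradu x - grad (f l) x) ord0 i) \_ O =
    fun x => ((fun x => gradu x ord0 i) \_ O) x - partial i (f l) x.
  apply/funext => x; rewrite !patchE; case: ifPn => [_|/negbTE xO]; first by rewrite !mxE.
  by rewrite (off x xO).2 subr0.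
have [Bf Bp] := C1_box_bbox C1f.
have mUf : measurable_fun [set: 'rV[R]_n] (fun x => (u \_ O) x - f l x).
  by apply: measurable_funB => //; exact: (bbox_bound Bf).1.
have mGp i : measurable_fun [set: 'rV[R]_n] (fun x => ((fun x => gradu x ord0 i) \_ O) x - partial i (f l) x).
  by apply: measurable_funB => //; exact: (bbox_bound (Bp i)).1.
have D0 (v : 'rV[R]_n -> 'rV[R]_n) : (0 <= dirichlet k v :> \bar R)%E.
  by apply: integral_ge0 => x _; rewrite lee_fin; apply: sumr_ge0 => i _; rewrite -expr2 sqr_ge0.
have M0 (v : 'rV[R]_n -> R) : (0 <= moment k v :> \bar R)%E.
  apply: integral_ge0 => x _; rewrite lee_fin mulr_ge0 ?sqr_ge0//.
  by apply: sumr_ge0 => i _; rewrite -expr2 sqr_ge0.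
(* The norm bounds square roots of the integrals, so the integrals are at most the square of the
   rate, hence at most the rate since it does not exceed 1. *)
have h2 : ((harmonic j ^+ 2)%:E <= (harmonic j)%:E :> \bar R)%E.
  by rewrite lee_fin expr2 ler_piMl ?(ltW h0)// /harmonic invf_le1// ler1n.
have /(poweR_half_le (D0 _) (ltW h0)) := le_trans (leeDl _ (poweR_ge0 _ _)) Hl.
have /(poweR_half_le (M0 _) (ltW h0)) := le_trans (leeDr _ (poweR_ge0 _ _)) Hl.
rewrite moment_sum ?Eu// dirichlet_sum => [Hm Hd|i]; last by rewrite Eg.
split => // i; apply: L2_le => //.
- apply: le_trans (le_trans Hd h2); rewrite (bigD1 i)//= Eg leeDl//.
  by apply: sume_ge0 => m _; apply: integral_ge0 => x _; rewrite lee_fin -expr2 sqr_ge0.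
- rewrite (_ : (fun x => _) = fun x : 'rV[R]_n => x ord0 i * ((u \_ O) x - f l x)); last first.
    by apply/funext => x; rewrite mulrBr.
  by apply: measurable_funM => //; exact: measurable_coord.
- apply: le_trans (le_trans Hm h2); rewrite (bigD1 i)//=.
  rewrite [leLHS](@eq_integral _ _ _ mu _ (fun x : 'rV[R]_n =>
     ((x ord0 i * ((u \_ O) x - f l x)) * (x ord0 i * ((u \_ O) x - f l x)))%:E)); last first.
    by move=> x _ /=; rewrite (mulrBr (x ord0 i)).
  rewrite leeDl//.
  by apply: sume_ge0 => m _; apply: integral_ge0 => x _; rewrite lee_fin -expr2 sqr_ge0.
Qed.

Hypothesis hk : (1 <= k <= n)%N.

(** The last coordinate is a half-line one because [k >= 1]; it is positive on the orthant, so the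
    moment dominates a weight that vanishes nowhere there. *)
Let i0 : 'I_n.
Proof. by exists n.-1; case: n hk => //; case: k. Defined.

Let bi0 : b i0.
Proof. by rewrite /half_coord /=; case/andP: hk => k0 kn; lia. Qed.

Let U_supp (x : 'rV[R]_n) : U x != 0 -> 0 < x ord0 i0.
Proof. by rewrite patchE; case: ifP => [|_]; rewrite ?eqxx// inE => Ox _; exact: (Ox i0 bi0). Qed.

Lemma in_S_ineq :
  [/\ L2 U, forall i, L2 (G i), forall i, L2 (fun x => x ord0 i * U x),
      forall (a : R) i, 0 < a -> (2^-1 + (b i)%:R) * norm2 U <=
        (a * norm2 (G i) + norm2 (fun x => x ord0 i * U x) / a) / 2 &
      forall a : R, 0 < a ->
        2 * norm2 U - 2 * ip U (tens a b None) ^+ 2 - \sum_j ip U (tens a b (Some j)) ^+ 2 <=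
        \sum_i ((a * norm2 (G i) + norm2 (fun x => x ord0 i * U x) / a) / 2 -
                (2^-1 + (b i)%:R) * norm2 U)].
Proof.
have [mU _] := measurable_in_S.
have [M [f H]] := in_S_approx.
have C1f j : C1_box b (M j) (f j) (fun i => partial i (f j)) by case: (H j).
have LG i j : L2 (fun x => (G i) x - partial i (f j) x) by case: (H j) => _ /(_ i)[].
have nG i j : norm2 (fun x => (G i) x - partial i (f j) x) <= harmonic j.
  by case: (H j) => _ /(_ i)[].
have LX i j : L2 (fun x => x ord0 i * U x - x ord0 i * f j x) by case: (H j) => _ _ /(_ i)[].
have nX i j : norm2 (fun x => x ord0 i * U x - x ord0 i * f j x) <= harmonic j.
  by case: (H j) => _ _ /(_ i)[].
split.
- exact: (L2_limit bi0 mU U_supp C1f LG nG LX nX).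
- by move=> i; exact: (L2_partial_limit C1f LG).
- by move=> i; exact: (L2_coord_limit C1f LX).
- by move=> a i; exact: (limit_heisenberg bi0 mU U_supp C1f LG nG LX nX).
- by move=> a; exact: (limit_gap bi0 mU U_supp C1f LG nG LX nX).
Qed.

Lemma integral_L2 h : L2 h -> (\int[mu]_x (h x * h x)%:E)%E = (norm2 h)%:E.
Proof. by move=> Lh; rewrite -(EFin_Rint Lh.2). Qed.

Lemma dirichlet_in_S : dirichlet k gradu = (\sum_i norm2 (G i))%:E.
Proof.
have [_ mG] := measurable_in_S; have [_ LG _ _ _] := in_S_ineq.
by rewrite dirichlet_sum// -sumEFin; apply: eq_bigr => i _; rewrite integral_L2.
Qed.

Lemma moment_in_S : moment k u = (\sum_i norm2 (fun x => x ord0 i * U x))%:E.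
Proof.
have [mU _] := measurable_in_S; have [_ _ LX _ _] := in_S_ineq.
by rewrite moment_sum// -sumEFin; apply: eq_bigr => i _; rewrite integral_L2.
Qed.

(** [V] is the extension of [W] by 0, which turns a distance over the orthant into a norm on the
    whole space. *)
Lemma integral_sqr_diff (V W : 'rV[R]_n -> R) : (forall x, O x -> V x = W x) ->
  (forall x, ~ O x -> V x = 0) -> L2 (fun x => U x - V x) ->
  (\int[mu]_(x in O) ((u x - W x) ^+ 2)%:E)%E = (norm2 (fun x => U x - V x))%:E.
Proof.
move=> VW V0 LV; rewrite -integral_L2// integral_restrict; apply: eq_integral => x _.
rewrite !patchE; case: ifPn => [|/negP xO]; first by rewrite inE => /VW ->; rewrite expr2.
by rewrite V0 ?subrr ?mulr0// => Ox; apply: xO; rewrite inE.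
Qed.

Lemma integral_sqr_in_S : (\int[mu]_(x in O) (u x ^+ 2)%:E)%E = (norm2 U)%:E.
Proof.
have [LU _ _ _ _] := in_S_ineq.
have E : (fun x => U x - 0) = U by apply/funext => x; rewrite subr0.
by under eq_integral do rewrite -[u _]subr0; rewrite (@integral_sqr_diff (cst 0)) ?E.
Qed.

Lemma norm2_in_S_gt0 : ~ {ae mu, forall x, O x -> u x = 0} -> 0 < norm2 U.
Proof.
move=> hu0; have [LU _ _ _ _] := in_S_ineq; rewrite lt_neqAle ip_ge0 andbT eq_sym.
apply/negP => /eqP N0; apply: hu0.
have : (\int[mu]_x `|(U x * U x)%:E| = 0)%E.
  rewrite -[RHS]/(0%:E) -N0 -integral_L2//; apply: eq_integral => x _.
  by rewrite /= ger0_norm// -expr2 sqr_ge0.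
move=> /(ae_eq_integral_abs mu measurableT).
case=> [|N [mN N0' sub]].
  by apply/measurable_EFinP; apply: measurable_funM; exact: LU.1.
exists N; split => // x /= ux; apply: sub => /= H; apply: ux => Ox.
by have := H I; rewrite patchE mem_set// => -[/eqP]; rewrite mulf_eq0 orbb => /eqP.
Qed.

End completion.

(** * The optimal scale and the deficit *)

Section deficit.
Context (R : realType) (n k : nat) (u : 'rV[R]_n -> R) (gradu : 'rV[R]_n -> 'rV[R]_n).
Notation mu := (lebesgue_rV R n).
Notation ip := (ip mu).
Notation norm2 h := (ip h h).
Notation O := (orthant k : set 'rV[R]_n).
Notation b := (@half_coord n k).
Notation U := (u \_ O).
Notation G i := ((fun x => gradu x ord0 i) \_ O).
Hypotheses (hk : (1 <= k <= n)%N) (hu : in_S k u gradu).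
Let D := \sum_i norm2 (G i).
Let M := \sum_i norm2 (fun x => x ord0 i * U x).

(** The total ground energy: 1/2 for each of the [n - k] lines and 3/2 for each of the [k] half
    lines. *)
Lemma sum_half_coord : \sum_i (2^-1 + (b i)%:R) = (n + 2 * k)%:R / 2 :> R.
Proof.
have E : (\sum_i (b i : nat) = k)%N.
  rewrite -[RHS](@subKn k n); last by case/andP: hk.
  rewrite -[RHS]muln1 -sum_nat_const_nat big_geq_mkord [RHS]big_mkcond/=.
  by apply: eq_bigr => i _; rewrite /half_coord; case: ifP.
rewrite big_split/= sumr_const card_ord -natr_sum E natrD natrM -mulr_natl.
by field.
Qed.

Lemma energy_sum (a : R) :
  \sum_i (a * norm2 (G i) + norm2 (fun x => x ord0 i * U x) / a) / 2 = (a * D + M / a) / 2.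
Proof. by rewrite -mulr_suml big_split/= -mulr_sumr -mulr_suml. Qed.

(** The constant [(n + 2 k) / 2] is weakened to 1, enough to show that the Dirichlet integral and
    the moment are positive. *)
Lemma uncertainty (a : R) : 0 < a -> norm2 U <= (a * D + M / a) / 2.
Proof.
move=> a0; have [_ _ _ heis _] := in_S_ineq hu hk.
rewrite -energy_sum; apply: (@le_trans _ _ (\sum_i (2^-1 + (b i)%:R) * norm2 U)).
  rewrite -mulr_suml sum_half_coord ler_peMl ?ip_ge0// ler_pdivlMr// mul1r ler_nat.
  by case/andP: hk; lia.
by apply: ler_sum => i _; exact: heis.
Qed.

Lemma dirichlet_moment_gt0 : 0 < norm2 U -> 0 < D /\ 0 < M.
Proof.
have D0 : 0 <= D by apply: sumr_ge0 => i _; exact: ip_ge0.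
have M0 : 0 <= M by apply: sumr_ge0 => i _; exact: ip_ge0.
(* If one of [D] and [M] were 0, the scale [a] could be chosen to make the remaining term less than
   [N], against the uncertainty principle; adding 1 avoids dividing by 0. *)
have frac (c N : R) : 0 <= c -> 0 < N -> ~ N <= c * (N / (c + 1)) / 2.
  move=> c0 N0; have q1 : c / (c + 1) <= 1 by rewrite ler_pdivrMr ?mul1r ?lerDl// ltr_wpDl.
  have : N * (c / (c + 1)) <= N by rewrite ler_piMr// ltW.
  by rewrite mulrCA; lra.
move: (norm2 U) uncertainty => N unc N0.
split; rewrite lt_neqAle eq_sym ?D0 ?M0 andbT; apply/eqP => E.
- have a0 : 0 < (M + 1) / N by rewrite divr_gt0// ltr_wpDl.
  by have := unc _ a0; rewrite E mulr0 add0r invf_div; exact: frac.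
- have a0 : 0 < N / (D + 1) by rewrite divr_gt0// ltr_wpDl.
  by have := unc _ a0; rewrite E mul0r addr0 (mulrC _ D); exact: frac.
Qed.

Variable alpha : R.
Hypothesis halpha : alpha = (fine (moment k u) / fine (dirichlet k gradu)) `^ 4^-1.
Hypothesis u_neq0 : ~ {ae mu, forall x, O x -> u x = 0}.

Let DM : 0 < D /\ 0 < M.
Proof. by apply: dirichlet_moment_gt0; exact: (norm2_in_S_gt0 hu hk). Qed.

Lemma alpha_gt0 : 0 < alpha.
Proof.
have [D0 M0] := DM.
by rewrite halpha (moment_in_S hu hk) (dirichlet_in_S hu hk) powR_gt0 ?divr_gt0.
Qed.

(** Since [alpha^4 = M / D], the two summands are equal: this is the equality case of the
    arithmetic-geometric inequality. *)
Lemma alpha_energy : (alpha ^+ 2 * D + M / alpha ^+ 2) / 2 = Num.sqrt D * Num.sqrt M.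
Proof.
have [D0 M0] := DM; have a0 := alpha_gt0.
have -> : alpha ^+ 2 = Num.sqrt M / Num.sqrt D.
  rewrite halpha (moment_in_S hu hk) (dirichlet_in_S hu hk) expr2 -powRD.
    rewrite (_ : 4^-1 + 4^-1 = 2^-1); last by field.
    by rewrite powR12_sqrt ?divr_ge0 ?ltW// sqrtrM ?ltW// sqrtrV ?ltW.
  by apply/implyP => _; rewrite gt_eqF// divr_gt0.
have sD : Num.sqrt D != 0 by rewrite gt_eqF// sqrtr_gt0.
have sM : Num.sqrt M != 0 by rewrite gt_eqF// sqrtr_gt0.
move: sD sM (sqr_sqrtr (ltW D0)) (sqr_sqrtr (ltW M0)).
move: (Num.sqrt D) (Num.sqrt M) => s t sD sM ED EM; rewrite -ED -EM.
by field; rewrite sD sM.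
Qed.

Lemma energy_product : (dirichlet k gradu `^ 2^-1 * moment k u `^ 2^-1)%E =
  (Num.sqrt D * Num.sqrt M)%:E.
Proof.
have [D0 M0] := DM.
by rewrite (moment_in_S hu hk) (dirichlet_in_S hu hk) !poweR_EFin !powR12_sqrt ?ltW.
Qed.

End deficit.

Local Open Scope ereal_scope.

Theorem theorem5p4 (R : realType) (n k : nat)
    (hn : (1 <= n)%N) (hk : (1 <= k <= n)%N)
    (u : 'rV[R]_n -> R) (gradu : 'rV[R]_n -> 'rV[R]_n)
    (hu : in_S k u gradu)
    (hu0 : ~ {ae lebesgue_rV R n, forall x, orthant k x -> u x = 0%R})
    (alpha : R)
    (halpha : alpha = ((fine (moment k u) / fine (dirichlet k gradu)) `^ 4^-1)%R) :
  dirichlet k gradu `^ 2^-1 * moment k u `^ 2^-1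
  - ((n + 2 * k)%:R / 2)%:E
    * \int[lebesgue_rV R n]_(x in orthant k) (u x ^+ 2)%:E
  - ereal_inf [set \int[lebesgue_rV R n]_(x in orthant k)
                     ((u x - c * gauss_monomial k alpha x) ^+ 2)%:E
              | c in [set: R]]
  >= ereal_inf [set \int[lebesgue_rV R n]_(x in orthant k)
                      ((u x - (cd.1 + rV_dot cd.2 x)
                              * gauss_monomial k alpha x) ^+ 2)%:E
               | cd in [set cd : R * 'rV[R]_n |
                         forall i : 'I_n, (n - k <= i)%N ->
                           cd.2 ord0 i = 0%R]].
Proof.
pose a := (alpha ^+ 2)%R; have alpha0 := alpha_gt0 hk hu halpha hu0.
have a0 : (0 < a)%R by rewrite exprn_gt0.
have [LU _ _ _ /(_ a a0) gap] := in_S_ineq hu hk.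
have [kappa [kappa0 kN kS]] := tens_orthant n k alpha0.
pose mu := lebesgue_rV R n; pose O : set 'rV[R]_n := orthant k.
pose T := tens a (@half_coord n k); pose c o := ip mu (u \_ O) (T o).
(* The infima are bounded by evaluating at the projection on a list of states: [[:: None]] for the
   first one, all of them for the second. *)
have proj s W : uniq s -> (forall x, O x -> (\sum_(o <- s) c o * T o x)%R = W x) ->
    \int[mu]_(x in O) ((u x - W x) ^+ 2)%:E <=
    (ip mu (u \_ O) (u \_ O) - \sum_(o <- s) c o ^+ 2)%:E.
  move=> us sW.
  have [|||Lg _ gg] := @ip_projection _ _ _ mu _ s T _ us LU.
  - by move=> o; exact: L2_tens.
  - by move=> o; exact: ip_tens_le1.
  - by move=> o o'; exact: ip_tens.
  rewrite (integral_sqr_diff sW _ Lg) ?lee_fin// => x Ox.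
  by rewrite big1// => o _; rewrite /T tens_off_orthant// mulr0.
have inf1 : ereal_inf [set \int[mu]_(x in O) ((u x - c' * gauss_monomial k alpha x) ^+ 2)%:E
    | c' in [set: R]] <= (ip mu (u \_ O) (u \_ O) - c None ^+ 2)%:E.
  have := proj [:: None] (fun x => (c None * kappa None) * gauss_monomial k alpha x)%R isT.
  rewrite big_seq1 => H; apply: le_trans (H _).
    by apply: ereal_inf_lbound; exists (c None * kappa None)%R.
  by move=> x Ox; rewrite big_seq1 /T kN// mulrA.
pose s := None :: [seq Some i | i <- index_enum 'I_n].
have us : uniq s.
  rewrite /= map_inj_uniq ?index_enum_uniq ?andbT; last by move=> ? ? [].
  by apply/mapP => -[].
(* The coefficients of the projection, rescaled from the normalised states to [gauss_monomial] and
   its products with the coordinates. *)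
pose cd := ((c None * kappa None)%R, (\row_i (c (Some i) * kappa (Some i)))%R : 'rV[R]_n).
have inf2 : ereal_inf [set \int[mu]_(x in O) ((u x - (cd.1 + rV_dot cd.2 x)
                              * gauss_monomial k alpha x) ^+ 2)%:E
               | cd in [set cd : R * 'rV[R]_n |
                         forall i : 'I_n, (n - k <= i)%N -> cd.2 ord0 i = 0%R]] <=
    (ip mu (u \_ O) (u \_ O) - c None ^+ 2 - \sum_i c (Some i) ^+ 2)%:E.
  have := proj s (fun x => (cd.1 + rV_dot cd.2 x) * gauss_monomial k alpha x)%R us.
  rewrite big_cons big_map opprD addrA => H; apply: le_trans (H _).
    apply: ereal_inf_lbound; exists cd => // i bi.
    by rewrite mxE kappa0// mulr0.
  move=> x Ox; rewrite big_cons big_map mulrDl mulr_suml /T kN// mulrA.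
  congr (_ + _)%R; apply: eq_bigr => i _; rewrite kS// mxE; ring.
rewrite (energy_product hk hu hu0) (integral_sqr_in_S hu hk).
(* Both infima are replaced by their upper bounds, the one that is subtracted included; what remains
   is [gap] with its right-hand side evaluated at the optimal scale. *)
apply: le_trans inf2 _; apply: le_trans (leeB (lexx _) inf1).
rewrite -EFinM -!EFinB lee_fin; move: gap.
rewrite sumrB energy_sum -mulr_suml sum_half_coord// (alpha_energy hk hu halpha hu0).
rewrite -/T -/(c None) -/mu -/O.
rewrite (eq_bigr (fun i => c (Some i) ^+ 2)%R)//.
lra.
Qed.
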